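(* Let $\alpha\in[0,1)$, $a\in\mathbb{C}$, $\gamma\in\mathbb{R}$. The transmission coefficient $T_{\alpha,a,\gamma}(E)$ and the reflection coefficient $R_{\alpha,a,\gamma}(E)$ at energy $E>0$ for the transmission protocol governed by the Hamiltonian $H_{\alpha,a}^{[\gamma]}$ (defined in the context) are given by $$T_{\alpha,a,\gamma}(E)=\left|\frac{E^{\frac{1+\alpha}{2}}(1+e^{\mathrm{i}\pi\alpha})\,\Gamma(\frac{1-\alpha}{2})\,\overline a}{E^{\frac{1+\alpha}{2}}\Gamma(\frac{1-\alpha}{2})(1+|a|^2)+\mathrm{i}\,\gamma\,2^{1+\alpha}e^{\mathrm{i}\frac\pi2\alpha}\Gamma(\frac{3+\alpha}{2})}\right|^2,$$ $$R_{\alpha,a,\gamma}(E)=\left|\frac{E^{\frac{1+\alpha}{2}}\Gamma(\frac{1-\alpha}{2})(1-|a|^2e^{\mathrm{i}\pi\alpha})+\mathrm{i}\,\gamma\,2^{1+\alpha}e^{\mathrm{i}\frac\pi2\alpha}\Gamma(\frac{3+\alpha}{2})}{E^{\frac{1+\alpha}{2}}\Gamma(\frac{1-\alpha}{2})(1+|a|^2)+\mathrm{i}\,\gamma\,2^{1+\alpha}e^{\mathrm{i}\frac\pi2\alpha}\Gamma(\frac{3+\alpha}{2})}\right|^2.$$ They satisfy $T_{\alpha,a,\gamma}(E)+R_{\alpha,a,\gamma}(E)=1$, and when $\gamma=0$ they are independent of $E$. The scattering is reflection-less ($R_{\alpha,a,\gamma}(E)=0$) when $$E=\left(\frac{2^{1+\alpha}\,\gamma\,\Gamma(\frac{3+\alpha}{2})\sin\frac\pi2\alpha}{\Gamma(\frac{1-\alpha}{2})(1-\cos\pi\alpha)}\right)^{\frac{2}{1+\alpha}},$$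 provided that $\alpha\in(0,1)$, $|a|=1$, and $\gamma>0$. In the high energy limit the scattering is independent of $\gamma$ and $$\lim_{E\to+\infty}T_{\alpha,a,\gamma}(E)=\frac{2|a|^2(1+\cos\pi\alpha)}{(1+|a|^2)^2},\qquad\lim_{E\to+\infty}R_{\alpha,a,\gamma}(E)=\frac{1+|a|^4-2|a|^2\cos\pi\alpha}{(1+|a|^2)^2},$$ whereas in the low energy limit, for $\gamma\neq0$, $\lim_{E\downarrow0}T_{\alpha,a,\gamma}(E)=0$ and $\lim_{E\downarrow0}R_{\alpha,a,\gamma}(E)=1$.
   Context: $\Gamma(\cdot)$ is the Euler Gamma function. Let $M=(\mathbb{R}\setminus\{0\})_x\times\mathbb{S}^1_y$ with $\mathbb{S}^1=\mathbb{R}/2\pi\mathbb{Z}$, $\mathrm{d}\mu_\alpha=|x|^{-\alpha}\mathrm{d}x\,\mathrm{d}y$, and $\Delta_\alpha=\partial_x^2+|x|^{2\alpha}\partial_y^2-\frac{\alpha}{x}\partial_x$ (the Laplace-Beltrami operator of the metric $\mathrm{d}x^2+|x|^{-2\alpha}\mathrm{d}y^2$). $H_{\alpha,a}^{[\gamma]}$ is the self-adjoint extension of $-\Delta_\alpha|_{C_c^\infty(M)}$ in $L^2(M,\mathrm{d}\mu_\alpha)$ acting as $-\Delta_\alpha$ with the boundary conditions, for a.e. $y$, $$f_0^+(y)=a\,f_0^-(y),\qquad f_1^-(y)+\overline a\,f_1^+(y)=\gamma f_0^-(y),\qquad(\ast)$$ where $f_0^\pm(y)=\lim_{x\to0^\pm}f(x,y)$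 and $f_1^\pm(y)=\pm(1+\alpha)^{-1}\lim_{x\to0^\pm}|x|^{-\alpha}\partial_xf(x,y)$. Scattering coefficients. Scattering takes place only among states constant in $y$, which at large $|x|$ behave as $|x|^{\alpha/2}e^{\pm\mathrm{i}x\sqrt E}$. For incidence from $+\infty$ at energy $E>0$, let $f=f(x)$ be the solution of $-\Delta_\alpha f=Ef$ on $\mathbb{R}\setminus\{0\}$ satisfying $(\ast)$ and having asymptotics $f(x)\sim|x|^{\alpha/2}\big(e^{-\mathrm{i}x\sqrt E}+r\,e^{\mathrm{i}x\sqrt E}\big)$ as $x\to+\infty$ and $f(x)\sim|x|^{\alpha/2}\,t\,e^{-\mathrm{i}x\sqrt E}$ as $x\to-\infty$, for some $r,t\in\mathbb{C}$; the transmission and reflection coefficients are $|t|^2$ and $|r|^2$. For incidence from $-\infty$ they are defined in the mirror-symmetric way: $f(x)\sim|x|^{\alpha/2}\big(e^{\mathrm{i}x\sqrt E}+r\,e^{-\mathrm{i}x\sqrt E}\big)$ as $x\to-\infty$ and $f(x)\sim|x|^{\alpha/2}\,t\,e^{\mathrm{i}x\sqrt E}$ as $x\to+\infty$. $T_{\alpha,a,\gamma}(E)$ and $R_{\alpha,a,\gamma}(E)$ denote these coefficients, which are the same for incidence from either end. Equivalently, writing $f=|x|^{\alpha/2}g$, the function $g$ solves $-g''+\frac{\alpha(2+\alpha)}{4x^2}g=Eg$ on $\mathbb{R}\setminus\{0\}$, with boundary conditions $g_0^+=a g_0^-$, $g_1^-+\overline a g_1^+=\gamma g_0^-$ for $g_0^\pm=\lim_{x\to0^\pm}|x|^{\alpha/2}g(x)$,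 $g_1^\pm=\lim_{x\to0^\pm}|x|^{-(1+\alpha/2)}(g(x)-g_0^\pm|x|^{-\alpha/2})$. *)

(* Defs.v *)
From Stdlib Require Import Reals ClassicalEpsilon.
From Coquelicot Require Import Coquelicot.

Open Scope R_scope.

(* The Euler Gamma function; only meaningful for [0 < s], where the improper
   integral converges. *)
Definition Gamma (s : R) : R :=
  RInt_gen (fun u => Rpower u (s - 1) * exp (- u))
    (at_right 0) (Rbar_locally p_infty).

Definition cis (theta : R) : C := (cos theta, sin theta).

(* Coquelicot's [Derive] is real-valued only; this is the derivative of a
   complex-valued function of a real variable, total like [Derive]. *)
Definition deriv (f : R -> C) (x : R) : C :=
  (Derive (fun s => Re (f s)) x, Derive (fun s => Im (f s)) x).

(* Functions on M = (R \ {0}) x S^1 are functions [F x y], 2 pi-periodic in [y];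
   their values at [x = 0] are never used. *)
Definition Laplace_Beltrami (alpha : R) (F : R -> R -> C) (x y : R) : C :=
  (deriv (deriv (fun s => F s y)) x
   + RtoC (Rpower (Rabs x) (2 * alpha)) * deriv (deriv (fun s => F x s)) y
   - RtoC (alpha / x) * deriv (fun s => F s y) x)%C.

Definition twice_differentiable_on_M (F : R -> R -> C) : Prop :=
  forall x y : R, x <> 0 ->
    ex_derive (fun s => F s y) x /\ ex_derive (deriv (fun s => F s y)) x /\
    ex_derive (fun s => F x s) y /\ ex_derive (deriv (fun s => F x s)) y.

(* The boundary conditions at x = 0 for the slice f = F(., y) at a given y,
   existence of the four limits included. *)
Definition boundary_condition (alpha : R) (a : C) (gamma : R) (f : R -> C)
    : Prop :=
  exists f0p f0m f1p f1m : C,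
    filterlim f (at_right 0) (locally f0p) /\
    filterlim f (at_left 0) (locally f0m) /\
    filterlim
      (fun x => (RtoC (/ (1 + alpha) * Rpower (Rabs x) (- alpha))
                 * deriv f x)%C)
      (at_right 0) (locally f1p) /\
    filterlim
      (fun x => (- (RtoC (/ (1 + alpha) * Rpower (Rabs x) (- alpha))
                 * deriv f x))%C)
      (at_left 0) (locally f1m) /\
    f0p = (a * f0m)%C /\
    (f1m + Cconj a * f1p)%C = (RtoC gamma * f0m)%C.

(* f(x) ~ |x|^(alpha/2) g(x) along the filter [A], read as
   f(x) = |x|^(alpha/2) (g(x) + o(1)): a ratio would be ill-defined since [g],
   a combination of plane waves, may vanish. *)
Definition asymptotic (alpha : R) (A : (R -> Prop) -> Prop) (f g : R -> C)
    : Prop :=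
  filterlim (fun x => (RtoC (Rpower (Rabs x) (- (alpha / 2))) * f x - g x)%C)
    A (locally (RtoC 0)).

Inductive incidence : Set := from_plus_infinity | from_minus_infinity.

Definition scattering_asymptotics (d : incidence) (alpha E : R)
    (f : R -> C) (r t : C) : Prop :=
  match d with
  | from_plus_infinity =>
      asymptotic alpha (Rbar_locally p_infty) f
        (fun x => cis (- (x * sqrt E)) + r * cis (x * sqrt E))%C /\
      asymptotic alpha (Rbar_locally m_infty) f
        (fun x => t * cis (- (x * sqrt E)))%C
  | from_minus_infinity =>
      asymptotic alpha (Rbar_locally m_infty) f
        (fun x => cis (x * sqrt E) + r * cis (- (x * sqrt E)))%C /\
      asymptotic alpha (Rbar_locally p_infty) f
        (fun x => t * cis (x * sqrt E))%C
  end.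

(* [f] is constant in y, so the boundary conditions, required for a.e. y,
   are one and the same condition on [f] for every y. *)
Definition scattering_state (d : incidence) (alpha : R) (a : C) (gamma E : R)
    (f : R -> C) (r t : C) : Prop :=
  twice_differentiable_on_M (fun x _ => f x) /\
  (forall x y : R, x <> 0 ->
     (- Laplace_Beltrami alpha (fun x' _ => f x') x y)%C
     = (RtoC E * f x)%C) /\
  boundary_condition alpha a gamma f /\
  scattering_asymptotics d alpha E f r t.

(* Well defined once the scattering state is known to exist and be unique. *)
Definition transmission (d : incidence) (alpha : R) (a : C) (gamma E : R) : R :=
  epsilon (inhabits 0) (fun T => exists (f : R -> C) (r t : C),
    scattering_state d alpha a gamma E f r t /\ T = (Cmod t) ^ 2).

Definition reflection (d : incidence) (alpha : R) (a : C) (gamma E : R) : R :=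
  epsilon (inhabits 0) (fun P => exists (f : R -> C) (r t : C),
    scattering_state d alpha a gamma E f r t /\ P = (Cmod r) ^ 2).

(* Main.v *)
Require Import Defs.
From Stdlib Require Import Reals Lra ClassicalEpsilon.
From Coquelicot Require Import Coquelicot.

Open Scope R_scope.

(* With nu = (1 + alpha) / 2, the equation f'' - (alpha / x) f' + E f = 0 on x > 0 is
   Bessel's equation for x^(-nu) f.  For E = 1 its outgoing solution is given by the
   integral of exp (i x cosh w) cosh (nu w) dw along the steepest descent path
   w = s + i atan (sinh s), on which cosh w = 1 + i (cosh s - 1 / cosh s).
   Integrating by parts along the path shows that X_alpha = x^nu * (integral) satisfies
   X_alpha' = i x^alpha X_(-alpha), so the flux x^(-alpha) f' is a solution of the same
   kind with alpha replaced by - alpha.  At the origin the integral becomes Euler's integral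
   for Gamma nu, with phase e^(i pi nu / 2), which gives the ratio of the two boundary
   values.  At infinity the amplitudes of X_alpha and X_(-alpha) differ by
   O(x^(-1/2)), which makes the derivative of their sum integrable, so both converge to the
   same limit; the conserved Wronskian shows that it is not 0.  By the Wronskian again, every
   solution on a half line is a combination of the outgoing solution and its conjugate, and
   the boundary conditions become a 2 x 2 linear system for r and t. *)

(** * Complex-valued functions of a real variable *)

(** Since the coefficients are chosen by [epsilon], existence and uniqueness of the scattering state
    must come before any formula, which is why all solutions on each half line have to be described.
    The steepest descent path turns the oscillating integrand into exp (i x) times the real decaying
    factor exp (- x Lam s) times a kernel free of x, so every estimate concerns an absolutely
    convergent real integral. Treating al and - al together keeps all equations of first order and
    makes the order 1 - nu as accessible as nu; alpha < 1 is what keeps both orders positive, hence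
    both Gamma integrals convergent. The limit at infinity is never computed: it is divided out when
    the solution is normalized, and the ratio of the boundary values at 0 does not see it. Only the
    phase conj F0 / F0 stays unknown; it has modulus 1 and merely multiplies r and t. The energy
    enters by the scaling x -> sqrt E x, so the coefficients depend on it only through the number
    [impedance], proportional to E^((1 + alpha) / 2), and the energy limits concern a rational
    function of that number. *)

Definition is_derivC (f : R -> C) (x : R) (l : C) : Prop :=
  is_derive (fun s => Re (f s)) x (Re l) /\
  is_derive (fun s => Im (f s)) x (Im l).

Lemma is_derivC_eq f x l l' : is_derivC f x l -> l = l' -> is_derivC f x l'.
Proof. now intros H <-. Qed.

Lemma is_derivC_deriv f x l : is_derivC f x l -> deriv f x = l.
Proof.
intros [H1 H2]; unfold deriv.
apply injective_projections; [apply (is_derive_unique _ _ _ H1) | apply (is_derive_unique _ _ _ H2)].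
Qed.

(** Passes from componentwise derivatives to [ex_derive] for C as a real normed space, the notion
    used in [twice_differentiable_on_M]; the way back is [ex_derive_is_derivC]. *)
Lemma is_derivC_ex_derive f x l : is_derivC f x l -> ex_derive f x.
Proof.
intros [H1 H2]; exists l.
apply (is_derive_ext (fun s => (Re (f s), Im (f s)))).
  now intros t; destruct (f t).
apply (filterdiff_ext_lin _ (fun y : R => (scal y (Re l), scal y (Im l)))).
  apply (filterdiff_comp_2 (fun s => Re (f s)) (fun s => Im (f s)) (fun a b => (a, b))
    (fun y : R => scal y (Re l)) (fun y : R => scal y (Im l)) (fun a b => (a, b))).
  - exact H1.
  - exact H2.
  - apply (filterdiff_ext (fun t : R * R => t)).
      now intros [u v].
    apply (filterdiff_ext_lin _ (fun t : R * R => t)).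
      apply filterdiff_id.
    now intros [u v].
now intros y; destruct l.
Qed.

Lemma ex_derive_is_derivC f x : ex_derive f x -> is_derivC f x (deriv f x).
Proof.
intros [l H]; unfold deriv.
assert (HR : is_derive (fun s => Re (f s)) x (Re l)).
  apply (filterdiff_ext_lin _ (fun y : R => Re (scal y l))); [|now destruct l].
  apply (filterdiff_comp' f (fun z : C => Re z) x (fun y : R => scal y l) (fun z : C => Re z)).
    exact H.
  apply filterdiff_linear, is_linear_fst.
assert (HI : is_derive (fun s => Im (f s)) x (Im l)).
  apply (filterdiff_ext_lin _ (fun y : R => Im (scal y l))); [|now destruct l].
  apply (filterdiff_comp' f (fun z : C => Im z) x (fun y : R => scal y l) (fun z : C => Im z)).
    exact H.
  apply filterdiff_linear, is_linear_snd.
split; simpl; apply Derive_correct; eexists; eassumption.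
Qed.

Lemma is_derivC_ext_loc f g x l :
  locally x (fun t => f t = g t) -> is_derivC f x l -> is_derivC g x l.
Proof.
intros H [H1 H2]; split.
- apply (is_derive_ext_loc (fun s => Re (f s))); [|easy].
  revert H; apply filter_imp; now intros t ->.
- apply (is_derive_ext_loc (fun s => Im (f s))); [|easy].
  revert H; apply filter_imp; now intros t ->.
Qed.

Lemma is_derivC_const c x : is_derivC (fun _ => c) x 0.
Proof. split; apply (is_derive_const (K := R_AbsRing) (V := R_NormedModule)). Qed.

Lemma is_derivC_plus f g x df dg :
  is_derivC f x df -> is_derivC g x dg ->
  is_derivC (fun s => f s + g s)%C x (df + dg)%C.
Proof.
now intros [? ?] [? ?]; split; simpl;
  apply (is_derive_plus (K := R_AbsRing) (V := R_NormedModule)).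
Qed.

Lemma is_deriveR_mult (u v : R -> R) (x du dv : R) :
  is_derive u x du -> is_derive v x dv ->
  is_derive (fun s => u s * v s) x (du * v x + u x * dv).
Proof.
intros Hu Hv.
apply (is_derive_mult (K := R_AbsRing) u v x du dv Hu Hv).
intros n m; apply Rmult_comm.
Qed.

Lemma is_deriveR_minus (u v : R -> R) (x du dv : R) :
  is_derive u x du -> is_derive v x dv -> is_derive (fun s => u s - v s) x (du - dv).
Proof. apply (is_derive_minus (K := R_AbsRing) (V := R_NormedModule)). Qed.

Lemma is_deriveR_plus (u v : R -> R) (x du dv : R) :
  is_derive u x du -> is_derive v x dv -> is_derive (fun s => u s + v s) x (du + dv).
Proof. apply (is_derive_plus (K := R_AbsRing) (V := R_NormedModule)). Qed.

Lemma is_derive_eq (u : R -> R) (x l l' : R) : is_derive u x l -> l = l' -> is_derive u x l'.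
Proof. now intros H <-. Qed.

Lemma is_derivC_mult f g x df dg :
  is_derivC f x df -> is_derivC g x dg ->
  is_derivC (fun s => f s * g s)%C x (df * g x + f x * dg)%C.
Proof.
intros [H1 H2] [H3 H4]; split; simpl.
- refine (is_derive_eq _ _ _ _ (is_deriveR_minus _ _ _ _ _ (is_deriveR_mult _ _ _ _ _ H1 H3)
    (is_deriveR_mult _ _ _ _ _ H2 H4)) _).
  unfold Re, Im; ring.
- refine (is_derive_eq _ _ _ _ (is_deriveR_plus _ _ _ _ _ (is_deriveR_mult _ _ _ _ _ H1 H4)
    (is_deriveR_mult _ _ _ _ _ H2 H3)) _).
  unfold Re, Im; ring.
Qed.

Lemma is_derivC_cmult c f x df :
  is_derivC f x df -> is_derivC (fun s => c * f s)%C x (c * df)%C.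
Proof.
intros H; eapply is_derivC_eq.
  apply (is_derivC_mult (fun _ => c) f); [apply is_derivC_const | exact H].
ring.
Qed.

Lemma is_derivC_RtoC u x l :
  is_derive u x l -> is_derivC (fun s => RtoC (u s)) x (RtoC l).
Proof.
intros H; split; [exact H|].
apply (is_derive_const (K := R_AbsRing) (V := R_NormedModule) 0 x).
Qed.

Lemma is_derivC_conj f x l :
  is_derivC f x l -> is_derivC (fun s => Cconj (f s)) x (Cconj l).
Proof.
intros [H1 H2]; split; [exact H1|].
now apply (is_derive_opp (K := R_AbsRing) (V := R_NormedModule)) in H2.
Qed.

Lemma is_derivC_comp f u x df du :
  is_derivC f (u x) df -> is_derive u x du ->
  is_derivC (fun s => f (u s)) x (RtoC du * df)%C.
Proof.
intros [H1 H2] Hu; split.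
- apply (is_derive_comp (fun s => Re (f s)) u _ _ _ H1) in Hu.
  evar_last; [exact Hu|]; unfold scal; simpl; unfold mult; simpl.
  destruct df; simpl; ring.
- apply (is_derive_comp (fun s => Im (f s)) u _ _ _ H2) in Hu.
  evar_last; [exact Hu|]; unfold scal; simpl; unfold mult; simpl.
  destruct df; simpl; ring.
Qed.

Lemma is_derivC_cis u x du :
  is_derive u x du -> is_derivC (fun s => cis (u s)) x (Ci * RtoC du * cis (u x))%C.
Proof.
intros H; split; simpl.
- evar_last; [apply (is_derive_comp cos u x _ _ (is_derive_cos _) H)|].
  unfold scal; simpl; unfold mult; simpl; ring.
- evar_last; [apply (is_derive_comp sin u x _ _ (is_derive_sin _) H)|].
  unfold scal; simpl; unfold mult; simpl; ring.
Qed.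

Lemma is_derive_continuity_pt (f : R -> R) (x l : R) : is_derive f x l -> continuity_pt f x.
Proof.
intros H; apply continuity_pt_filterlim.
apply (ex_derive_continuous (K := R_AbsRing) (V := R_NormedModule) f x).
now exists l.
Qed.

Lemma derive_zero_const (u : R -> R) :
  (forall x, 0 < x -> is_derive u x 0) ->
  forall x y, 0 < x -> 0 < y -> u x = u y.
Proof.
intros H x y Hx Hy.
destruct (MVT_gen u y x (fun _ => 0)) as [c [Hc1 Hc2]].
- intros z Hz; apply H.
  apply Rlt_le_trans with (2 := Rlt_le _ _ (proj1 Hz)).
  now apply Rmin_glb_lt.
- intros z Hz; apply is_derive_continuity_pt with 0, H.
  apply Rlt_le_trans with (2 := proj1 Hz).
  now apply Rmin_glb_lt.
- lra.
Qed.

Lemma is_derivC_zero_const (f : R -> C) :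
  (forall x, 0 < x -> is_derivC f x 0) ->
  forall x y, 0 < x -> 0 < y -> f x = f y.
Proof.
intros H x y Hx Hy; apply injective_projections.
- now apply (derive_zero_const (fun s => Re (f s))); [apply H|..].
- now apply (derive_zero_const (fun s => Im (f s))); [apply H|..].
Qed.

(** * Limits of complex-valued functions *)

Lemma filterlim_C {T} (F : (T -> Prop) -> Prop) {FF : Filter F} (f : T -> C) (l : C) :
  filterlim f F (locally l) <->
  filterlim (fun t => Re (f t)) F (locally (Re l)) /\
  filterlim (fun t => Im (f t)) F (locally (Im l)).
Proof.
split.
- destruct l as [a b]; intros H; split.
  + apply filterlim_comp with (1 := H).
    apply (continuous_fst (U := R_UniformSpace) (V := R_UniformSpace) a b).
  + apply filterlim_comp with (1 := H).
    apply (continuous_snd (U := R_UniformSpace) (V := R_UniformSpace) a b).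
- intros [H1 H2].
  apply filterlim_locally; intros eps.
  apply filterlim_locally with (eps := eps) in H1.
  apply filterlim_locally with (eps := eps) in H2.
  generalize (filter_and _ _ H1 H2); apply filter_imp.
  intros t [A B]; now split.
Qed.

Lemma filterlimC_plus {T} (F : (T -> Prop) -> Prop) {FF : Filter F} (f g : T -> C) (l m : C) :
  filterlim f F (locally l) -> filterlim g F (locally m) ->
  filterlim (fun t => f t + g t)%C F (locally (l + m)%C).
Proof.
intros Hf Hg.
apply (filterlim_comp_2 (G := locally l) (H := locally m) f g Cplus Hf Hg).
apply (filterlim_plus (K := C_AbsRing) (V := C_NormedModule) l m).
Qed.

Lemma filterlimR_mult {T} (F : (T -> Prop) -> Prop) {FF : Filter F} (f g : T -> R) (l m : R) :
  filterlim f F (locally l) -> filterlim g F (locally m) ->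
  filterlim (fun t => f t * g t) F (locally (l * m)).
Proof.
intros Hf Hg.
apply (filterlim_comp_2 (G := locally l) (H := locally m) f g Rmult Hf Hg).
apply (filterlim_mult (K := R_AbsRing) l m).
Qed.

Lemma filterlimR_plus {T} (F : (T -> Prop) -> Prop) {FF : Filter F} (f g : T -> R) (l m : R) :
  filterlim f F (locally l) -> filterlim g F (locally m) ->
  filterlim (fun t => f t + g t) F (locally (l + m)).
Proof.
intros Hf Hg.
apply (filterlim_comp_2 (G := locally l) (H := locally m) f g Rplus Hf Hg).
apply (filterlim_plus (K := R_AbsRing) (V := R_NormedModule) l m).
Qed.

Lemma filterlimR_opp {T} (F : (T -> Prop) -> Prop) {FF : Filter F} (f : T -> R) (l : R) :
  filterlim f F (locally l) -> filterlim (fun t => - f t) F (locally (- l)).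
Proof.
intros Hf; apply (filterlim_comp _ _ _ f Ropp _ _ _ Hf).
apply (filterlim_opp (K := R_AbsRing) (V := R_NormedModule) l).
Qed.

Lemma filterlimC_mult {T} (F : (T -> Prop) -> Prop) {FF : Filter F} (f g : T -> C) (l m : C) :
  filterlim f F (locally l) -> filterlim g F (locally m) ->
  filterlim (fun t => f t * g t)%C F (locally (l * m)%C).
Proof.
intros Hf Hg; apply filterlim_C in Hf; apply filterlim_C in Hg; try easy.
destruct Hf, Hg.
apply filterlim_C; [easy|]; split; simpl.
- apply filterlimR_plus; [easy|now apply filterlimR_mult|].
  now apply filterlimR_opp; [|apply filterlimR_mult].
- now apply filterlimR_plus; [|apply filterlimR_mult|apply filterlimR_mult].
Qed.

Lemma filterlimC_conj {T} (F : (T -> Prop) -> Prop) {FF : Filter F} (f : T -> C) (l : C) :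
  filterlim f F (locally l) -> filterlim (fun t => Cconj (f t)) F (locally (Cconj l)).
Proof.
intros Hf; apply filterlim_C in Hf; [|easy]; destruct Hf.
apply filterlim_C; [easy|]; split; [easy|].
now apply filterlimR_opp.
Qed.

Lemma filterlimC_opp {T} (F : (T -> Prop) -> Prop) {FF : Filter F} (f : T -> C) (l : C) :
  filterlim f F (locally l) -> filterlim (fun t => - f t)%C F (locally (- l)%C).
Proof.
intros Hf; apply filterlim_C in Hf; [|easy]; destruct Hf.
apply filterlim_C; [easy|]; split; now apply filterlimR_opp.
Qed.

Lemma filterlimC_Cmod {T} (F : (T -> Prop) -> Prop) {FF : Filter F} (f g : T -> C) :
  filterlim f F (locally (RtoC 0)) -> F (fun t => Cmod (g t) <= Cmod (f t)) ->
  filterlim g F (locally (RtoC 0)).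
Proof.
intros Hf Hg.
apply (filterlim_locally_ball_norm (K := C_AbsRing) (U := C_NormedModule)); intros eps.
apply (filterlim_locally_ball_norm (K := C_AbsRing) (U := C_NormedModule)) with (eps := eps) in Hf.
generalize (filter_and _ _ Hf Hg); apply filter_imp.
intros t [A B]; unfold ball_norm in *.
unfold minus, plus, opp, norm in *; simpl in *.
replace (f t + - RtoC 0)%C with (f t) in A by ring.
replace (g t + - RtoC 0)%C with (g t) by ring.
now apply Rle_lt_trans with (1 := B).
Qed.

(** * The unit circle *)

Lemma cis_plus a b : cis (a + b) = (cis a * cis b)%C.
Proof.
unfold cis, Cmult; simpl; rewrite cos_plus, sin_plus; f_equal; ring.
Qed.

Lemma cis_conj a : Cconj (cis a) = cis (- a).
Proof. unfold cis, Cconj; simpl; now rewrite cos_neg, sin_neg. Qed.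

Lemma cis_0 : cis 0 = 1.
Proof. unfold cis; now rewrite cos_0, sin_0. Qed.

Lemma cis_mult_opp a : (cis a * cis (- a))%C = 1.
Proof. rewrite <- cis_plus, Rplus_opp_r; apply cis_0. Qed.

Lemma cis_neq_0 a : cis a <> 0.
Proof.
intros H; generalize (cis_mult_opp a); rewrite H, Cmult_0_l.
intros K; injection K; lra.
Qed.

Lemma Cmod_cis a : Cmod (cis a) = 1.
Proof.
unfold Cmod, cis; simpl.
replace (_ + _) with 1; [apply sqrt_1|].
generalize (sin2_cos2 a); unfold Rsqr; lra.
Qed.

Lemma cis_PI2 : cis (PI / 2) = Ci.
Proof. unfold cis, Ci; now rewrite cos_PI2, sin_PI2. Qed.

(** * Improper integrals over the half line *)

Lemma mono_bounded_cv (u : R -> R) (x0 M : R) :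
  (forall x y, x0 <= x -> x <= y -> u x <= u y) ->
  (forall x, x0 <= x -> u x <= M) ->
  exists l, filterlim u (Rbar_locally p_infty) (locally l).
Proof.
intros Hm HM.
destruct (completeness (fun z => exists x, x0 <= x /\ z = u x)) as [l [H1 H2]].
- exists M; intros z [x [Hx ->]]; now apply HM.
- exists (u x0), x0; split; [lra | easy].
- exists l; apply filterlim_locally; intros [e He]; simpl.
  destruct (classic (exists x, x0 <= x /\ l - e < u x)) as [[x [Hx Hl]]|N].
  + exists x; intros y Hy.
    assert (u y <= l) by (apply H1; exists y; split; [lra|easy]).
    assert (u x <= u y) by (apply Hm; lra).
    change (Rabs (u y - l) < e); apply Rabs_def1; lra.
  + assert (l <= l - e); [|lra].
    apply H2; intros z [x [Hx ->]].
    apply Rnot_lt_le; intros K; apply N; now exists x.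
Qed.

(** Continuity is bundled in, and on the whole line, so that each [RInt] of such a function exists
    without a range condition. *)
Definition int0 (f : R -> R) (l : R) : Prop :=
  (forall s, continuous f s) /\
  filterlim (fun b => RInt f 0 b) (Rbar_locally p_infty) (locally l).

Lemma ex_RInt_cont (f : R -> R) a b : (forall s, continuous f s) -> ex_RInt f a b.
Proof. intros H; apply (ex_RInt_continuous (V := R_CompleteNormedModule)); intros; apply H. Qed.

Lemma int0_unique f l m : int0 f l -> int0 f m -> l = m.
Proof. intros [_ H1] [_ H2]; exact (filterlim_locally_unique (K := R_AbsRing) (V := R_NormedModule) _ l m H1 H2). Qed.

Lemma int0_ext f g l : (forall s, f s = g s) -> int0 f l -> int0 g l.
Proof.
intros E [H1 H2]; split.
- intros s; apply (continuous_ext f); [exact E | apply H1].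
- apply (filterlim_ext (fun b => RInt f 0 b)); [|exact H2].
  intros b; apply RInt_ext; intros; apply E.
Qed.

Lemma int0_plus f g l m : int0 f l -> int0 g m -> int0 (fun s => f s + g s) (l + m).
Proof.
intros [H1 H2] [H3 H4]; split.
- intros s; apply (continuous_plus (V := R_NormedModule)); [apply H1 | apply H3].
- apply (filterlim_ext (fun b => RInt f 0 b + RInt g 0 b)).
    intros b; symmetry; apply (RInt_plus (V := R_CompleteNormedModule)); now apply ex_RInt_cont.
  now apply filterlimR_plus; [apply Rbar_locally_filter|..].
Qed.

Lemma int0_scal k f l : int0 f l -> int0 (fun s => k * f s) (k * l).
Proof.
intros [H1 H2]; split.
- intros s; apply (continuous_scal_r (V := R_NormedModule)), H1.
- apply (filterlim_ext (fun b => k * RInt f 0 b)).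
    intros b; symmetry; apply (RInt_scal (V := R_CompleteNormedModule)); now apply ex_RInt_cont.
  apply filterlimR_mult; [apply Rbar_locally_filter|apply filterlim_const|exact H2].
Qed.

Lemma int0_minus f g l m : int0 f l -> int0 g m -> int0 (fun s => f s - g s) (l - m).
Proof.
intros H1 H2.
apply (int0_ext (fun s => f s + -1 * g s)); [intros; ring|].
replace (l - m) with (l + -1 * m) by ring.
now apply int0_plus, int0_scal.
Qed.

Lemma int0_derive (G g : R -> R) (l : R) :
  (forall s, is_derive G s (g s)) -> (forall s, continuous g s) ->
  filterlim G (Rbar_locally p_infty) (locally l) -> int0 g (l - G 0).
Proof.
intros HG Hg Hl; split; [exact Hg|].
apply (filterlim_ext (fun b => G b + - G 0)).
- intros b; symmetry.
  apply is_RInt_unique, (is_RInt_derive (V := R_CompleteNormedModule)); intros; [apply HG | apply Hg].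
- apply filterlimR_plus; [apply Rbar_locally_filter|exact Hl|apply filterlim_const].
Qed.

Lemma filterlim_exp_opp d : 0 < d -> filterlim (fun s => exp (- (d * s))) (Rbar_locally p_infty) (locally 0).
Proof.
intros Hd.
apply filterlim_locally; intros [e He]; simpl.
exists (/ (d * e)); intros s Hs.
change (Rabs (exp (- (d * s)) - 0) < e).
rewrite Rminus_0_r, Rabs_pos_eq by apply Rlt_le, exp_pos.
assert (0 < / (d * e)) by (apply Rinv_0_lt_compat; nra).
rewrite exp_Ropp.
assert (K : / e < exp (d * s)).
  apply Rlt_le_trans with (1 + d * s).
  - apply Rmult_lt_compat_l with (r := d) in Hs; [|easy].
    replace (d * / (d * e)) with (/ e) in Hs by (field; lra); lra.
  - destruct (Req_dec (d * s) 0) as [->|N]; [rewrite exp_0; lra|].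
    now apply Rlt_le, exp_ineq1.
rewrite <- (Rinv_inv e).
apply Rinv_lt_contravar; [|exact K].
apply Rmult_lt_0_compat; [now apply Rinv_0_lt_compat | apply exp_pos].
Qed.

Lemma filterlim_0_exp_bound (f : R -> R) C d : 0 < d ->
  (forall s, 0 <= s -> Rabs (f s) <= C * exp (- (d * s))) ->
  filterlim f (Rbar_locally p_infty) (locally 0).
Proof.
intros Hd H; apply filterlim_locally; intros e.
assert (K := filterlim_exp_opp d Hd).
apply (filterlimR_mult _ _ _ C _ (filterlim_const _)) in K.
rewrite Rmult_0_r in K.
apply filterlim_locally with (eps := e) in K.
assert (K2 : Rbar_locally p_infty (fun s => 0 <= s)) by (exists 0; intros; lra).
generalize (filter_and _ _ K K2); apply filter_imp.
intros s [B Hs].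
change (Rabs (f s - 0) < e).
change (Rabs (C * exp (- (d * s)) - 0) < e) in B.
rewrite Rminus_0_r in *.
apply Rle_lt_trans with (2 := B), Rle_trans with (2 := Rle_abs _), H, Hs.
Qed.

Lemma is_derive_exp_opp k d s :
  is_derive (fun s => k * exp (- (d * s))) s (- (k * d) * exp (- (d * s))).
Proof. auto_derive; [easy|ring]. Qed.

Lemma int0_exp C d : 0 < d -> int0 (fun s => C * exp (- (d * s))) (C / d).
Proof.
intros Hd.
replace (C / d) with (0 - (- (C / d)) * exp (- (d * 0))).
- apply (int0_derive (fun s => (- (C / d)) * exp (- (d * s)))).
  + intros s; eapply is_derive_eq; [apply is_derive_exp_opp|].
    field; lra.
  + intros s; apply (ex_derive_continuous (K := R_AbsRing) (V := R_NormedModule)).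
    eexists; apply is_derive_exp_opp.
  + rewrite <- (Rmult_0_r (- (C / d))).
    apply filterlimR_mult; [apply Rbar_locally_filter|apply filterlim_const|].
    now apply filterlim_exp_opp.
- rewrite Rmult_0_r, Ropp_0, exp_0; ring.
Qed.

Lemma int0_le f g l m :
  int0 f l -> int0 g m -> (forall s, 0 <= s -> f s <= g s) -> l <= m.
Proof.
intros [H1 H2] [H3 H4] H.
apply (filterlim_le (F := Rbar_locally p_infty) (fun b => RInt f 0 b) (fun b => RInt g 0 b) l m); try easy.
exists 0; intros b Hb; apply RInt_le; try now apply ex_RInt_cont.
- lra.
- intros; apply H; lra.
Qed.

Lemma int0_abs_le f g l m :
  int0 f l -> int0 g m -> (forall s, 0 <= s -> Rabs (f s) <= g s) -> Rabs l <= m.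
Proof.
intros Hf Hg H; apply Rabs_le; split.
- assert (-1 * m <= l); [|lra].
  apply (int0_le (fun s => -1 * g s) f); [now apply int0_scal|easy|].
  intros s Hs; generalize (H s Hs); intros K; apply Rabs_le_between in K; lra.
- apply (int0_le f g); try easy.
  intros s Hs; generalize (H s Hs); intros K; apply Rabs_le_between in K; lra.
Qed.

(** With g the dominating exponential, f + g is nonnegative, so its partial integrals increase; they
    stay below the integral of 2 g, which is 2 C / d. Subtracting g gives f. *)
Lemma int0_ex f C d :
  0 < d -> (forall s, continuous f s) ->
  (forall s, 0 <= s -> Rabs (f s) <= C * exp (- (d * s))) ->
  exists l, int0 f l.
Proof.
intros Hd Hf HC.
set (g := fun s => C * exp (- (d * s))).
assert (Hg : int0 g (C / d)) by now apply int0_exp.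
destruct Hg as [cg Hg].
assert (Hb : forall s, 0 <= s -> - g s <= f s <= g s).
  intros s Hs; apply Rabs_le_between, HC, Hs.
assert (cfg : forall s, continuous (fun s => f s + g s) s).
  intros s; apply (continuous_plus (V := R_NormedModule)); auto.
destruct (mono_bounded_cv (fun b => RInt (fun s => f s + g s) 0 b) 0 (2 * C / d)) as [l Hl].
- intros x y Hx Hxy.
  rewrite <- (RInt_Chasles (V := R_CompleteNormedModule) _ 0 x y) by now apply ex_RInt_cont.
  change (RInt (fun s => f s + g s) 0 x <= RInt (fun s => f s + g s) 0 x + RInt (fun s => f s + g s) x y).
  assert (0 <= RInt (fun s => f s + g s) x y); [|lra].
  apply RInt_ge_0; [easy|now apply ex_RInt_cont|].
  intros s Hs; generalize (Hb s); lra.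
- intros x Hx.
  apply Rle_trans with (RInt (fun s => 2 * g s) 0 x).
    apply RInt_le; [easy|now apply ex_RInt_cont| |].
    + apply ex_RInt_cont; intros s; apply (continuous_scal_r (V := R_NormedModule)), cg.
    + intros s Hs; generalize (Hb s); lra.
  assert (HR : is_RInt (fun s => 2 * g s) 0 x (minus ((- (2 * C / d)) * exp (- (d * x))) ((- (2 * C / d)) * exp (- (d * 0))))).
    apply (is_RInt_derive (V := R_CompleteNormedModule) (fun s => (- (2 * C / d)) * exp (- (d * s)))).
    + intros s _; eapply is_derive_eq; [apply is_derive_exp_opp|].
      unfold g; field; lra.
    + intros s _; apply (continuous_scal_r (V := R_NormedModule)), cg.
  rewrite (is_RInt_unique _ _ _ _ HR).
  unfold minus, plus, opp; simpl.
  rewrite Rmult_0_r, Ropp_0, exp_0.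
  assert (0 <= C).
    generalize (HC 0 (Rle_refl _)); rewrite Rmult_0_r, Ropp_0, exp_0; generalize (Rabs_pos (f 0)); lra.
  assert (0 <= 2 * C / d).
    apply Rmult_le_pos; [lra | apply Rlt_le, Rinv_0_lt_compat, Hd].
  generalize (exp_pos (- (d * x))); nra.
- exists (l - C / d).
  apply (int0_ext (fun s => (f s + g s) - g s)); [intros; ring|].
  apply int0_minus; now split.
Qed.

(** Serves to differentiate under the integral sign: there the second-order remainder is what can be
    bounded uniformly in h. *)
Lemma is_derive_quadratic (f : R -> R) x l K d :
  0 < d -> (forall h, Rabs h <= d -> Rabs (f (x + h) - f x - h * l) <= K * h ^ 2) ->
  is_derive f x l.
Proof.
intros Hd H.
assert (HK : 0 <= K).
  generalize (H d); rewrite (Rabs_pos_eq d) by lra; intros K1.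
  generalize (Rabs_pos (f (x + d) - f x - d * l)) (K1 (Rle_refl _)); intros P Q.
  assert (0 < d ^ 2) by now apply pow_lt.
  apply Rmult_le_reg_r with (d ^ 2); [easy|lra].
apply is_derive_Reals; intros e He.
assert (Hm : 0 < Rmin d (e / (K + 1))).
  (* [K + 1] replaces [K] to keep the denominator positive when K = 0. *)
  apply Rmin_glb_lt; [easy|]; apply Rmult_lt_0_compat; [easy|apply Rinv_0_lt_compat; lra].
exists (mkposreal _ Hm); intros h Hh0 Hh; simpl in Hh.
assert (Rabs h <= d) by (apply Rlt_le, Rlt_le_trans with (1 := Hh), Rmin_l).
assert (H2 : Rabs h < e / (K + 1)) by (apply Rlt_le_trans with (1 := Hh), Rmin_r).
specialize (H h H0).
replace ((f (x + h) - f x) / h - l) with ((f (x + h) - f x - h * l) / h) by (field; easy).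
unfold Rdiv; rewrite Rabs_mult, Rabs_inv.
assert (Ha : 0 < Rabs h) by now apply Rabs_pos_lt.
apply Rmult_lt_reg_r with (Rabs h); [easy|].
rewrite Rmult_assoc, Rinv_l, Rmult_1_r by lra.
apply Rle_lt_trans with (1 := H).
rewrite <- (pow2_abs h).
apply Rmult_lt_compat_r with (r := K + 1) in H2; [|lra].
unfold Rdiv in H2; rewrite Rmult_assoc, Rinv_l in H2 by lra.
nra.
Qed.

Lemma exp_ge_1_plus z : 1 + z <= exp z.
Proof.
destruct (Req_dec z 0) as [->|N]; [rewrite exp_0; lra|now apply Rlt_le, exp_ineq1].
Qed.

(** The tangent bound at - z gives exp z - 1 <= z exp z, so the remainder is at most z (exp z - 1);
    the sign of z decides how the second factor is bounded. *)
Lemma exp_taylor2 z : Rabs (exp z - 1 - z) <= z ^ 2 * exp (Rabs z).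
Proof.
generalize (exp_ge_1_plus z) (exp_ge_1_plus (- z)) (exp_pos z); intros H1 H2 H3.
rewrite Rabs_pos_eq by lra.
assert (E : exp z * exp (- z) = 1) by (rewrite <- exp_plus, Rplus_opp_r; apply exp_0).
assert (A : exp z - 1 <= z * exp z) by nra.
apply Rle_trans with (z * (exp z - 1)); [lra|].
destruct (Rle_lt_dec 0 z).
- rewrite Rabs_pos_eq by easy; nra.
- rewrite Rabs_left by easy.
  generalize (exp_ge_1_plus (-z)); nra.
Qed.

(** * The steepest descent path *)

Lemma cosh_ge_1 s : 1 <= cosh s.
Proof.
unfold cosh; generalize (exp_ge_1_plus s) (exp_ge_1_plus (- s)); lra.
Qed.

Lemma cosh2_sinh2 s : cosh s ^ 2 = 1 + sinh s ^ 2.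
Proof.
unfold cosh, sinh.
assert (E : exp s * exp (- s) = 1) by (rewrite <- exp_plus, Rplus_opp_r; apply exp_0).
assert (D : ((exp s + exp (- s)) / 2) ^ 2 - ((exp s - exp (- s)) / 2) ^ 2 = exp s * exp (- s)) by field.
lra.
Qed.

Lemma is_derive_cosh s : is_derive cosh s (sinh s).
Proof. unfold cosh, sinh; auto_derive; [easy|field]. Qed.

Lemma is_derive_sinh s : is_derive sinh s (cosh s).
Proof. unfold cosh, sinh; auto_derive; [easy|field]. Qed.

Lemma continuous_is_derive (f df : R -> R) :
  (forall s, is_derive f s (df s)) -> forall s, continuous f s.
Proof.
intros H s; apply (ex_derive_continuous (K := R_AbsRing) (V := R_NormedModule)).
exists (df s); apply H.
Qed.

(* [s + i eta s] runs along the steepest descent path of [exp (i x cosh w)]: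
   there [cosh w = 1 + i * Lam s] and [dw/ds = 1 + i / cosh s]. *)
Definition eta (s : R) : R := atan (sinh s).

Definition Lam (s : R) : R := cosh s - / cosh s.

Definition dLam (s : R) : R := sinh s + sinh s / cosh s ^ 2.

(* Real and imaginary parts of [sinh (nu w)]. *)
Definition sinhRe (nu s : R) : R := sinh (nu * s) * cos (nu * eta s).
Definition sinhIm (nu s : R) : R := cosh (nu * s) * sin (nu * eta s).

(* Real and imaginary parts of [cosh (nu w) * dw/ds]. *)
Definition kerRe (nu s : R) : R :=
  cosh (nu * s) * cos (nu * eta s) - sinh (nu * s) * sin (nu * eta s) / cosh s.
Definition kerIm (nu s : R) : R :=
  sinh (nu * s) * sin (nu * eta s) + cosh (nu * s) * cos (nu * eta s) / cosh s.

Lemma is_derive_eta s : is_derive eta s (/ cosh s).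
Proof.
unfold eta; eapply is_derive_eq.
  apply (is_derive_comp (K := R_AbsRing) (V := R_NormedModule) atan sinh s).
    apply is_derive_atan.
  apply is_derive_sinh.
unfold scal; simpl; unfold mult; simpl.
replace (1 + (sinh s)²) with (cosh s ^ 2) by (rewrite cosh2_sinh2; unfold Rsqr; ring).
generalize (cosh_ge_1 s); intros; field; lra.
Qed.

(** [eta] is the Gudermannian function. With its sine below, this gives cosh (s + i eta s) = 1 + i
    Lam s, and it makes the kernel identities polynomial in cosh s, sinh s and 1 / cosh s. *)
Lemma cos_eta s : cos (eta s) = / cosh s.
Proof.
unfold eta; rewrite cos_atan.
replace (1 + (sinh s)²) with ((cosh s)²).
  rewrite sqrt_Rsqr; [unfold Rdiv; ring|generalize (cosh_ge_1 s); lra].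
generalize (cosh2_sinh2 s); unfold Rsqr; lra.
Qed.

Lemma sin_eta s : sin (eta s) = sinh s / cosh s.
Proof.
unfold eta; rewrite sin_atan.
replace (1 + (sinh s)²) with ((cosh s)²).
  rewrite sqrt_Rsqr; [easy|generalize (cosh_ge_1 s); lra].
generalize (cosh2_sinh2 s); unfold Rsqr; lra.
Qed.

Lemma is_derive_Lam s : is_derive Lam s (dLam s).
Proof.
unfold Lam, dLam, cosh, sinh; auto_derive.
- generalize (exp_pos s) (exp_pos (- s)); lra.
- field; generalize (exp_pos s) (exp_pos (- s)); lra.
Qed.

(** Real part of d/ds sinh (nu w) = nu cosh (nu w) dw/ds: the kernel is an exact derivative, ready
    for integration by parts. *)
Lemma is_derive_sinhRe nu s : is_derive (sinhRe nu) s (nu * kerRe nu s).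
Proof.
unfold sinhRe, kerRe; eapply is_derive_eq.
  apply is_deriveR_mult.
    apply (is_derive_comp (K := R_AbsRing) (V := R_NormedModule) sinh (fun s => nu * s)).
      apply is_derive_sinh.
    apply (is_derive_scal (fun s => s)), (is_derive_id (K := R_AbsRing)).
  apply (is_derive_comp (K := R_AbsRing) (V := R_NormedModule) cos (fun s => nu * eta s)).
    apply is_derive_cos.
  apply (is_derive_scal eta), is_derive_eta.
unfold scal; simpl; unfold mult, one; simpl; unfold Rdiv; ring.
Qed.

Lemma is_derive_sinhIm nu s : is_derive (sinhIm nu) s (nu * kerIm nu s).
Proof.
unfold sinhIm, kerIm; eapply is_derive_eq.
  apply is_deriveR_mult.
    apply (is_derive_comp (K := R_AbsRing) (V := R_NormedModule) cosh (fun s => nu * s)).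
      apply is_derive_cosh.
    apply (is_derive_scal (fun s => s)), (is_derive_id (K := R_AbsRing)).
  apply (is_derive_comp (K := R_AbsRing) (V := R_NormedModule) sin (fun s => nu * eta s)).
    apply is_derive_sin.
  apply (is_derive_scal eta), is_derive_eta.
unfold scal; simpl; unfold mult, one; simpl; unfold Rdiv; ring.
Qed.

Lemma cosh_sub a b : cosh (a - b) = cosh a * cosh b - sinh a * sinh b.
Proof.
unfold cosh, sinh.
replace (- (a - b)) with (b + - a) by ring.
unfold Rminus; rewrite !exp_plus.
field.
Qed.

Lemma sinh_sub a b : sinh (a - b) = sinh a * cosh b - cosh a * sinh b.
Proof.
unfold cosh, sinh.
replace (- (a - b)) with (b + - a) by ring.
unfold Rminus; rewrite !exp_plus.
field.
Qed.

(* The two parts of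
   [i cosh ((1 - nu) w) w' = (i - Lam) cosh (nu w) w' + Lam' sinh (nu w)]. *)
Lemma kerIm_reflect nu s :
  kerIm (1 - nu) s = kerIm nu s + Lam s * kerRe nu s - dLam s * sinhRe nu s.
Proof.
unfold kerRe, kerIm, sinhRe, dLam, Lam.
replace ((1 - nu) * s) with (s - nu * s) by ring.
replace ((1 - nu) * eta s) with (eta s - nu * eta s) by ring.
rewrite cosh_sub, sinh_sub, cos_minus, sin_minus, cos_eta, sin_eta.
assert (E := cosh2_sinh2 s).
assert (V : cosh s * / cosh s = 1) by (apply Rinv_r; generalize (cosh_ge_1 s); lra).
unfold Rdiv; rewrite <- pow_inv.
set (k := cosh s) in *; set (h := sinh s) in *; set (v := / k) in *.
set (p := cosh (nu * s)); set (q := sinh (nu * s)).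
set (c := cos (nu * eta s)); set (d := sin (nu * eta s)).
clearbody h v k p q c d.
(* The remaining identity is polynomial modulo two relations: sinh^2 = cosh^2 - 1, and cosh times
   its inverse is 1. *)
assert (E' : h ^ 2 = k ^ 2 - 1) by lra.
ring [E' V].
Qed.

Lemma kerRe_reflect nu s :
  kerRe (1 - nu) s = kerRe nu s - Lam s * kerIm nu s + dLam s * sinhIm nu s.
Proof.
unfold kerRe, kerIm, sinhIm, dLam, Lam.
replace ((1 - nu) * s) with (s - nu * s) by ring.
replace ((1 - nu) * eta s) with (eta s - nu * eta s) by ring.
rewrite cosh_sub, sinh_sub, cos_minus, sin_minus, cos_eta, sin_eta.
assert (E := cosh2_sinh2 s).
assert (V : cosh s * / cosh s = 1) by (apply Rinv_r; generalize (cosh_ge_1 s); lra).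
unfold Rdiv; rewrite <- pow_inv.
set (k := cosh s) in *; set (h := sinh s) in *; set (v := / k) in *.
set (p := cosh (nu * s)); set (q := sinh (nu * s)).
set (c := cos (nu * eta s)); set (d := sin (nu * eta s)).
clearbody h v k p q c d.
assert (E' : h ^ 2 = k ^ 2 - 1) by lra.
ring [E' V].
Qed.

(** * Laplace integrals along the path *)

Lemma continuous_eta s : continuous eta s.
Proof. apply (continuous_is_derive _ _ is_derive_eta). Qed.

Lemma continuous_Lam s : continuous Lam s.
Proof. apply (continuous_is_derive _ _ is_derive_Lam). Qed.

Lemma continuous_dLam s : continuous dLam s.
Proof.
apply (ex_derive_continuous (K := R_AbsRing) (V := R_NormedModule)).
unfold dLam, cosh, sinh; auto_derive.
generalize (exp_pos s) (exp_pos (- s)); nra.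
Qed.

Lemma continuous_multR (f g : R -> R) s :
  continuous f s -> continuous g s -> continuous (fun t => f t * g t) s.
Proof. apply (continuous_mult (K := R_AbsRing)). Qed.

Lemma continuous_plusR (f g : R -> R) s :
  continuous f s -> continuous g s -> continuous (fun t => f t + g t) s.
Proof. apply (continuous_plus (V := R_NormedModule)). Qed.

Lemma continuous_minusR (f g : R -> R) s :
  continuous f s -> continuous g s -> continuous (fun t => f t - g t) s.
Proof. apply (continuous_minus (V := R_NormedModule)). Qed.

Lemma continuous_expR (f : R -> R) s : continuous f s -> continuous (fun t => exp (f t)) s.
Proof.
intros H; apply (continuous_comp f exp); [exact H|].
apply (continuous_is_derive exp exp); intros; apply is_derive_exp.
Qed.

Lemma continuous_hyp_trig (f g : R -> R) nu s :
  (forall t, continuous f t) -> (forall t, continuous g t) ->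
  continuous (fun s => f (nu * s) * g (nu * eta s)) s.
Proof.
intros Hf Hg; apply continuous_multR.
- apply (continuous_comp (fun s => nu * s) f); [|apply Hf].
  apply continuous_multR; [apply continuous_const | apply continuous_id].
- apply (continuous_comp (fun s => nu * eta s) g); [|apply Hg].
  apply continuous_multR; [apply continuous_const | apply continuous_eta].
Qed.

Lemma continuous_coshR s : continuous cosh s.
Proof. apply (continuous_is_derive _ _ is_derive_cosh). Qed.

Lemma continuous_sinhR s : continuous sinh s.
Proof. apply (continuous_is_derive _ _ is_derive_sinh). Qed.

Lemma continuous_inv_cosh s : continuous (fun s => / cosh s) s.
Proof.
apply (continuous_comp cosh Rinv); [apply continuous_coshR|].
apply continuous_Rinv; generalize (cosh_ge_1 s); lra.
Qed.

Lemma continuous_kerRe nu s : continuous (kerRe nu) s.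
Proof.
apply continuous_minusR.
- apply continuous_hyp_trig; [apply continuous_coshR | apply continuous_cos].
- apply continuous_multR; [|apply continuous_inv_cosh].
  apply continuous_hyp_trig; [apply continuous_sinhR | apply continuous_sin].
Qed.

Lemma continuous_kerIm nu s : continuous (kerIm nu) s.
Proof.
apply continuous_plusR.
- apply continuous_hyp_trig; [apply continuous_sinhR | apply continuous_sin].
- apply continuous_multR; [|apply continuous_inv_cosh].
  apply continuous_hyp_trig; [apply continuous_coshR | apply continuous_cos].
Qed.

Lemma sinh_nonneg s : 0 <= s -> 0 <= sinh s.
Proof.
intros H; unfold sinh.
assert (exp (- s) <= exp s); [|lra].
destruct (Req_dec s 0) as [->|]; [rewrite Ropp_0; lra|].
apply Rlt_le, exp_increasing; lra.
Qed.

Lemma cosh_plus_sinh s : cosh s + sinh s = exp s.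
Proof. unfold cosh, sinh; field. Qed.

Lemma exp_le a b : a <= b -> exp a <= exp b.
Proof.
intros [H| ->]; [now apply Rlt_le, exp_increasing | apply Rle_refl].
Qed.

Lemma inv_cosh_bounds s : 0 < / cosh s <= 1.
Proof.
generalize (cosh_ge_1 s); intros H; split; [apply Rinv_0_lt_compat; lra|].
rewrite <- Rinv_1; apply Rinv_le_contravar; lra.
Qed.

Lemma ker_bound a b c d v :
  0 <= a -> 0 <= b -> -1 <= c <= 1 -> -1 <= d <= 1 -> 0 < v <= 1 ->
  Rabs (a * c - b * d * v) <= a + b /\ Rabs (b * d + a * c * v) <= a + b.
Proof.
intros Ha Hb Hc Hd Hv.
assert (- a <= a * c <= a) by nra.
assert (- b <= b * d <= b) by nra.
assert (- a <= a * c * v <= a) by nra.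
assert (- b <= b * d * v <= b) by nra.
split; apply Rabs_le; lra.
Qed.

Lemma ker_abs_le nu s : 0 <= nu -> 0 <= s ->
  Rabs (kerRe nu s) <= exp (nu * s) /\ Rabs (kerIm nu s) <= exp (nu * s).
Proof.
intros Hn Hs.
rewrite <- (cosh_plus_sinh (nu * s)).
apply ker_bound.
- generalize (cosh_ge_1 (nu * s)); lra.
- apply sinh_nonneg; nra.
- apply COS_bound.
- apply SIN_bound.
- apply inv_cosh_bounds.
Qed.

Lemma sinh_abs_le nu s : 0 <= nu -> 0 <= s ->
  Rabs (sinhRe nu s) <= exp (nu * s) /\ Rabs (sinhIm nu s) <= exp (nu * s).
Proof.
intros Hn Hs.
rewrite <- (cosh_plus_sinh (nu * s)).
assert (Hp : 0 <= nu * s) by nra.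
generalize (COS_bound (nu * eta s)) (SIN_bound (nu * eta s)) (cosh_ge_1 (nu * s))
  (sinh_nonneg _ Hp); intros.
unfold sinhRe, sinhIm; split; apply Rabs_le; nra.
Qed.

Lemma Lam_nonneg s : 0 <= Lam s.
Proof.
unfold Lam; generalize (cosh_ge_1 s) (inv_cosh_bounds s); lra.
Qed.

Lemma Lam_le s : 0 <= s -> Lam s <= exp s.
Proof.
intros H; rewrite <- cosh_plus_sinh; unfold Lam.
generalize (sinh_nonneg s H) (inv_cosh_bounds s); lra.
Qed.

Lemma Lam_ge s : exp s / 2 - 1 <= Lam s.
Proof.
unfold Lam; generalize (inv_cosh_bounds s); unfold cosh at 3.
generalize (exp_pos (- s)); lra.
Qed.

Lemma exp_ge_sqr s : 0 <= s -> s ^ 2 / 4 <= exp s.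
Proof.
intros H; replace s with (s / 2 + s / 2) at 2 by field; rewrite exp_plus.
generalize (exp_ge_1_plus (s / 2)); nra.
Qed.

(** From Lam s >= exp s / 2 - 1 >= s^2 / 8 - 1, complete the square: x s^2 / 8 - n s + 2 n^2 / x is
    (x s - 4 n)^2 / (8 x). The damping thus beats any exponential exp (n s). *)
Lemma exp_Lam_le x n s : 0 < x -> 0 <= s ->
  exp (- (x * Lam s)) <= exp (x + 2 * n ^ 2 / x) * exp (- (n * s)).
Proof.
intros Hx Hs; rewrite <- exp_plus; apply exp_le.
generalize (Lam_ge s) (exp_ge_sqr s Hs); intros H1 H2.
assert (H3 : x * (s ^ 2 / 8 - 1) <= x * Lam s) by (apply Rmult_le_compat_l; lra).
assert (0 <= (x * s - 4 * n) ^ 2 / (8 * x)).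
  apply Rmult_le_pos; [apply pow2_ge_0|apply Rlt_le, Rinv_0_lt_compat; lra].
replace ((x * s - 4 * n) ^ 2 / (8 * x)) with (x * (s ^ 2 / 8) - n * s + 2 * n ^ 2 / x) in H by (field; lra).
lra.
Qed.

Definition int0_val (f : R -> R) : R := epsilon (inhabits 0) (int0 f).

Definition laplace (c : R -> R) (x : R) : R :=
  int0_val (fun s => exp (- (x * Lam s)) * c s).

Definition exp_bounded (n : R) (c : R -> R) : Prop :=
  (forall s, continuous c s) /\
  exists M, forall s, 0 <= s -> Rabs (c s) <= M * exp (n * s).

Lemma continuous_exp_Lam x s : continuous (fun s => exp (- (x * Lam s))) s.
Proof.
apply continuous_expR.
apply (continuous_opp (K := R_AbsRing) (V := R_NormedModule)).
apply continuous_multR; [apply continuous_const | apply continuous_Lam].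
Qed.

(** Uses the previous damping with exponent n + 1: n absorbs the growth of c and 1 is left as
    decay. *)
Lemma exp_Lam_abs_le c n M x s : 0 < x -> 0 <= s -> Rabs (c s) <= M * exp (n * s) ->
  Rabs (exp (- (x * Lam s)) * c s) <= M * exp (x + 2 * (n + 1) ^ 2 / x) * exp (- (1 * s)).
Proof.
intros Hx Hs H.
rewrite Rabs_mult, Rabs_pos_eq by apply Rlt_le, exp_pos.
apply Rle_trans with (exp (x + 2 * (n + 1) ^ 2 / x) * exp (- ((n + 1) * s)) * (M * exp (n * s))).
- apply Rmult_le_compat; [apply Rlt_le, exp_pos|apply Rabs_pos| |exact H].
  now apply exp_Lam_le.
- right; replace (- (1 * s)) with (- ((n + 1) * s) + n * s) by ring.
  rewrite (exp_plus _ (n * s)); ring.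
Qed.

Lemma laplace_int0 c n x : exp_bounded n c -> 0 < x ->
  int0 (fun s => exp (- (x * Lam s)) * c s) (laplace c x).
Proof.
intros [Hc [M HM]] Hx; unfold laplace, int0_val.
apply epsilon_spec.
apply (int0_ex _ (M * exp (x + 2 * (n + 1) ^ 2 / x)) 1); [lra| |].
- intros s; apply continuous_multR; [apply continuous_exp_Lam | apply Hc].
- intros s Hs; now apply exp_Lam_abs_le; [..|apply HM].
Qed.

Lemma laplace_unique c x l : int0 (fun s => exp (- (x * Lam s)) * c s) l -> laplace c x = l.
Proof.
intros H; apply (int0_unique (fun s => exp (- (x * Lam s)) * c s)); [|exact H].
unfold laplace, int0_val; apply epsilon_spec; now exists l.
Qed.

Lemma exp_bounded_Lam n c : exp_bounded n c -> exp_bounded (n + 1) (fun s => Lam s * c s).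
Proof.
intros [Hc [M HM]]; split.
- intros s; apply continuous_multR; [apply continuous_Lam | apply Hc].
- exists M; intros s Hs.
  rewrite Rabs_mult, Rabs_pos_eq by apply Lam_nonneg.
  replace ((n + 1) * s) with (s + n * s) by ring; rewrite exp_plus.
  replace (M * _) with (exp s * (M * exp (n * s))) by ring.
  apply Rmult_le_compat; [apply Lam_nonneg|apply Rabs_pos|now apply Lam_le|now apply HM].
Qed.

Lemma exp_bounded_plus n c d : exp_bounded n c -> exp_bounded n d -> exp_bounded n (fun s => c s + d s).
Proof.
intros [Hc [M HM]] [Hd [N HN]]; split.
- intros s; now apply continuous_plusR.
- exists (M + N); intros s Hs.
  apply Rle_trans with (1 := Rabs_triang _ _).
  rewrite Rmult_plus_distr_r; now apply Rplus_le_compat; [apply HM | apply HN].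
Qed.

Lemma exp_bounded_scal n k c : exp_bounded n c -> exp_bounded n (fun s => k * c s).
Proof.
intros [Hc [M HM]]; split.
- intros s; apply continuous_multR; [apply continuous_const | apply Hc].
- exists (Rabs k * M); intros s Hs; rewrite Rabs_mult, Rmult_assoc.
  apply Rmult_le_compat_l; [apply Rabs_pos | now apply HM].
Qed.

Lemma laplace_plus n c d x : exp_bounded n c -> exp_bounded n d -> 0 < x ->
  laplace (fun s => c s + d s) x = laplace c x + laplace d x.
Proof.
intros Hc Hd Hx; apply laplace_unique.
apply (int0_ext (fun s => exp (- (x * Lam s)) * c s + exp (- (x * Lam s)) * d s)).
  intros; ring.
now apply int0_plus; apply laplace_int0 with n.
Qed.

Lemma laplace_scal n c k x : exp_bounded n c -> 0 < x ->
  laplace (fun s => k * c s) x = k * laplace c x.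
Proof.
intros Hc Hx; apply laplace_unique.
apply (int0_ext (fun s => k * (exp (- (x * Lam s)) * c s))).
  intros; ring.
now apply int0_scal, laplace_int0 with n.
Qed.

Lemma laplace_ext n c d x : exp_bounded n c -> 0 < x -> (forall s, d s = c s) ->
  laplace d x = laplace c x.
Proof.
intros Hc Hx E; apply laplace_unique.
apply (int0_ext (fun s => exp (- (x * Lam s)) * c s)); [intros s; now rewrite E|].
now apply laplace_int0 with n.
Qed.

(** Uniform in x >= x0 because the damping factor decreases in x. *)
Lemma laplace_abs_le c n M x0 x : 0 < x0 -> x0 <= x ->
  (forall s, continuous c s) -> (forall s, 0 <= s -> Rabs (c s) <= M * exp (n * s)) ->
  Rabs (laplace c x) <= M * exp (x0 + 2 * (n + 1) ^ 2 / x0).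
Proof.
intros H0 Hx Hc HM.
rewrite <- (Rdiv_1_r (M * _)).
apply (int0_abs_le (fun s => exp (- (x * Lam s)) * c s)
  (fun s => M * exp (x0 + 2 * (n + 1) ^ 2 / x0) * exp (- (1 * s)))).
- apply laplace_int0 with n; [split; [easy|now exists M]|lra].
- apply int0_exp; lra.
- intros s Hs; apply Rle_trans with (Rabs (exp (- (x0 * Lam s)) * c s)).
  + rewrite !Rabs_mult; apply Rmult_le_compat_r; [apply Rabs_pos|].
    rewrite !Rabs_pos_eq by apply Rlt_le, exp_pos.
    apply exp_le; generalize (Lam_nonneg s); nra.
  + now apply exp_Lam_abs_le; [..|apply HM].
Qed.

(** Differentiation under the integral. For |h| <= x / 2 the factor exp (x / 2 Lam s) from
    [exp_taylor2] uses up half of the damping, so the remainder is at most h^2 times a Laplace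
    integral taken at x / 2. *)
Lemma is_derive_laplace c n x : exp_bounded n c -> 0 < x ->
  is_derive (laplace c) x (- laplace (fun s => Lam s * c s) x).
Proof.
intros Hc Hx.
assert (H1 := exp_bounded_Lam _ _ Hc).
assert (Hac : exp_bounded n (fun s => Rabs (c s))).
{ destruct Hc as [Hc [M HM]]; split.
  - intros s; apply (continuous_comp c Rabs); [apply Hc|apply continuous_Rabs].
  - exists M; intros s Hs; rewrite Rabs_Rabsolu; now apply HM. }
assert (H2 := exp_bounded_Lam _ _ (exp_bounded_Lam _ _ Hac)).
apply (is_derive_quadratic _ _ _ (laplace (fun s => Lam s * (Lam s * Rabs (c s))) (x / 2)) (x / 2)).
  lra.
intros h Hh.
assert (Hh' := proj1 (Rabs_le_between _ _) Hh).
rewrite (Rmult_comm (laplace _ (x / 2))).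
apply (int0_abs_le
  (fun s => (exp (- ((x + h) * Lam s)) * c s - exp (- (x * Lam s)) * c s) -
    (- h) * (exp (- (x * Lam s)) * (Lam s * c s)))
  (fun s => h ^ 2 * (exp (- (x / 2 * Lam s)) * (Lam s * (Lam s * Rabs (c s)))))).
- replace (h * _) with (- h * laplace (fun s => Lam s * c s) x) by ring.
  apply int0_minus; [apply int0_minus; apply laplace_int0 with n; (easy || lra)|].
  apply int0_scal; now apply laplace_int0 with (n + 1).
- apply int0_scal; apply laplace_int0 with (n + 1 + 1); [easy|lra].
- intros s Hs.
  replace (- ((x + h) * Lam s)) with (- (x * Lam s) + - (h * Lam s)) by ring; rewrite exp_plus.
  replace (_ - _) with (exp (- (x * Lam s)) * c s * (exp (- (h * Lam s)) - 1 - - (h * Lam s))) by ring.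
  rewrite !Rabs_mult, (Rabs_pos_eq (exp _)) by apply Rlt_le, exp_pos.
  apply Rle_trans with (exp (- (x * Lam s)) * Rabs (c s) * ((- (h * Lam s)) ^ 2 * exp (x / 2 * Lam s))).
  + apply Rmult_le_compat_l.
      apply Rmult_le_pos; [apply Rlt_le, exp_pos|apply Rabs_pos].
    apply Rle_trans with (1 := exp_taylor2 _).
    apply Rmult_le_compat_l; [apply pow2_ge_0|].
    apply exp_le; rewrite Rabs_Ropp, Rabs_mult, (Rabs_pos_eq (Lam s)) by apply Lam_nonneg.
    apply Rmult_le_compat_r; [apply Lam_nonneg|easy].
  + right; replace (- (x / 2 * Lam s)) with (- (x * Lam s) + x / 2 * Lam s) by field.
    rewrite exp_plus; ring.
Qed.

(** The factor Lam gains 1 / x: half of the damping is spent on y exp (- y) <= 1 with y = x Lam s /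
    2, and the other half is at most the damping at x0. *)
Lemma laplace_Lam_abs_le c n M x0 x : 0 < x0 -> 2 * x0 <= x ->
  (forall s, continuous c s) -> (forall s, 0 <= s -> Rabs (c s) <= M * exp (n * s)) ->
  Rabs (laplace (fun s => Lam s * c s) x) <= 2 * M * exp (x0 + 2 * (n + 1) ^ 2 / x0) / x.
Proof.
intros H0 Hx Hc HM.
replace (2 * M * exp (x0 + 2 * (n + 1) ^ 2 / x0) / x)
  with (2 / x * M * exp (x0 + 2 * (n + 1) ^ 2 / x0) / 1) by (field; lra).
apply (int0_abs_le (fun s => exp (- (x * Lam s)) * (Lam s * c s))
  (fun s => 2 / x * M * exp (x0 + 2 * (n + 1) ^ 2 / x0) * exp (- (1 * s)))).
- apply laplace_int0 with (n + 1); [apply exp_bounded_Lam|lra].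
  split; [easy|now exists M].
- apply int0_exp; lra.
- intros s Hs; apply Rle_trans with (2 / x * Rabs (exp (- (x0 * Lam s)) * c s)).
  + rewrite !Rabs_mult, !(Rabs_pos_eq (exp _)), (Rabs_pos_eq (Lam s))
      by (apply Lam_nonneg || apply Rlt_le, exp_pos).
    rewrite <- !Rmult_assoc; apply Rmult_le_compat_r; [apply Rabs_pos|].
    replace (- (x * Lam s)) with (- (x / 2 * Lam s) + - (x / 2 * Lam s)) by field.
    rewrite exp_plus.
    assert (L := Lam_nonneg s).
    assert (E1 : exp (- (x / 2 * Lam s)) <= exp (- (x0 * Lam s))) by (apply exp_le; nra).
    assert (E2 : x / 2 * Lam s * exp (- (x / 2 * Lam s)) <= 1).
      rewrite exp_Ropp; apply Rmult_le_reg_r with (exp (x / 2 * Lam s)); [apply exp_pos|].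
      rewrite Rmult_assoc, Rinv_l by (apply Rgt_not_eq, exp_pos).
      generalize (exp_ge_1_plus (x / 2 * Lam s)); lra.
    replace (exp (- (x / 2 * Lam s)) * exp (- (x / 2 * Lam s)) * Lam s)
      with (2 / x * ((x / 2 * Lam s * exp (- (x / 2 * Lam s))) * exp (- (x / 2 * Lam s)))) by (field; lra).
    apply Rmult_le_compat_l; [apply Rmult_le_pos; [lra|apply Rlt_le, Rinv_0_lt_compat; lra]|].
    generalize (exp_pos (- (x / 2 * Lam s))); nra.
  + rewrite !(Rmult_assoc (2 / x)).
    apply Rmult_le_compat_l; [apply Rmult_le_pos; [lra|apply Rlt_le, Rinv_0_lt_compat; lra]|].
    now apply exp_Lam_abs_le; [..|apply HM].
Qed.

(* Integrate the derivative of [exp (- (x * Lam s)) * P s]. *)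
Lemma laplace_dLam P dP n m x :
  exp_bounded n P -> exp_bounded m dP -> (forall s, is_derive P s (dP s)) ->
  P 0 = 0 -> 0 < x ->
  exp_bounded (n + 1) (fun s => dLam s * P s) /\
  x * laplace (fun s => dLam s * P s) x = laplace dP x.
Proof.
intros HP HdP HD P0 Hx.
assert (HdL : exp_bounded (n + 1) (fun s => dLam s * P s)).
{ destruct HP as [Hc [M HM]]; split.
  - intros s; apply continuous_multR; [apply continuous_dLam | apply Hc].
  - exists (2 * M); intros s Hs; rewrite Rabs_mult.
    replace ((n + 1) * s) with (s + n * s) by ring; rewrite exp_plus.
    replace (2 * M * _) with (2 * exp s * (M * exp (n * s))) by ring.
    apply Rmult_le_compat; [apply Rabs_pos|apply Rabs_pos| |now apply HM].
    generalize (sinh_nonneg s Hs) (inv_cosh_bounds s) (cosh_ge_1 s) (cosh_plus_sinh s); intros.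
    unfold dLam, Rdiv; rewrite <- pow_inv.
    assert (0 <= (/ cosh s) ^ 2 <= 1) by (simpl; nra).
    rewrite Rabs_pos_eq; nra. }
split; [exact HdL|].
(* Both boundary terms vanish: at 0 since P 0 = 0, at infinity by the damping. *)
assert (Z : int0 (fun s => exp (- (x * Lam s)) * dP s - x * (exp (- (x * Lam s)) * (dLam s * P s))) 0).
{ assert (E0 : 0 - exp (- (x * Lam 0)) * P 0 = 0) by (rewrite P0; ring).
  rewrite <- E0 at 1; apply (int0_derive (fun s => exp (- (x * Lam s)) * P s)).
  - intros s; eapply is_derive_eq.
      apply is_deriveR_mult; [|apply HD].
      apply (is_derive_comp (K := R_AbsRing) (V := R_NormedModule) exp (fun s => - (x * Lam s))).
        apply is_derive_exp.
      apply (is_derive_opp (K := R_AbsRing) (V := R_NormedModule)).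
      apply (is_derive_scal Lam), is_derive_Lam.
    unfold scal, opp; simpl; unfold mult; simpl; ring.
  - intros s; apply continuous_minusR.
      apply continuous_multR; [apply continuous_exp_Lam|apply HdP].
    apply continuous_multR; [apply continuous_const|].
    apply continuous_multR; [apply continuous_exp_Lam|apply HdL].
  - destruct HP as [Hc [M HM]].
    apply (filterlim_0_exp_bound _ (M * exp (x + 2 * (n + 1) ^ 2 / x)) 1); [lra|].
    intros s Hs; now apply exp_Lam_abs_le; [..|apply HM]. }
assert (Z2 : int0 (fun s => exp (- (x * Lam s)) * dP s - x * (exp (- (x * Lam s)) * (dLam s * P s)))
  (laplace dP x - x * laplace (fun s => dLam s * P s) x)).
{ apply int0_minus; [now apply laplace_int0 with m|].
  now apply int0_scal, laplace_int0 with (n + 1). }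
generalize (int0_unique _ _ _ Z Z2); lra.
Qed.

(** * The outgoing solution and its amplitude at infinity *)

(** The factor exp (i x) is split off: this is a constant multiple of exp (- i x) H^(1)_nu (x). *)
Definition hankel (nu x : R) : C := (laplace (kerRe nu) x, laplace (kerIm nu) x).

Lemma exp_bounded_kerRe nu : 0 <= nu -> exp_bounded nu (kerRe nu).
Proof.
intros Hn; split; [apply continuous_kerRe|].
exists 1; intros s Hs; rewrite Rmult_1_l; now apply ker_abs_le.
Qed.

Lemma exp_bounded_kerIm nu : 0 <= nu -> exp_bounded nu (kerIm nu).
Proof.
intros Hn; split; [apply continuous_kerIm|].
exists 1; intros s Hs; rewrite Rmult_1_l; now apply ker_abs_le.
Qed.

Lemma exp_bounded_sinhRe nu : 0 <= nu -> exp_bounded nu (sinhRe nu).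
Proof.
intros Hn; split; [apply (continuous_is_derive _ _ (is_derive_sinhRe nu))|].
exists 1; intros s Hs; rewrite Rmult_1_l; now apply sinh_abs_le.
Qed.

Lemma exp_bounded_sinhIm nu : 0 <= nu -> exp_bounded nu (sinhIm nu).
Proof.
intros Hn; split; [apply (continuous_is_derive _ _ (is_derive_sinhIm nu))|].
exists 1; intros s Hs; rewrite Rmult_1_l; now apply sinh_abs_le.
Qed.

Lemma exp_bounded_le n m c : n <= m -> exp_bounded n c -> exp_bounded m c.
Proof.
intros Hnm [Hc [M HM]]; split; [easy|].
exists M; intros s Hs; apply Rle_trans with (1 := HM s Hs).
assert (0 <= M).
  generalize (HM 0 (Rle_refl _)) (Rabs_pos (c 0)); rewrite Rmult_0_r, exp_0; lra.
apply Rmult_le_compat_l; [easy|]; apply exp_le; nra.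
Qed.

Lemma eta_0 : eta 0 = 0.
Proof. unfold eta; now rewrite sinh_0, atan_0. Qed.

(** Integrates [kerIm_reflect] and [kerRe_reflect]; integration by parts turns the dLam terms into
    nu / x times the original integrals. *)
Lemma hankel_reflect nu x : 0 <= nu -> 0 < x ->
  laplace (kerIm (1 - nu)) x =
    laplace (kerIm nu) x + laplace (fun s => Lam s * kerRe nu s) x - nu / x * laplace (kerRe nu) x /\
  laplace (kerRe (1 - nu)) x =
    laplace (kerRe nu) x - laplace (fun s => Lam s * kerIm nu s) x + nu / x * laplace (kerIm nu) x.
Proof.
intros Hn Hx.
assert (A := exp_bounded_kerRe nu Hn).
assert (B := exp_bounded_kerIm nu Hn).
destruct (laplace_dLam (sinhRe nu) (fun s => nu * kerRe nu s) nu nu x) as [C1 C2];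
  try easy.
  now apply exp_bounded_sinhRe.
  now apply exp_bounded_scal.
  apply is_derive_sinhRe.
  unfold sinhRe; rewrite Rmult_0_r, sinh_0; ring.
destruct (laplace_dLam (sinhIm nu) (fun s => nu * kerIm nu s) nu nu x) as [D1 D2];
  try easy.
  now apply exp_bounded_sinhIm.
  now apply exp_bounded_scal.
  apply is_derive_sinhIm.
  unfold sinhIm; rewrite eta_0, Rmult_0_r, sin_0; ring.
rewrite laplace_scal with (n := nu) in C2, D2 by easy.
assert (A' := exp_bounded_Lam _ _ A).
assert (B' := exp_bounded_Lam _ _ B).
apply (exp_bounded_le _ (nu + 1)) in A; [|lra].
apply (exp_bounded_le _ (nu + 1)) in B; [|lra].
split.
- rewrite (laplace_ext (nu + 1) (fun s => kerIm nu s + (Lam s * kerRe nu s + -1 * (dLam s * sinhRe nu s)))); [|..|easy|].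
  + rewrite (laplace_plus (nu + 1)), (laplace_plus (nu + 1)), (laplace_scal (nu + 1));
      auto using exp_bounded_plus, exp_bounded_scal.
    assert (laplace (fun s => dLam s * sinhRe nu s) x = nu / x * laplace (kerRe nu) x); [|lra].
    apply Rmult_eq_reg_l with x; [|lra]; rewrite C2; field; lra.
  + auto using exp_bounded_plus, exp_bounded_scal.
  + intros s; rewrite kerIm_reflect; ring.
- rewrite (laplace_ext (nu + 1) (fun s => kerRe nu s + (-1 * (Lam s * kerIm nu s) + dLam s * sinhIm nu s))); [|..|easy|].
  + rewrite (laplace_plus (nu + 1)), (laplace_plus (nu + 1)), (laplace_scal (nu + 1));
      auto using exp_bounded_plus, exp_bounded_scal.
    assert (laplace (fun s => dLam s * sinhIm nu s) x = nu / x * laplace (kerIm nu) x); [|lra].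
    apply Rmult_eq_reg_l with x; [|lra]; rewrite D2; field; lra.
  + auto using exp_bounded_plus, exp_bounded_scal.
  + intros s; rewrite kerRe_reflect; ring.
Qed.

Lemma is_derivC_macdonald_laplace nu x : 0 <= nu -> 0 < x ->
  is_derivC (hankel nu) x
    (- laplace (fun s => Lam s * kerRe nu s) x, - laplace (fun s => Lam s * kerIm nu s) x).
Proof.
intros Hn Hx; split; simpl; apply is_derive_laplace with nu; try easy.
- now apply exp_bounded_kerRe.
- now apply exp_bounded_kerIm.
Qed.

Lemma hankel_derivative nu x : 0 <= nu -> 0 < x ->
  (- laplace (fun s => Lam s * kerRe nu s) x, - laplace (fun s => Lam s * kerIm nu s) x)
  = (Ci * hankel (1 - nu) x - Ci * hankel nu x - RtoC (nu / x) * hankel nu x)%C.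
Proof.
intros Hn Hx; destruct (hankel_reflect nu x Hn Hx) as [E1 E2].
apply injective_projections; simpl; lra.
Qed.

(** This is the Bessel recurrence H_nu' = H_(nu - 1) - (nu / x) H_nu, with order 1 - nu instead of
    nu - 1 because cosh (nu w) is even in nu. *)
Lemma is_derivC_macdonald nu x : 0 <= nu -> 0 < x ->
  is_derivC (hankel nu) x
    (Ci * hankel (1 - nu) x - Ci * hankel nu x - RtoC (nu / x) * hankel nu x)%C.
Proof.
intros Hn Hx; eapply is_derivC_eq; [|now apply hankel_derivative].
now apply is_derivC_macdonald_laplace.
Qed.

(* A multiple of the solution [x ^ nu * H^(1)_nu (x)] of Bessel's equation, [nu = (1 + al) / 2]. *)
Definition outgoing (al x : R) : C :=
  (RtoC (Rpower x ((1 + al) / 2)) * cis x * hankel ((1 + al) / 2) x)%C.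

Lemma is_derive_Rpower x p : 0 < x -> is_derive (fun t => Rpower t p) x (p / x * Rpower x p).
Proof.
intros Hx; unfold Rpower; auto_derive; [easy|field; lra].
Qed.

(** The range of al is symmetric, so the lemma applies to - al as well and yields a closed
    first-order system at energy 1. *)
Lemma is_derivC_outgoing al x : -1 < al < 1 -> 0 < x ->
  is_derivC (outgoing al) x (Ci * RtoC (Rpower x al) * outgoing (- al) x)%C.
Proof.
intros Hal Hx; unfold outgoing.
eapply is_derivC_eq.
  apply is_derivC_mult.
    apply is_derivC_mult.
      now apply is_derivC_RtoC, is_derive_Rpower.
    apply (is_derivC_cis (fun s => s)), is_derive_id.
  apply is_derivC_macdonald; lra.
replace ((1 + - al) / 2) with (1 - (1 + al) / 2) by field.
set (nu := (1 + al) / 2).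
replace (Rpower x nu) with (Rpower x al * Rpower x (1 - nu)).
- unfold one; simpl; rewrite !RtoC_mult; ring.
- rewrite <- Rpower_plus; f_equal; unfold nu; field.
Qed.

Lemma is_derive_inv_sqrt x : 0 < x -> is_derive (fun x => / sqrt x) x (- / (2 * (x * sqrt x))).
Proof.
intros Hx; assert (Hs := sqrt_lt_R0 x Hx).
assert (Hq := sqrt_sqrt x (Rlt_le _ _ Hx)).
auto_derive; [split; [easy|split; [lra|easy]]|].
rewrite <- Hq at 4; field; lra.
Qed.

Lemma filterlim_inv_sqrt : filterlim (fun x => / sqrt x) (Rbar_locally p_infty) (locally 0).
Proof.
apply filterlim_locally; intros [e He]; simpl.
exists (/ e ^ 2); intros x Hx.
change (Rabs (/ sqrt x - 0) < e).
assert (He2 : 0 < / e ^ 2) by (apply Rinv_0_lt_compat; now apply pow_lt).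
assert (Hs := sqrt_lt_R0 x ltac:(lra)).
rewrite Rminus_0_r, Rabs_pos_eq by (apply Rlt_le, Rinv_0_lt_compat, Hs).
apply sqrt_lt_1 in Hx; [|lra|lra].
rewrite <- pow_inv, sqrt_pow2 in Hx by (apply Rlt_le, Rinv_0_lt_compat, He).
rewrite <- (Rinv_inv e); apply Rinv_lt_contravar; [|easy].
apply Rmult_lt_0_compat; [now apply Rinv_0_lt_compat|easy].
Qed.

(** Subtracting 2 M / sqrt x adds M / (x sqrt x) to the derivative, which makes it nonnegative. *)
Lemma derive_lower_bound (u du : R -> R) (M x0 x y : R) : 0 < x0 ->
  (forall x, x0 <= x -> is_derive u x (du x)) ->
  (forall x, x0 <= x -> - (M / (x * sqrt x)) <= du x) ->
  x0 <= x -> x <= y ->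
  u x - 2 * M * / sqrt x <= u y - 2 * M * / sqrt y.
Proof.
intros H0 Hu HM Hx Hxy.
assert (HD : forall z, x0 <= z -> is_derive (fun x => u x - 2 * M * / sqrt x) z (du z + M / (z * sqrt z))).
{ intros z Hz; eapply is_derive_eq.
    apply is_deriveR_minus; [now apply Hu|].
    apply (is_derive_scal (fun x => / sqrt x)), is_derive_inv_sqrt; lra.
  assert (Hs := sqrt_lt_R0 z ltac:(lra)); field; lra. }
destruct (MVT_gen (fun x => u x - 2 * M * / sqrt x) x y (fun x => du x + M / (x * sqrt x))) as [c [Hc1 Hc2]].
- intros z; rewrite Rmin_left, Rmax_right by easy; intros Hz; apply HD; lra.
- intros z; rewrite Rmin_left, Rmax_right by easy; intros Hz.
  eapply is_derive_continuity_pt, HD; lra.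
- rewrite Rmin_left, Rmax_right in Hc1 by easy.
  generalize (HM c ltac:(lra)); nra.
Qed.

(** The corrected function u - 2 M / sqrt x increases, and the same bound for - u keeps it bounded;
    the correction tends to 0. *)
Lemma cv_of_derive_bound (u du : R -> R) (M x0 : R) : 0 < x0 ->
  (forall x, x0 <= x -> is_derive u x (du x)) ->
  (forall x, x0 <= x -> Rabs (du x) <= M / (x * sqrt x)) ->
  exists l, filterlim u (Rbar_locally p_infty) (locally l).
Proof.
intros H0 Hu HM.
assert (L := fun x y => derive_lower_bound u du M x0 x y H0 Hu
  (fun x Hx => proj1 (proj1 (Rabs_le_between _ _) (HM x Hx)))).
assert (U := fun x y => derive_lower_bound (fun x => - u x) (fun x => - du x) M x0 x y H0
  (fun x Hx => is_derive_opp (K := R_AbsRing) (V := R_NormedModule) u x (du x) (Hu x Hx))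
  (fun x Hx => Ropp_le_contravar _ _ (proj2 (proj1 (Rabs_le_between _ _) (HM x Hx))))).
assert (M0 : 0 <= M).
{ assert (Hs := sqrt_lt_R0 x0 H0).
  apply Rmult_le_reg_r with (/ (x0 * sqrt x0)).
    apply Rinv_0_lt_compat; nra.
  rewrite Rmult_0_l; apply Rle_trans with (2 := HM x0 (Rle_refl _)), Rabs_pos. }
destruct (mono_bounded_cv (fun x => u x - 2 * M * / sqrt x) x0 (u x0 + 2 * M * / sqrt x0)) as [l Hl].
- exact L.
- intros x Hx; generalize (U x0 x (Rle_refl _) Hx).
  assert (0 < / sqrt x) by (apply Rinv_0_lt_compat, sqrt_lt_R0; lra).
  nra.
- exists (l + 2 * M * 0).
  apply (filterlim_ext (fun x => (u x - 2 * M * / sqrt x) + 2 * M * / sqrt x)); [intros; ring|].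
  apply filterlimR_plus; [apply Rbar_locally_filter|exact Hl|].
  apply filterlimR_mult; [apply Rbar_locally_filter|apply filterlim_const|apply filterlim_inv_sqrt].
Qed.

(** A Hankel function decays like x^(-1/2); the factor sqrt x compensates this. *)
Definition amplitude (nu x : R) : C := (RtoC (sqrt x) * hankel nu x)%C.

Lemma hankel_bounds nu : 0 <= nu -> exists M, forall x, 2 <= x ->
  Rabs (Re (hankel nu x)) <= M /\ Rabs (Im (hankel nu x)) <= M /\
  Rabs (laplace (fun s => Lam s * kerRe nu s) x) <= M / x /\
  Rabs (laplace (fun s => Lam s * kerIm nu s) x) <= M / x.
Proof.
(* Both Laplace bounds are taken with x0 = 1; the one with the factor Lam needs x >= 2 x0. *)
intros Hn; exists (2 * exp (1 + 2 * (nu + 1) ^ 2 / 1)); intros x Hx.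
assert (K1 : forall s, 0 <= s -> Rabs (kerRe nu s) <= 1 * exp (nu * s)).
  intros s Hs; rewrite Rmult_1_l; now apply ker_abs_le.
assert (K2 : forall s, 0 <= s -> Rabs (kerIm nu s) <= 1 * exp (nu * s)).
  intros s Hs; rewrite Rmult_1_l; now apply ker_abs_le.
replace (2 * exp (1 + 2 * (nu + 1) ^ 2 / 1)) with (2 * 1 * exp (1 + 2 * (nu + 1) ^ 2 / 1)) by ring.
assert (P := exp_pos (1 + 2 * (nu + 1) ^ 2 / 1)).
split; [|split; [|split]].
- apply Rle_trans with (1 * exp (1 + 2 * (nu + 1) ^ 2 / 1)); [|lra].
  apply (laplace_abs_le _ nu); try easy; [lra|lra|apply continuous_kerRe].
- apply Rle_trans with (1 * exp (1 + 2 * (nu + 1) ^ 2 / 1)); [|lra].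
  apply (laplace_abs_le _ nu); try easy; [lra|lra|apply continuous_kerIm].
- apply laplace_Lam_abs_le; try easy; [lra|lra|apply continuous_kerRe].
- apply laplace_Lam_abs_le; try easy; [lra|lra|apply continuous_kerIm].
Qed.

Lemma is_derivC_amplitude nu x : 0 <= nu -> 0 < x ->
  is_derivC (amplitude nu) x
    (RtoC (sqrt x) * (Ci * hankel (1 - nu) x - Ci * hankel nu x)
     + RtoC ((1 / 2 - nu) / x) * amplitude nu x)%C.
Proof.
intros Hn Hx; unfold amplitude.
assert (Hs := sqrt_lt_R0 x Hx).
assert (Hq := sqrt_sqrt x (Rlt_le _ _ Hx)).
eapply is_derivC_eq.
  apply is_derivC_mult; [|now apply is_derivC_macdonald].
  apply is_derivC_RtoC, is_derive_Reals, derivable_pt_lim_sqrt, Hx.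
replace (/ (2 * sqrt x)) with (1 / 2 / x * sqrt x).
- replace ((1 / 2 - nu) / x) with (1 / 2 / x - nu / x) by (field; lra).
  rewrite RtoC_minus, RtoC_mult; ring.
- rewrite <- Hq at 1; field; lra.
Qed.

(* The sum of the two amplitudes has derivative [O(x^(-3/2))], their difference is
   [O(x^(-1/2))]. *)
Lemma amplitude_cv nu : 0 <= nu <= 1 -> exists L : C,
  filterlim (amplitude nu) (Rbar_locally p_infty) (locally L) /\
  filterlim (amplitude (1 - nu)) (Rbar_locally p_infty) (locally L).
Proof.
intros Hn.
destruct (hankel_bounds nu ltac:(lra)) as [M HM].
set (D := fun x => (amplitude nu x - amplitude (1 - nu) x)%C).
set (S := fun x => (amplitude nu x + amplitude (1 - nu) x)%C).
assert (M0 : 0 <= M).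
  apply Rle_trans with (2 := proj1 (HM 2 (Rle_refl _))), Rabs_pos.
(* The terms with hankel (1 - nu) - hankel nu change sign under nu -> 1 - nu and cancel in the sum;
   1/2 - nu changes sign too, which leaves the difference D. *)
assert (HS : forall x, 0 < x -> is_derivC S x (RtoC ((1 / 2 - nu) / x) * D x)%C).
{ intros x Hx; unfold S, D; eapply is_derivC_eq.
    apply is_derivC_plus; apply is_derivC_amplitude; (easy || lra).
  replace (1 - (1 - nu)) with nu by ring.
  replace ((1 / 2 - (1 - nu)) / x) with (- ((1 / 2 - nu) / x)) by (field; lra).
  rewrite RtoC_opp; ring. }
(* By [hankel_reflect] the difference consists of a Lam integral and nu / x times a bounded term,
   each O(1 / x), times sqrt x. *)
assert (HD : forall x, 2 <= x -> Rabs (Re (D x)) <= 2 * M / sqrt x /\ Rabs (Im (D x)) <= 2 * M / sqrt x).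
{ intros x Hx.
  destruct (HM x Hx) as [B1 [B2 [B3 B4]]].
  assert (Hs := sqrt_lt_R0 x ltac:(lra)).
  assert (Hq := sqrt_sqrt x ltac:(lra)).
  destruct (hankel_reflect nu x ltac:(lra) ltac:(lra)) as [E1 E2].
  assert (A : forall p q, Rabs p <= M -> Rabs q <= M / x -> Rabs (sqrt x * (q - nu / x * p)) <= 2 * M / sqrt x).
  { intros p q Hp Hq'.
    rewrite Rabs_mult, (Rabs_pos_eq (sqrt x)) by lra.
    replace (2 * M / sqrt x) with (sqrt x * (M / x + M / x)).
    2: rewrite <- Hq at 2 3; field; lra.
    apply Rmult_le_compat_l; [lra|].
    apply Rle_trans with (1 := Rabs_triang _ _).
    apply Rplus_le_compat; [easy|].
    rewrite Rabs_Ropp, Rabs_mult.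
    unfold Rdiv; rewrite Rabs_mult, (Rabs_pos_eq nu), (Rabs_pos_eq (/ x)) by (lra || apply Rlt_le, Rinv_0_lt_compat; lra).
    assert (0 < / x) by (apply Rinv_0_lt_compat; lra).
    generalize (Rabs_pos p); intros.
    apply Rle_trans with (1 * / x * M); [|lra].
    apply Rmult_le_compat; [|easy| |easy]; nra. }
  split.
  - replace (Re (D x)) with (sqrt x * (laplace (fun s => Lam s * kerIm nu s) x - nu / x * laplace (kerIm nu) x)).
      now apply A.
    unfold D, amplitude, hankel; simpl; rewrite E2; ring.
  - replace (Im (D x)) with (- (sqrt x * (laplace (fun s => Lam s * kerRe nu s) x - nu / x * laplace (kerRe nu) x))).
      rewrite Rabs_Ropp; now apply A.
    unfold D, amplitude, hankel; simpl; rewrite E1; ring. }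
(* The bound |1/2 - nu| <= 1/2 absorbs the factor 2. *)
assert (HD' : forall x d, 2 <= x -> Rabs d <= 2 * M / sqrt x ->
  Rabs ((1 / 2 - nu) / x * d) <= M / (x * sqrt x)).
{ intros x d Hx Hd.
  assert (Hs := sqrt_lt_R0 x ltac:(lra)).
  replace (M / (x * sqrt x)) with (1 / 2 * / x * (2 * M / sqrt x)) by (field; lra).
  rewrite Rabs_mult; apply Rmult_le_compat; try apply Rabs_pos; [|easy].
  unfold Rdiv at 1; rewrite Rabs_mult, (Rabs_pos_eq (/ x)) by (apply Rlt_le, Rinv_0_lt_compat; lra).
  apply Rmult_le_compat_r; [apply Rlt_le, Rinv_0_lt_compat; lra|].
  apply Rabs_le; lra. }
destruct (cv_of_derive_bound (fun x => Re (S x)) (fun x => (1 / 2 - nu) / x * Re (D x)) M 2) as [l1 Hl1].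
  lra.
  intros x Hx; refine (is_derive_eq _ _ _ _ (proj1 (HS x ltac:(lra))) _); simpl; ring.
  intros x Hx; apply HD'; [easy|now apply HD].
destruct (cv_of_derive_bound (fun x => Im (S x)) (fun x => (1 / 2 - nu) / x * Im (D x)) M 2) as [l2 Hl2].
  lra.
  intros x Hx; refine (is_derive_eq _ _ _ _ (proj2 (HS x ltac:(lra))) _); simpl; ring.
  intros x Hx; apply HD'; [easy|now apply HD].
assert (LS : filterlim S (Rbar_locally p_infty) (locally ((l1, l2) : C))).
  now apply filterlim_C; [apply Rbar_locally_filter|].
assert (Z : forall d : R -> R, (forall x, 2 <= x -> Rabs (d x) <= 2 * M / sqrt x) ->
  filterlim d (Rbar_locally p_infty) (locally 0)).
{ intros d Hd.
  apply filterlim_locally; intros e.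
  assert (K := filterlimR_mult _ _ _ (2 * M) _ (filterlim_const _) filterlim_inv_sqrt).
  rewrite Rmult_0_r in K.
  apply filterlim_locally with (eps := e) in K.
  assert (K2 : Rbar_locally p_infty (fun s => 2 <= s)) by (exists 2; intros; lra).
  generalize (filter_and _ _ K K2); apply filter_imp.
  intros x [B Hx].
  change (Rabs (d x - 0) < e).
  change (Rabs (2 * M * / sqrt x - 0) < e) in B.
  rewrite Rminus_0_r in *.
  apply Rle_lt_trans with (2 := B), Rle_trans with (2 := Rle_abs _), Hd, Hx. }
assert (LD : filterlim D (Rbar_locally p_infty) (locally (RtoC 0))).
  apply filterlim_C; [apply Rbar_locally_filter|]; split; apply Z; intros; now apply HD.
exists (RtoC (1 / 2) * (l1, l2))%C; split.
- replace (RtoC (1 / 2) * (l1, l2))%C with (RtoC (1 / 2) * ((l1, l2) + 0))%C by ring.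
  apply (filterlim_ext (fun x => RtoC (1 / 2) * (S x + D x))%C).
    intros x; unfold S, D; apply injective_projections; simpl; field.
  apply filterlimC_mult; [apply Rbar_locally_filter|apply filterlim_const|].
  now apply filterlimC_plus; [apply Rbar_locally_filter|..].
- replace (RtoC (1 / 2) * (l1, l2))%C with (RtoC (1 / 2) * ((l1, l2) + (RtoC (-1)) * 0))%C by ring.
  apply (filterlim_ext (fun x => RtoC (1 / 2) * (S x + RtoC (-1) * D x))%C).
    intros x; unfold S, D; apply injective_projections; simpl; field.
  apply filterlimC_mult; [apply Rbar_locally_filter|apply filterlim_const|].
  apply filterlimC_plus; [apply Rbar_locally_filter|easy|].
  now apply filterlimC_mult; [apply Rbar_locally_filter|apply filterlim_const|].
Qed.

(** * The Gamma function *)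

Definition gamma_integrand (s u : R) : R := Rpower u (s - 1) * exp (- u).

(* [gamma_integrand s u du] under the substitution [u = e * exp t], divided by [Rpower e s]. *)
Definition log_gamma_integrand (s e t : R) : R := exp (- (e * exp t)) * exp (s * t).

Definition scaled_tail (s e : R) : R := int0_val (log_gamma_integrand s e).

(** The upper incomplete Gamma function: the integral of [gamma_integrand s] over [e, +oo), written
    in a logarithmic variable so that [int0] applies. *)
Definition gamma_tail (s e : R) : R := Rpower e s * scaled_tail s e.

Lemma continuous_log_gamma_integrand s e t : continuous (log_gamma_integrand s e) t.
Proof.
apply (ex_derive_continuous (K := R_AbsRing) (V := R_NormedModule)).
unfold log_gamma_integrand; auto_derive; easy.
Qed.

(** Completes a square, using exp t >= t^2 / 4. *)
Lemma log_gamma_integrand_abs_le s e t : 0 < e -> 0 <= t ->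
  Rabs (log_gamma_integrand s e t) <= exp ((s + 1) ^ 2 / e) * exp (- (1 * t)).
Proof.
intros He Ht; unfold log_gamma_integrand.
rewrite Rabs_pos_eq by (apply Rlt_le, Rmult_lt_0_compat; apply exp_pos).
rewrite <- !exp_plus; apply exp_le.
assert (H : e * (t ^ 2 / 4) <= e * exp t) by (apply Rmult_le_compat_l; [lra|now apply exp_ge_sqr]).
assert (K : 0 <= (e * t - 2 * (s + 1)) ^ 2 / (4 * e)).
  apply Rmult_le_pos; [apply pow2_ge_0|apply Rlt_le, Rinv_0_lt_compat; lra].
replace ((e * t - 2 * (s + 1)) ^ 2 / (4 * e)) with (e * (t ^ 2 / 4) - (s + 1) * t + (s + 1) ^ 2 / e) in K by (field; lra).
lra.
Qed.

Lemma scaled_tail_int0 s e : 0 < e ->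
  int0 (log_gamma_integrand s e) (scaled_tail s e).
Proof.
intros He; unfold scaled_tail, int0_val; apply epsilon_spec.
apply (int0_ex _ (exp ((s + 1) ^ 2 / e)) 1); [lra|apply continuous_log_gamma_integrand|].
intros t Ht; now apply log_gamma_integrand_abs_le.
Qed.

Lemma continuous_gamma_integrand s u : 0 < u -> continuous (gamma_integrand s) u.
Proof.
intros Hu; apply (ex_derive_continuous (K := R_AbsRing) (V := R_NormedModule)).
unfold gamma_integrand, Rpower; auto_derive; easy.
Qed.

Lemma ex_RInt_gamma_integrand s a b : 0 < a -> 0 < b -> ex_RInt (gamma_integrand s) a b.
Proof.
intros Ha Hb; apply (ex_RInt_continuous (V := R_CompleteNormedModule)).
intros z [Hz _]; apply continuous_gamma_integrand.
apply Rlt_le_trans with (2 := Hz); now apply Rmin_glb_lt.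
Qed.

Lemma RInt_gamma_integrand s e b : 0 < e ->
  RInt (gamma_integrand s) e (e * exp b) = Rpower e s * RInt (log_gamma_integrand s e) 0 b.
Proof.
intros He.
rewrite <- (RInt_scal (V := R_CompleteNormedModule)).
2: apply ex_RInt_cont, continuous_log_gamma_integrand.
rewrite <- (Rmult_1_r e) at 1; rewrite <- exp_0.
rewrite <- (RInt_comp (V := R_CompleteNormedModule) (gamma_integrand s) (fun t => e * exp t) (fun t => e * exp t)).
- apply RInt_ext; intros t _.
  unfold scal; simpl; unfold mult; simpl.
  unfold gamma_integrand, log_gamma_integrand, Rpower.
  rewrite ln_mult, ln_exp by (easy || apply exp_pos).
  replace (s * t) with (t + (s - 1) * t) by ring.
  replace ((s - 1) * (ln e + t)) with (s * ln e + - ln e + (s - 1) * t) by ring.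
  rewrite !exp_plus, exp_Ropp, (exp_ln e He); field; lra.
- intros t _; apply continuous_gamma_integrand, Rmult_lt_0_compat; [easy|apply exp_pos].
- intros t _; split.
    auto_derive; [easy|ring].
  apply continuous_multR; [apply continuous_const|].
  apply continuous_expR, continuous_id.
Qed.

Lemma gamma_tail_lim s e : 0 < e ->
  filterlim (fun c => RInt (gamma_integrand s) e c) (Rbar_locally p_infty) (locally (gamma_tail s e)).
Proof.
intros He; destruct (scaled_tail_int0 s e He) as [_ Hl].
apply (filterlimR_mult _ _ _ (Rpower e s) _ (filterlim_const _)) in Hl.
apply filterlim_locally; intros d.
apply filterlim_locally with (eps := d) in Hl.
destruct Hl as [m Hm].
exists (e * exp m); intros c Hc.
assert (He' := exp_pos m).
assert (Hc0 : 0 < c / e).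
  apply Rmult_lt_0_compat; [|now apply Rinv_0_lt_compat].
  apply Rlt_trans with (2 := Hc), Rmult_lt_0_compat; easy.
replace c with (e * exp (ln (c / e))).
2: rewrite exp_ln by easy; field; lra.
rewrite RInt_gamma_integrand by easy.
apply Hm; rewrite <- (ln_exp m); apply ln_increasing; [easy|].
apply Rmult_lt_reg_l with e; [easy|].
replace (e * (c / e)) with c by (field; lra); easy.
Qed.

Lemma gamma_tail_Chasles s e e' : 0 < e -> 0 < e' ->
  gamma_tail s e = RInt (gamma_integrand s) e e' + gamma_tail s e'.
Proof.
intros He He'.
apply (filterlim_locally_unique (K := R_AbsRing) (V := R_NormedModule)
  (F := Rbar_locally p_infty) (fun c => RInt (gamma_integrand s) e c)).
  now apply gamma_tail_lim.
apply (filterlim_ext_loc (fun c => RInt (gamma_integrand s) e e' + RInt (gamma_integrand s) e' c)).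
- exists 0; intros c Hc.
  apply (RInt_Chasles (V := R_CompleteNormedModule)); now apply ex_RInt_gamma_integrand.
- apply filterlimR_plus; [apply Rbar_locally_filter|apply filterlim_const|now apply gamma_tail_lim].
Qed.

Lemma at_right_lt a b : a < b -> at_right a (fun x => a < x < b).
Proof.
intros H; exists (mkposreal (b - a) ltac:(lra)); intros y Hy Hy'; split; [easy|].
change (Rabs (y - a) < b - a) in Hy.
apply Rabs_def2 in Hy; lra.
Qed.

(** Transported from infinity by x -> 1 / x. *)
Lemma mono_bounded_cv_0 (u : R -> R) (x0 M : R) : 0 < x0 ->
  (forall x y, 0 < x -> x <= y -> y <= x0 -> u y <= u x) ->
  (forall x, 0 < x -> x <= x0 -> u x <= M) ->
  exists l, filterlim u (at_right 0) (locally l).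
Proof.
intros H0 Hm HM.
destruct (mono_bounded_cv (fun z => u (/ z)) (/ x0) M) as [l Hl].
- assert (I0 := Rinv_0_lt_compat _ H0).
  intros x y Hx Hxy; apply Hm.
  + apply Rinv_0_lt_compat; lra.
  + apply Rinv_le_contravar; lra.
  + rewrite <- (Rinv_inv x0); apply Rinv_le_contravar; lra.
- assert (I0 := Rinv_0_lt_compat _ H0).
  intros x Hx; apply HM; [apply Rinv_0_lt_compat; lra|].
  rewrite <- (Rinv_inv x0); apply Rinv_le_contravar; lra.
- exists l.
  apply (filterlim_ext_loc (fun x => u (/ / x))).
    exists posreal_one; intros y _ Hy; now rewrite Rinv_inv.
  apply (filterlim_comp _ _ _ Rinv (fun z => u (/ z)) _ _ _ filterlim_Rinv_0_right Hl).
Qed.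

Lemma Rpower_pos x p : 0 < Rpower x p.
Proof. apply exp_pos. Qed.

Lemma filterlim_Rpower_0 p : 0 < p -> filterlim (fun x => Rpower x p) (at_right 0) (locally 0).
Proof.
intros Hp; apply filterlim_locally; intros [e He]; simpl.
generalize (at_right_lt 0 (Rpower e (/ p)) (Rpower_pos _ _)); apply filter_imp.
intros x Hx.
change (Rabs (Rpower x p - 0) < e).
rewrite Rminus_0_r, Rabs_pos_eq by apply Rlt_le, Rpower_pos.
apply Rlt_le_trans with (Rpower (Rpower e (/ p)) p).
  apply Rlt_Rpower_l; [easy|tauto].
rewrite Rpower_mult, Rinv_l, Rpower_1 by (easy || lra); lra.
Qed.

Lemma gamma_tail_mono s e e' : 0 < e -> e <= e' -> gamma_tail s e' <= gamma_tail s e.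
Proof.
intros He Hee'.
rewrite (gamma_tail_Chasles s e e') by lra.
assert (0 <= RInt (gamma_integrand s) e e'); [|lra].
apply RInt_ge_0; [easy|apply ex_RInt_gamma_integrand; lra|].
intros; apply Rlt_le, Rmult_lt_0_compat; apply exp_pos.
Qed.

(** On (0, 1] the integrand is at most u^(s - 1), whose integral is at most 1 / s; this is where s >
    0 enters. *)
Lemma gamma_tail_cv s : 0 < s -> exists l, filterlim (gamma_tail s) (at_right 0) (locally l).
Proof.
intros Hs.
apply (mono_bounded_cv_0 _ 1 (1 / s + gamma_tail s 1)); [lra| |].
- intros x y Hx Hxy _; now apply gamma_tail_mono.
- intros x Hx Hx1; rewrite (gamma_tail_Chasles s x 1) by lra.
  apply Rplus_le_compat_r.
  assert (HR : is_RInt (fun u => Rpower u (s - 1)) x 1 (minus (/ s * Rpower 1 s) (/ s * Rpower x s))).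
  { apply (is_RInt_derive (V := R_CompleteNormedModule) (fun u => / s * Rpower u s)).
    - intros u; rewrite Rmin_left, Rmax_right by lra; intros Hu.
      eapply is_derive_eq; [apply (is_derive_scal (fun u => Rpower u s)), is_derive_Rpower; lra|].
      unfold Rminus; rewrite Rpower_plus, Rpower_Ropp, Rpower_1 by lra; field; lra.
    - intros u; rewrite Rmin_left, Rmax_right by lra; intros Hu.
      apply (ex_derive_continuous (K := R_AbsRing) (V := R_NormedModule)).
      eexists; apply is_derive_Rpower; lra. }
  apply Rle_trans with (RInt (fun u => Rpower u (s - 1)) x 1).
  + apply RInt_le; [easy|apply ex_RInt_gamma_integrand; lra|eexists; apply HR|].
    intros u Hu; unfold gamma_integrand.
    rewrite <- (Rmult_1_r (Rpower u (s - 1))) at 2.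
    apply Rmult_le_compat_l; [apply Rlt_le, Rpower_pos|].
    rewrite <- exp_0; apply exp_le; lra.
  + rewrite (is_RInt_unique _ _ _ _ HR); unfold minus, plus, opp; simpl.
    assert (Hi := Rinv_0_lt_compat s Hs).
    replace (Rpower 1 s) with 1.
      generalize (Rpower_pos x s); unfold Rdiv; nra.
    unfold Rpower; now rewrite ln_1, Rmult_0_r, exp_0.
Qed.

Lemma is_RInt_gen_filterlim_r (f : R -> R) a F {FF : Filter F} (l : R) :
  F (fun c => ex_RInt f a c) -> filterlim (fun c => RInt f a c) F (locally l) ->
  is_RInt_gen f (at_point a) F l.
Proof.
intros He Hl P HP.
apply (Filter_prod _ _ _ (fun x => x = a) (fun c => ex_RInt f a c /\ P (RInt f a c))).
- easy.
- apply filter_and; [easy|]; now apply Hl.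
- intros x c -> [H1 H2]; exists (RInt f a c); split; [|easy].
  now apply (RInt_correct (V := R_CompleteNormedModule)).
Qed.

(** [Gamma] is improper at both ends; it is split at 1, where the piece near 0 is the limit of
    differences of [gamma_tail]. *)
Lemma filterlim_gamma_tail s : 0 < s -> filterlim (gamma_tail s) (at_right 0) (locally (Gamma s)).
Proof.
intros Hs; destruct (gamma_tail_cv s Hs) as [l Hl].
replace (Gamma s) with l; [easy|]; symmetry.
apply (is_RInt_gen_unique (V := R_CompleteNormedModule) (gamma_integrand s)).
replace l with (plus (l - gamma_tail s 1) (gamma_tail s 1)) by (unfold plus; simpl; ring).
apply (is_RInt_gen_Chasles (gamma_integrand s) 1).
- replace (l - gamma_tail s 1) with (opp (gamma_tail s 1 - l)) by (unfold opp; simpl; ring).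
  apply (is_RInt_gen_swap (V := R_NormedModule)).
  apply is_RInt_gen_filterlim_r; [typeclasses eauto| |].
  + generalize (at_right_lt 0 1 Rlt_0_1); apply filter_imp; intros c Hc.
    apply ex_RInt_gamma_integrand; lra.
  + apply (filterlim_ext_loc (fun c => gamma_tail s 1 + - gamma_tail s c)).
    * generalize (at_right_lt 0 1 Rlt_0_1); apply filter_imp; intros c Hc.
      rewrite (gamma_tail_Chasles s 1 c) by lra; ring.
    * apply filterlimR_plus; [typeclasses eauto|apply filterlim_const|].
      apply filterlimR_opp; [typeclasses eauto|easy].
- apply is_RInt_gen_filterlim_r; [typeclasses eauto| |apply gamma_tail_lim; lra].
  exists 0; intros c Hc; apply ex_RInt_gamma_integrand; lra.
Qed.

Lemma Gamma_pos s : 0 < s -> 0 < Gamma s.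
Proof.
intros Hs.
assert (H1 : 0 < RInt (gamma_integrand s) 1 2).
{ apply RInt_gt_0; [lra| |].
  - intros; apply Rmult_lt_0_compat; apply exp_pos.
  - intros; apply continuous_gamma_integrand; lra. }
apply Rlt_le_trans with (1 := H1).
apply Rle_trans with (gamma_tail s 1).
- apply (filterlim_le (F := Rbar_locally p_infty) (fun _ => RInt (gamma_integrand s) 1 2)
    (fun c => RInt (gamma_integrand s) 1 c) (RInt (gamma_integrand s) 1 2) (gamma_tail s 1)).
  + exists 2; intros c Hc.
    rewrite <- (RInt_Chasles (V := R_CompleteNormedModule) (gamma_integrand s) 1 2 c)
      by (apply ex_RInt_gamma_integrand; lra).
    assert (0 <= RInt (gamma_integrand s) 2 c).
      apply RInt_ge_0; [lra|apply ex_RInt_gamma_integrand; lra|].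
      intros; apply Rlt_le, Rmult_lt_0_compat; apply exp_pos.
    unfold plus; simpl; lra.
  + apply filterlim_const.
  + apply gamma_tail_lim; lra.
- apply (filterlim_le (F := at_right 0) (fun _ => gamma_tail s 1) (gamma_tail s) (gamma_tail s 1) (Gamma s)).
  + generalize (at_right_lt 0 1 Rlt_0_1); apply filter_imp; intros c Hc.
    apply gamma_tail_mono; lra.
  + apply filterlim_const.
  + now apply filterlim_gamma_tail.
Qed.

(** Integration by parts in the logarithmic variable; the value exp (- e) at t = 0 is the boundary
    term. *)
Lemma gamma_tail_succ s e : 0 < e -> gamma_tail (s + 1) e = s * gamma_tail s e + Rpower e s * exp (- e).
Proof.
intros He.
assert (Z : int0 (fun t => s * log_gamma_integrand s e t + - e * log_gamma_integrand (s + 1) e t)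
  (0 - log_gamma_integrand s e 0)).
{ apply int0_derive.
  - intros t; unfold log_gamma_integrand; auto_derive; [easy|].
    replace ((s + 1) * t) with (s * t + t) by ring; rewrite (exp_plus (s * t) t); ring.
  - intros t; apply continuous_plusR;
      (apply continuous_multR; [apply continuous_const|apply continuous_log_gamma_integrand]).
  - apply (filterlim_0_exp_bound _ (exp ((s + 1) ^ 2 / e)) 1); [lra|].
    intros t Ht; now apply log_gamma_integrand_abs_le. }
assert (Z2 := int0_plus _ _ _ _ (int0_scal s _ _ (scaled_tail_int0 s e He))
  (int0_scal (- e) _ _ (scaled_tail_int0 (s + 1) e He))).
generalize (int0_unique _ _ _ Z Z2).
replace (log_gamma_integrand s e 0) with (exp (- e))
  by (unfold log_gamma_integrand; now rewrite Rmult_0_r, exp_0, !Rmult_1_r).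
intros E; unfold gamma_tail.
rewrite Rpower_plus, Rpower_1 by easy.
replace (Rpower e s * e * scaled_tail (s + 1) e) with (Rpower e s * (e * scaled_tail (s + 1) e)) by ring.
replace (e * scaled_tail (s + 1) e) with (s * scaled_tail s e + exp (- e)) by lra.
ring.
Qed.

Lemma Gamma_succ s : 0 < s -> Gamma (s + 1) = s * Gamma s.
Proof.
intros Hs.
apply (filterlim_locally_unique (K := R_AbsRing) (V := R_NormedModule)
  (F := at_right 0) (gamma_tail (s + 1))).
  apply filterlim_gamma_tail; lra.
apply (filterlim_ext_loc (fun e => s * gamma_tail s e + Rpower e s * exp (- e))).
  generalize (at_right_lt 0 1 Rlt_0_1); apply filter_imp; intros e He.
  symmetry; apply gamma_tail_succ; lra.
replace (s * Gamma s) with (s * Gamma s + 0 * exp (- 0)) by ring.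
apply filterlimR_plus; [typeclasses eauto| |].
- apply filterlimR_mult; [typeclasses eauto|apply filterlim_const|now apply filterlim_gamma_tail].
- apply filterlimR_mult; [typeclasses eauto|now apply filterlim_Rpower_0|].
  apply (filterlim_filter_le_1 _ (F := locally 0)).
    intros P HP; apply filter_le_within, HP.
  apply (continuous_comp Ropp exp).
    apply (continuous_opp (K := R_AbsRing) (V := R_NormedModule)), continuous_id.
  apply continuous_expR, continuous_id.
Qed.

Lemma lipschitz_1 (f df : R -> R) a b :
  (forall x, is_derive f x (df x)) -> (forall x, Rabs (df x) <= 1) ->
  Rabs (f a - f b) <= Rabs (a - b).
Proof.
intros Hf Hd.
destruct (MVT_gen f b a df) as [c [_ ->]].
- intros; apply Hf.
- intros; eapply is_derive_continuity_pt, Hf.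
- rewrite Rabs_mult; generalize (Rabs_pos (a - b)) (Hd c); nra.
Qed.

(** For y = sinh s > 0, pi / 2 - atan y = atan (1 / y) <= 1 / y. With exp s <= 2 y + 1 the product
    by exp s is at most 2 + pi / 2, below 4. *)
Lemma PI2_minus_eta_bounds s : 0 <= s -> 0 <= PI / 2 - eta s <= 4 * exp (- s).
Proof.
intros Hs; unfold eta.
generalize (atan_bound (sinh s)) PI_4 (sinh_nonneg s Hs); intros B P4 S0.
split; [lra|].
apply Rmult_le_reg_r with (exp s); [apply exp_pos|].
rewrite Rmult_assoc, <- exp_plus, Rplus_opp_l, exp_0.
assert (E : exp s <= 2 * sinh s + 1).
{ unfold sinh; generalize (exp_pos s); intros.
  assert (exp (- s) <= 1) by (rewrite <- exp_0; apply exp_le; lra); lra. }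
assert (A0 : 0 <= atan (sinh s)).
{ destruct S0 as [S0|S0]; [|rewrite <- S0, atan_0; lra].
  rewrite <- atan_0; now apply Rlt_le, atan_increasing. }
assert (T : (PI / 2 - atan (sinh s)) * sinh s <= 1).
{ destruct S0 as [S0|S0]; [|rewrite <- S0; lra].
  rewrite <- atan_inv by easy.
  apply Rmult_le_reg_r with (/ sinh s); [now apply Rinv_0_lt_compat|].
  rewrite Rmult_assoc, Rinv_r, Rmult_1_r, Rmult_1_l by lra.
  apply Rle_trans with (1 := Rle_abs _).
  rewrite <- (Rminus_0_r (atan _)), <- atan_0.
  rewrite <- (Rabs_pos_eq (/ sinh s)) at 2 by (apply Rlt_le, Rinv_0_lt_compat, S0).
  rewrite <- (Rminus_0_r (/ sinh s)) at 2.
  apply (lipschitz_1 atan (fun x => / (1 + x²))).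
    apply is_derive_atan.
  intros x; generalize (Rle_0_sqr x); intros.
  rewrite Rabs_pos_eq by (apply Rlt_le, Rinv_0_lt_compat; lra).
  rewrite <- Rinv_1; apply Rinv_le_contravar; lra. }
nra.
Qed.

(** * Behaviour of the outgoing solution at the origin *)

Lemma exp_opp_lipschitz a b : 0 <= a -> 0 <= b -> Rabs (exp (- a) - exp (- b)) <= Rabs (a - b).
Proof.
assert (W : forall a b, 0 <= a -> a <= b -> Rabs (exp (- a) - exp (- b)) <= Rabs (a - b)).
{ clear a b; intros a b Ha Hab.
  assert (exp (- b) <= exp (- a)) by (apply exp_le; lra).
  rewrite Rabs_pos_eq, Rabs_minus_sym, Rabs_pos_eq by lra.
  assert (exp (- a) <= 1) by (rewrite <- exp_0; apply exp_le; lra).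
  replace (- b) with (- a + - (b - a)) in * by ring; rewrite exp_plus in *.
  generalize (exp_ge_1_plus (- (b - a))) (exp_pos (- a)); nra. }
intros Ha Hb; destruct (Rle_dec a b).
- now apply W.
- rewrite Rabs_minus_sym, (Rabs_minus_sym a); apply W; lra.
Qed.

Lemma Lam_exp_half_le s : 0 <= s -> Rabs (Lam s - exp s / 2) <= 2 * exp (- s).
Proof.
intros Hs; unfold Lam.
assert (H : 0 < / cosh s <= 2 * exp (- s)).
{ split; [apply inv_cosh_bounds|].
  rewrite exp_Ropp; replace (2 * / exp s) with (/ (exp s / 2)) by (field; apply Rgt_not_eq, exp_pos).
  generalize (exp_pos s) (exp_pos (- s)); intros.
  apply Rinv_le_contravar; unfold cosh; lra. }
replace (cosh s - / cosh s - exp s / 2) with (exp (- s) / 2 - / cosh s) by (unfold cosh; field;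
  generalize (exp_pos s) (exp_pos (- s)); lra).
generalize (exp_pos (- s)); intros; apply Rabs_le; lra.
Qed.

(** Replacing Lam s by exp s / 2 and k by c exp (nu s) turns the integral into c (x / 2)^(- nu)
    times the incomplete Gamma function at x / 2. The error is bounded uniformly in x < 1, so the
    factor x^nu kills it. *)
Lemma laplace_at_0 nu d k c M :
  0 < nu -> 0 < d -> d <= 1 - nu -> exp_bounded nu k ->
  (forall s, 0 <= s -> Rabs (k s - c * exp (nu * s)) <= M * exp (- (d * s))) ->
  filterlim (fun x => Rpower x nu * laplace k x) (at_right 0) (locally (c * Rpower 2 nu * Gamma nu)).
Proof.
intros Hn Hd Hdn Hk HM.
(* The first summand is the error of the kernel, the second that of Lam. *)
set (K := M / d + 2 * Rabs c / d).
assert (Hb : forall x, 0 < x < 1 ->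
  Rabs (Rpower x nu * laplace k x - c * Rpower 2 nu * gamma_tail nu (x / 2)) <= Rpower x nu * K).
{ intros x Hx; unfold gamma_tail.
  replace (c * Rpower 2 nu * (Rpower (x / 2) nu * scaled_tail nu (x / 2)))
    with (Rpower x nu * (c * scaled_tail nu (x / 2))).
  2: { replace x with (2 * (x / 2)) at 1 by field.
       rewrite <- Rpower_mult_distr by lra; ring. }
  rewrite <- Rmult_minus_distr_l, Rabs_mult, (Rabs_pos_eq (Rpower x nu)) by apply Rlt_le, Rpower_pos.
  apply Rmult_le_compat_l; [apply Rlt_le, Rpower_pos|].
  apply (int0_abs_le (fun s => exp (- (x * Lam s)) * k s - c * log_gamma_integrand nu (x / 2) s)
    (fun s => M * exp (- (d * s)) + 2 * Rabs c * exp (- (d * s)))).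
  - apply int0_minus; [now apply laplace_int0 with nu|].
    apply int0_scal, scaled_tail_int0; lra.
  - apply int0_plus; now apply int0_exp.
  - intros s Hs; unfold log_gamma_integrand.
    replace (_ - _) with (exp (- (x * Lam s)) * (k s - c * exp (nu * s)) +
      c * exp (nu * s) * (exp (- (x * Lam s)) - exp (- (x / 2 * exp s)))) by ring.
    apply Rle_trans with (1 := Rabs_triang _ _).
    rewrite !Rabs_mult, !(Rabs_pos_eq (exp _)) by apply Rlt_le, exp_pos.
    assert (L := Lam_nonneg s).
    apply Rplus_le_compat.
    + rewrite <- (Rmult_1_l (M * _)).
      apply Rmult_le_compat; [apply Rlt_le, exp_pos|apply Rabs_pos| |now apply HM].
      rewrite <- exp_0; apply exp_le; nra.
    + rewrite (Rmult_comm 2), !Rmult_assoc; apply Rmult_le_compat_l; [apply Rabs_pos|].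
      apply Rle_trans with (exp (nu * s) * (2 * exp (- s))).
      * apply Rmult_le_compat_l; [apply Rlt_le, exp_pos|].
        apply Rle_trans with (Rabs (x * Lam s - x / 2 * exp s)).
          apply exp_opp_lipschitz; [nra|generalize (exp_pos s); nra].
        replace (x * Lam s - x / 2 * exp s) with (x * (Lam s - exp s / 2)) by field.
        rewrite Rabs_mult, Rabs_pos_eq by lra.
        apply Rle_trans with (2 := Lam_exp_half_le s Hs).
        generalize (Rabs_pos (Lam s - exp s / 2)); nra.
      * replace (exp (nu * s) * (2 * exp (- s))) with (2 * (exp (nu * s) * exp (- s))) by ring.
        rewrite <- exp_plus; apply Rmult_le_compat_l; [lra|apply exp_le; nra]. }
assert (HK0 : filterlim (fun x => Rpower x nu * K) (at_right 0) (locally 0)).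
  rewrite <- (Rmult_0_l K) at 2.
  apply filterlimR_mult; [typeclasses eauto|now apply filterlim_Rpower_0|apply filterlim_const].
apply (filterlim_ext (fun x => (Rpower x nu * laplace k x - c * Rpower 2 nu * gamma_tail nu (x / 2))
  + c * Rpower 2 nu * gamma_tail nu (x / 2))).
  intros; ring.
rewrite <- (Rplus_0_l (c * _ * _)).
apply filterlimR_plus; [typeclasses eauto| |].
- apply filterlim_locally; intros e.
  apply filterlim_locally with (eps := e) in HK0.
  generalize (filter_and _ _ HK0 (at_right_lt 0 1 Rlt_0_1)); apply filter_imp.
  intros x [B Hx].
  change (Rabs (Rpower x nu * laplace k x - c * Rpower 2 nu * gamma_tail nu (x / 2) - 0) < e).
  change (Rabs (Rpower x nu * K - 0) < e) in B.
  rewrite Rminus_0_r in *.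
  apply Rle_lt_trans with (2 := B), Rle_trans with (2 := Rle_abs _), Hb, Hx.
- apply filterlimR_mult; [typeclasses eauto|apply filterlim_const|].
  apply (filterlim_comp _ _ _ (fun x => x / 2) (gamma_tail nu) _ (at_right 0)).
  + intros P [e He]; exists e; intros y Hy Hy0.
    apply He; [|lra].
    change (Rabs (y - 0) < e) in Hy; change (Rabs (y / 2 - 0) < e).
    rewrite Rminus_0_r in *; rewrite Rabs_pos_eq in * by lra; lra.
  + now apply filterlim_gamma_tail.
Qed.

(** cosh and sinh of nu s are exp (nu s) / 2 up to exp (- nu s) / 2, eta tends to pi / 2 at rate exp
    (- s), and the other term carries 1 / cosh s. These errors contribute 1/2, 2 and 2, below 5 in
    total. *)
Lemma ker_asymptotic nu d s : 0 < nu < 1 -> d <= nu -> d <= 1 - nu -> 0 <= s ->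
  Rabs (kerRe nu s - / 2 * cos (nu * (PI / 2)) * exp (nu * s)) <= 5 * exp (- (d * s)) /\
  Rabs (kerIm nu s - / 2 * sin (nu * (PI / 2)) * exp (nu * s)) <= 5 * exp (- (d * s)).
Proof.
intros Hn Hd1 Hd2 Hs.
assert (E := PI2_minus_eta_bounds s Hs).
assert (Hc : 0 < / cosh s <= 2 * exp (- s)).
{ split; [apply inv_cosh_bounds|].
  rewrite exp_Ropp; replace (2 * / exp s) with (/ (exp s / 2)) by (field; apply Rgt_not_eq, exp_pos).
  generalize (exp_pos s) (exp_pos (- s)); intros.
  apply Rinv_le_contravar; unfold cosh; lra. }
assert (F1 : exp (nu * s) * exp (- s) <= exp (- (d * s))) by (rewrite <- exp_plus; apply exp_le; nra).
assert (F2 : exp (- (nu * s)) <= exp (- (d * s))) by (apply exp_le; nra).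
assert (P1 := exp_pos (nu * s)).
assert (P2 := exp_pos (- (nu * s))).
assert (P3 := exp_pos (- s)).
assert (Hh : 0 <= sinh (nu * s) <= exp (nu * s) /\ 0 <= cosh (nu * s) <= exp (nu * s)).
{ generalize (sinh_nonneg (nu * s) ltac:(nra)) (cosh_ge_1 (nu * s)) (cosh_plus_sinh (nu * s)); lra. }
assert (Hd : forall z, Rabs z <= Rabs (nu * eta s - nu * (PI / 2)) -> Rabs z <= 4 * exp (- s)).
{ intros z Hz; apply Rle_trans with (1 := Hz).
  replace (nu * eta s - nu * (PI / 2)) with (- (nu * (PI / 2 - eta s))) by ring.
  rewrite Rabs_Ropp, Rabs_pos_eq by (apply Rmult_le_pos; lra).
  apply Rle_trans with (1 * (PI / 2 - eta s)); [apply Rmult_le_compat_r|]; lra. }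
assert (Dc : Rabs (cos (nu * eta s) - cos (nu * (PI / 2))) <= 4 * exp (- s)).
{ apply Hd, (lipschitz_1 cos (fun x => - sin x)); [apply is_derive_cos|].
  intros x; rewrite Rabs_Ropp; apply Rabs_le, SIN_bound. }
assert (Ds : Rabs (sin (nu * eta s) - sin (nu * (PI / 2))) <= 4 * exp (- s)).
{ apply Hd, (lipschitz_1 sin cos); [apply is_derive_sin|].
  intros x; apply Rabs_le, COS_bound. }
assert (B1 : forall a z, -1 <= z <= 1 -> 0 <= a <= exp (nu * s) -> Rabs (a * z / cosh s) <= 2 * exp (- (d * s))).
{ intros a z Hz Ha; unfold Rdiv; rewrite Rabs_mult, (Rabs_pos_eq (/ cosh s)) by lra.
  apply Rle_trans with (exp (nu * s) * (2 * exp (- s))); [|lra].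
  apply Rmult_le_compat; [apply Rabs_pos|lra| |tauto].
  assert (- a <= a * z <= a) by nra; apply Rabs_le; lra. }
assert (B2 : forall z, -1 <= z <= 1 -> Rabs (/ 2 * exp (- (nu * s)) * z) <= / 2 * exp (- (d * s))).
{ intros z Hz; assert (- exp (- (nu * s)) <= exp (- (nu * s)) * z <= exp (- (nu * s))) by nra.
  rewrite Rmult_assoc; apply Rabs_le; lra. }
assert (B3 : forall z, Rabs z <= 4 * exp (- s) -> Rabs (/ 2 * exp (nu * s) * z) <= 2 * exp (- (d * s))).
{ intros z Hz; rewrite Rabs_mult, Rabs_pos_eq by nra.
  apply Rle_trans with (/ 2 * exp (nu * s) * (4 * exp (- s))); [|lra].
  apply Rmult_le_compat_l; lra. }
assert (T3 : forall u v w, Rabs u <= 2 * exp (- (d * s)) -> Rabs v <= / 2 * exp (- (d * s)) ->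
  Rabs w <= 2 * exp (- (d * s)) -> Rabs (u + v + w) <= 5 * exp (- (d * s))).
{ intros u v w; intros; apply Rle_trans with (1 := Rabs_triang _ _).
  generalize (Rabs_triang u v) (exp_pos (- (d * s))); lra. }
split.
- replace (_ - _) with (/ 2 * exp (nu * s) * (cos (nu * eta s) - cos (nu * (PI / 2)))
    + / 2 * exp (- (nu * s)) * cos (nu * eta s) + - (sinh (nu * s) * sin (nu * eta s) / cosh s)).
  + apply T3; [now apply B3|apply B2, COS_bound|].
    rewrite Rabs_Ropp; apply B1; [apply SIN_bound|tauto].
  + unfold kerRe; unfold cosh at 2; field; generalize (cosh_ge_1 s); lra.
- replace (_ - _) with (/ 2 * exp (nu * s) * (sin (nu * eta s) - sin (nu * (PI / 2)))
    + / 2 * exp (- (nu * s)) * (- sin (nu * eta s)) + cosh (nu * s) * cos (nu * eta s) / cosh s).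
  + apply T3; [now apply B3|apply B2; generalize (SIN_bound (nu * eta s)); lra|].
    apply B1; [apply COS_bound|tauto].
  + unfold kerIm; unfold sinh; field; generalize (cosh_ge_1 s); lra.
Qed.

Lemma outgoing_at_0 al : -1 < al < 1 ->
  filterlim (outgoing al) (at_right 0)
    (locally (RtoC (/ 2 * Rpower 2 ((1 + al) / 2) * Gamma ((1 + al) / 2)) * cis ((1 + al) / 2 * (PI / 2)))%C).
Proof.
intros Hal; set (nu := (1 + al) / 2).
assert (Hn : 0 < nu < 1) by (unfold nu; lra).
(* One rate for both kinds of error, exp (- nu s) and exp ((nu - 1) s). *)
set (d := Rmin nu (1 - nu)).
assert (Hd : 0 < d) by (apply Rmin_glb_lt; lra).
assert (Hd1 : d <= nu) by apply Rmin_l.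
assert (Hd2 : d <= 1 - nu) by apply Rmin_r.
apply (filterlim_ext (fun x => cis x * ((Rpower x nu * laplace (kerRe nu) x)%R, (Rpower x nu * laplace (kerIm nu) x)%R))%C).
  intros x; unfold outgoing, hankel; fold nu; apply injective_projections; simpl; ring.
rewrite <- (Cmult_1_l (RtoC _ * _)%C).
apply filterlimC_mult; [typeclasses eauto| |].
- rewrite <- cis_0; apply filterlim_C; [typeclasses eauto|]; simpl.
  split; (apply (filterlim_filter_le_1 _ (F := locally 0)); [intros P HP; apply filter_le_within, HP|]).
  + apply continuous_cos.
  + apply continuous_sin.
- apply filterlim_C; [typeclasses eauto|]; split; simpl.
  + replace (_ - _) with (/ 2 * cos (nu * (PI / 2)) * Rpower 2 nu * Gamma nu) by ring.
    apply (laplace_at_0 nu d _ _ 5); try easy; [now apply exp_bounded_kerRe, Rlt_le|].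
    intros s Hs; now apply ker_asymptotic.
  + replace (_ + _) with (/ 2 * sin (nu * (PI / 2)) * Rpower 2 nu * Gamma nu) by ring.
    apply (laplace_at_0 nu d _ _ 5); try easy; [now apply exp_bounded_kerIm, Rlt_le|].
    intros s Hs; now apply ker_asymptotic.
Qed.

(** * The normalized outgoing solution *)

(* The equation [f'' - (al / x) f' + E f = 0] on [x > 0] as a first order system,
   with [h = x ^ (- al) * f']. *)
Definition radial_solution (al E : R) (f h : R -> C) : Prop :=
  forall x, 0 < x ->
    is_derivC f x (RtoC (Rpower x al) * h x)%C /\
    is_derivC h x (- (RtoC (E * Rpower x (- al)) * f x))%C.

Lemma outgoing_amplitude al x : 0 < x ->
  outgoing al x = (RtoC (Rpower x (al / 2)) * cis x * amplitude ((1 + al) / 2) x)%C.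
Proof.
intros Hx; unfold outgoing, amplitude.
replace ((1 + al) / 2) with (al / 2 + / 2) at 1 by field.
rewrite Rpower_plus, Rpower_sqrt, RtoC_mult by easy; ring.
Qed.

Lemma Rpower_opp_mult x p : Rpower x p * Rpower x (- p) = 1.
Proof.
unfold Rpower; rewrite <- exp_plus, <- exp_0; f_equal; ring.
Qed.

(** With X' = i x^al Y and Y' = i x^(- al) X, the derivative of conj X * Y is i (x^(- al) |X|^2 -
    x^al |Y|^2), which is purely imaginary. *)
Lemma outgoing_wronskian al : -1 < al < 1 -> exists w, forall x, 0 < x ->
  Re (Cconj (outgoing al x) * outgoing (- al) x)%C = w.
Proof.
intros Hal; exists (Re (Cconj (outgoing al 1) * outgoing (- al) 1)%C); intros x Hx.
apply (derive_zero_const (fun x => Re (Cconj (outgoing al x) * outgoing (- al) x)%C)); [|easy|lra].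
clear x Hx; intros x Hx.
refine (is_derive_eq _ _ _ _ (proj1 (is_derivC_mult _ _ _ _ _
  (is_derivC_conj _ _ _ (is_derivC_outgoing al x Hal Hx))
  (is_derivC_outgoing (- al) x ltac:(lra) Hx))) _).
rewrite Ropp_involutive; destruct (outgoing al x), (outgoing (- al) x); simpl; ring.
Qed.

Lemma filterlim_scale_infty k : 0 < k ->
  filterlim (fun x => k * x) (Rbar_locally p_infty) (Rbar_locally p_infty).
Proof.
intros Hk P [M HM]; exists (M / k); intros x Hx; apply HM.
replace M with (k * (M / k)) by (field; lra).
now apply Rmult_lt_compat_l.
Qed.

Lemma filterlim_scale_0 k : 0 < k -> filterlim (fun x => k * x) (at_right 0) (at_right 0).
Proof.
intros Hk P [e He].
assert (He' : 0 < e / k) by (apply Rmult_lt_0_compat; [apply e|now apply Rinv_0_lt_compat]).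
exists (mkposreal _ He'); intros x Hx Hx0; apply He; [|now apply Rmult_lt_0_compat].
change (Rabs (x - 0) < e / k) in Hx; change (Rabs (k * x - 0) < e).
rewrite Rminus_0_r in *; rewrite Rabs_mult, (Rabs_pos_eq k) by lra.
replace (pos e) with (k * (e / k)) by (field; lra).
now apply Rmult_lt_compat_l.
Qed.

(** The modulus of x^(- al) f' / f at 0+ for the outgoing solution: sqrt E to the power 1 + al times
    the quotient of the two limits given by [outgoing_at_0] for - al and al. *)
Definition impedance (al E : R) : R :=
  Rpower E ((1 + al) / 2) * (Rpower 2 (- al) * Gamma ((1 - al) / 2) / Gamma ((1 + al) / 2)).

Lemma filterlimR_unique {T} (F : (T -> Prop) -> Prop) {FF : ProperFilter F} (f : T -> R) (l m : R) :
  filterlim f F (locally l) -> filterlim f F (locally m) -> l = m.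
Proof.
intros H1 H2.
exact (filterlim_locally_unique (K := R_AbsRing) (V := R_NormedModule) f l m H1 H2).
Qed.

Lemma filterlimC_unique {T} (F : (T -> Prop) -> Prop) {FF : ProperFilter F} (f : T -> C) (l m : C) :
  filterlim f F (locally l) -> filterlim f F (locally m) -> l = m.
Proof.
intros H1 H2; apply filterlim_C in H1; [|typeclasses eauto]; apply filterlim_C in H2; [|typeclasses eauto].
destruct H1 as [A1 B1], H2 as [A2 B2]; apply injective_projections.
- exact (filterlimR_unique F _ _ _ A1 A2).
- exact (filterlimR_unique F _ _ _ B1 B2).
Qed.

(** The conserved Wronskian equals |L|^2 at infinity. At 0 it is a positive number times the cosine
    of the phase difference al pi / 2, which lies strictly between - pi / 2 and pi / 2. *)
Lemma outgoing_cv al : -1 < al < 1 -> exists L : C, L <> 0 /\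
  filterlim (amplitude ((1 + al) / 2)) (Rbar_locally p_infty) (locally L).
Proof.
intros Hal.
destruct (amplitude_cv ((1 + al) / 2) ltac:(lra)) as [L [H1 H2]].
exists L; split; [|easy].
replace (1 - (1 + al) / 2) with ((1 + - al) / 2) in H2 by field.
destruct (outgoing_wronskian al Hal) as [w Hw].
assert (W0 := filterlimC_mult (at_right 0) _ _ _ _ (filterlimC_conj _ _ _ (outgoing_at_0 al Hal))
  (outgoing_at_0 (- al) ltac:(lra))).
apply filterlim_C in W0; [|typeclasses eauto]; destruct W0 as [W0 _].
assert (E0 : filterlim (fun x => Re (Cconj (outgoing al x) * outgoing (- al) x)%C) (at_right 0) (locally w)).
{ apply (filterlim_ext_loc (fun _ => w)); [|apply filterlim_const].
  generalize (at_right_lt 0 1 Rlt_0_1); apply filter_imp; intros x Hx; symmetry; apply Hw; lra. }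
assert (Ew := filterlimR_unique _ _ _ _ W0 E0).
assert (Wi := filterlimC_mult _ _ _ _ _ (filterlimC_conj _ _ _ H1) H2).
apply filterlim_C in Wi; [|typeclasses eauto]; destruct Wi as [Wi _].
assert (Ei : filterlim (fun x => Re (Cconj (amplitude ((1 + al) / 2) x) * amplitude ((1 + - al) / 2) x)%C)
  (Rbar_locally p_infty) (locally w)).
{ apply (filterlim_ext_loc (fun _ => w)); [|apply filterlim_const].
  exists 0; intros x Hx; rewrite <- (Hw x Hx), !outgoing_amplitude by easy.
  replace (- al / 2) with (- (al / 2)) by field.
  assert (P := Rpower_opp_mult x (al / 2)).
  assert (Q := sin2_cos2 x); unfold Rsqr in Q.
  destruct (amplitude ((1 + al) / 2) x) as [u v], (amplitude ((1 + - al) / 2) x) as [u' v']; simpl.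
  set (p := Rpower x (al / 2)) in *; set (q := Rpower x (- (al / 2))) in *.
  set (c := cos x) in *; set (s := sin x) in *.
  transitivity ((p * q) * (s * s + c * c) * (u * u' + v * v')); [ring|].
  rewrite P, Q; ring. }
assert (Ew2 := filterlimR_unique _ _ _ _ Wi Ei).
intros ->.
assert (Wpos : 0 < w); [|simpl in Ew2; lra].
rewrite <- Ew.
set (p := / 2 * Rpower 2 ((1 + al) / 2) * Gamma ((1 + al) / 2)).
set (q := / 2 * Rpower 2 ((1 + - al) / 2) * Gamma ((1 + - al) / 2)).
assert (Hp : 0 < p) by (repeat apply Rmult_lt_0_compat; [lra|apply Rpower_pos|apply Gamma_pos; lra]).
assert (Hq : 0 < q) by (repeat apply Rmult_lt_0_compat; [lra|apply Rpower_pos|apply Gamma_pos; lra]).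
set (u := (1 + al) / 2 * (PI / 2)); set (v := (1 + - al) / 2 * (PI / 2)).
replace (Re _) with (p * q * cos (u - v)).
- apply Rmult_lt_0_compat; [now apply Rmult_lt_0_compat|].
  generalize PI_RGT_0; intros; apply cos_gt_0; unfold u, v; nra.
- rewrite cos_minus; simpl; ring.
Qed.

Lemma RtoC_neq_0 x : x <> 0 -> RtoC x <> 0.
Proof. intros H K; apply H; injection K; easy. Qed.

Lemma is_derivC_scale (f : R -> C) k x l : is_derivC f (k * x) l ->
  is_derivC (fun s => f (k * s)) x (RtoC k * l)%C.
Proof.
intros H; apply (is_derivC_comp f (fun s => k * s)); [exact H|].
eapply is_derive_eq; [apply (is_derive_scal (fun s => s)), (is_derive_id (K := R_AbsRing))|].
unfold one; simpl; ring.
Qed.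

(** The interface between the Bessel analysis and the scattering problem: F is the Jost solution, G
    its flux, F0 and G0 their boundary values, and later arguments use only these properties. *)
Definition jost_data (al E : R) (F G : R -> C) (F0 G0 : C) : Prop :=
  radial_solution al E F G /\
  filterlim F (at_right 0) (locally F0) /\
  filterlim G (at_right 0) (locally G0) /\
  filterlim (fun x => RtoC (Rpower x (- (al / 2))) * F x - cis (x * sqrt E))%C
    (Rbar_locally p_infty) (locally (RtoC 0)) /\
  F0 <> 0 /\ G0 = (Ci * RtoC (impedance al E) * cis (- (PI / 2 * al)) * F0)%C.

Lemma jost_solution al E : 0 <= al < 1 -> 0 < E ->
  exists (F G : R -> C) (F0 G0 : C), jost_data al E F G F0 G0.
Proof.
intros Hal HE.
assert (Hal' : -1 < al < 1) by lra.
unfold jost_data; set (k := sqrt E).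
assert (Hk : 0 < k) by now apply sqrt_lt_R0.
destruct (outgoing_cv al Hal') as [L [HL0 HL]].
(* Cancels the factor k^(al / 2) L that [outgoing al (k * x)] has at infinity. *)
set (N := (RtoC (Rpower k (- (al / 2))) / L)%C).
set (X0 := (RtoC (/ 2 * Rpower 2 ((1 + al) / 2) * Gamma ((1 + al) / 2)) * cis ((1 + al) / 2 * (PI / 2)))%C).
set (Y0 := (RtoC (/ 2 * Rpower 2 ((1 + - al) / 2) * Gamma ((1 + - al) / 2)) * cis ((1 + - al) / 2 * (PI / 2)))%C).
exists (fun x => N * outgoing al (k * x))%C,
  (fun x => N * Ci * RtoC (Rpower k (1 + al)) * outgoing (- al) (k * x))%C,
  (N * X0)%C, (N * Ci * RtoC (Rpower k (1 + al)) * Y0)%C.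
assert (G1 := Gamma_pos ((1 + al) / 2) ltac:(lra)).
split; [|split; [|split; [|split; [|split]]]].
- intros x Hx; assert (Hkx : 0 < k * x) by now apply Rmult_lt_0_compat.
  split.
  + eapply is_derivC_eq.
      apply is_derivC_cmult, is_derivC_scale, is_derivC_outgoing; easy.
    rewrite <- Rpower_mult_distr, (Rpower_plus 1 al k), Rpower_1, !RtoC_mult by easy; ring.
  + eapply is_derivC_eq.
      apply is_derivC_cmult, is_derivC_scale, is_derivC_outgoing; (easy || lra).
    rewrite Ropp_involutive, <- Rpower_mult_distr, (Rpower_plus 1 al k), Rpower_1, !RtoC_mult by easy.
    replace (RtoC E) with (RtoC k * RtoC k)%C.
    2: now unfold k; rewrite <- RtoC_mult, sqrt_sqrt by lra.
    assert (P : (RtoC (Rpower k al) * RtoC (Rpower k (- al)) = 1)%C).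
      now rewrite <- RtoC_mult, Rpower_opp_mult.
    transitivity ((Ci * Ci) * (RtoC (Rpower k al) * RtoC (Rpower k (- al))) * RtoC k * RtoC k * RtoC (Rpower x (- al)) * N * outgoing al (k * x))%C; [ring|].
    rewrite P; replace (Ci * Ci)%C with (RtoC (-1)) by (apply injective_projections; simpl; ring).
    ring_simplify; apply injective_projections; simpl; ring.
- apply filterlimC_mult; [typeclasses eauto|apply filterlim_const|].
  apply (filterlim_comp _ _ _ _ _ _ _ _ (filterlim_scale_0 k Hk)).
  now apply outgoing_at_0.
- apply filterlimC_mult; [typeclasses eauto|apply filterlim_const|].
  apply (filterlim_comp _ _ _ _ _ _ _ _ (filterlim_scale_0 k Hk)).
  apply outgoing_at_0; lra.
- assert (A : filterlim (fun x => / L * amplitude ((1 + al) / 2) (k * x) + RtoC (-1))%C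
    (Rbar_locally p_infty) (locally (RtoC 0))).
  { replace (RtoC 0) with (/ L * L + RtoC (-1))%C.
    2: rewrite Cinv_l by easy; apply injective_projections; simpl; ring.
    apply filterlimC_plus; [typeclasses eauto| |apply filterlim_const].
    apply filterlimC_mult; [typeclasses eauto|apply filterlim_const|].
    exact (filterlim_comp _ _ _ _ _ _ _ _ (filterlim_scale_infty k Hk) HL). }
  (* The difference to estimate is [cis (k * x)] times the expression in [A], so the moduli
     agree. *)
  apply (filterlimC_Cmod _ _ _ A).
  exists 0; intros x Hx; assert (Hkx : 0 < k * x) by now apply Rmult_lt_0_compat.
  right; rewrite outgoing_amplitude by easy.
  rewrite <- (Rpower_mult_distr k x), (Rmult_comm x k), RtoC_mult by easy.
  assert (P1 : (RtoC (Rpower k (al / 2)) * RtoC (Rpower k (- (al / 2))) = 1)%C).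
    now rewrite <- RtoC_mult, Rpower_opp_mult.
  assert (P2 : (RtoC (Rpower x (al / 2)) * RtoC (Rpower x (- (al / 2))) = 1)%C).
    now rewrite <- RtoC_mult, Rpower_opp_mult.
  transitivity (Cmod (cis (k * x) * (/ L * amplitude ((1 + al) / 2) (k * x) + RtoC (-1)))%C).
  + f_equal; unfold N, Cdiv.
    transitivity ((RtoC (Rpower k (al / 2)) * RtoC (Rpower k (- (al / 2)))) * (RtoC (Rpower x (al / 2)) * RtoC (Rpower x (- (al / 2)))) * cis (k * x) * / L * amplitude ((1 + al) / 2) (k * x) - cis (k * x))%C; [ring|].
    rewrite P1, P2; replace (RtoC (-1)) with (- RtoC 1)%C by (apply injective_projections; simpl; ring).
    ring.
  + rewrite Cmod_mult, Cmod_cis; ring.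
- apply Cmult_neq_0.
  + apply Cmult_neq_0; [apply RtoC_neq_0, Rgt_not_eq, Rpower_pos|].
    intros K; apply HL0; rewrite <- (Cmult_1_l L), <- (Cinv_r L) by easy; rewrite K; ring.
  + apply Cmult_neq_0; [|apply cis_neq_0].
    apply RtoC_neq_0, Rgt_not_eq; repeat apply Rmult_lt_0_compat; [lra|apply Rpower_pos|easy].
- unfold impedance, X0, Y0.
  replace ((1 + - al) / 2 * (PI / 2)) with (- (PI / 2 * al) + (1 + al) / 2 * (PI / 2)) by field.
  rewrite cis_plus.
  replace ((1 + - al) / 2) with ((1 - al) / 2) by field.
  replace (Rpower k (1 + al)) with (Rpower E ((1 + al) / 2)).
  2: { unfold k; rewrite <- Rpower_sqrt, Rpower_mult by easy; f_equal; field. }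
  replace (Rpower 2 ((1 - al) / 2)) with (Rpower 2 (- al) * Rpower 2 ((1 + al) / 2)).
  2: rewrite <- Rpower_plus; f_equal; field.
  transitivity (N * Ci * cis (- (PI / 2 * al)) * cis ((1 + al) / 2 * (PI / 2)) *
    RtoC (Rpower E ((1 + al) / 2) * (/ 2 * (Rpower 2 (- al) * Rpower 2 ((1 + al) / 2)) * Gamma ((1 - al) / 2))))%C.
    rewrite (RtoC_mult (Rpower E _)); ring.
  replace (Rpower E ((1 + al) / 2) * (/ 2 * (Rpower 2 (- al) * Rpower 2 ((1 + al) / 2)) * Gamma ((1 - al) / 2)))
    with (Rpower E ((1 + al) / 2) * (Rpower 2 (- al) * Gamma ((1 - al) / 2) / Gamma ((1 + al) / 2)) *
      (/ 2 * Rpower 2 ((1 + al) / 2) * Gamma ((1 + al) / 2))) by (field; lra).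
  rewrite (RtoC_mult (Rpower E _ * _)); ring.
Qed.

Lemma radial_solution_conj al E f h : radial_solution al E f h ->
  radial_solution al E (fun x => Cconj (f x)) (fun x => Cconj (h x)).
Proof.
intros H x Hx; destruct (H x Hx) as [H1 H2]; split.
- eapply is_derivC_eq; [exact (is_derivC_conj _ _ _ H1)|].
  apply injective_projections; simpl; ring.
- eapply is_derivC_eq; [exact (is_derivC_conj _ _ _ H2)|].
  apply injective_projections; simpl; ring.
Qed.

Lemma radial_solution_lin al E f h g l c d :
  radial_solution al E f h -> radial_solution al E g l ->
  radial_solution al E (fun x => c * f x + d * g x)%C (fun x => c * h x + d * l x)%C.
Proof.
intros H K x Hx; destruct (H x Hx) as [H1 H2], (K x Hx) as [K1 K2]; split.
- eapply is_derivC_eq; [apply is_derivC_plus; apply is_derivC_cmult; eassumption|ring].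
- eapply is_derivC_eq; [apply is_derivC_plus; apply is_derivC_cmult; eassumption|ring].
Qed.

Lemma radial_wronskian al E f h g l : radial_solution al E f h -> radial_solution al E g l ->
  exists w, forall x, 0 < x -> (f x * l x - h x * g x)%C = w.
Proof.
intros H K; exists (f 1 * l 1 + RtoC (-1) * (h 1 * g 1))%C; intros x Hx.
transitivity (f x * l x + RtoC (-1) * (h x * g x))%C.
  apply injective_projections; simpl; ring.
apply (is_derivC_zero_const (fun x => f x * l x + RtoC (-1) * (h x * g x))%C); [|easy|lra].
clear x Hx; intros x Hx; destruct (H x Hx) as [H1 H2], (K x Hx) as [K1 K2].
eapply is_derivC_eq.
  apply is_derivC_plus; [|apply is_derivC_cmult]; apply is_derivC_mult; eassumption.
apply injective_projections; simpl; ring.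
Qed.

(** Cramer's rule: f and h are recovered at each x from their two constant Wronskians with F and its
    conjugate. *)
Lemma radial_solution_span al E f h F G (w : C) : w <> 0 ->
  radial_solution al E f h -> radial_solution al E F G ->
  (forall x, 0 < x -> (F x * Cconj (G x) - G x * Cconj (F x))%C = w) ->
  exists c d, forall x, 0 < x ->
    f x = (c * F x + d * Cconj (F x))%C /\ h x = (c * G x + d * Cconj (G x))%C.
Proof.
intros Hw Hf HF HW.
destruct (radial_wronskian _ _ _ _ _ _ Hf HF) as [w1 H1].
destruct (radial_wronskian _ _ _ _ _ _ Hf (radial_solution_conj _ _ _ _ HF)) as [w2 H2].
exists (w2 / w)%C, (- (w1 / w))%C; intros x Hx.
specialize (H1 x Hx); specialize (H2 x Hx); specialize (HW x Hx).
assert (A : forall u v : C, (u * w)%C = v -> u = (v / w)%C).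
  intros u v <-; field; easy.
split.
- transitivity ((w2 * F x - w1 * Cconj (F x)) / w)%C; [|field; easy].
  apply A; rewrite <- H1, <- H2, <- HW; ring.
- transitivity ((w2 * G x - w1 * Cconj (G x)) / w)%C; [|field; easy].
  apply A; rewrite <- H1, <- H2, <- HW; ring.
Qed.

(** Taking the limit at 0 gives w = - 2 i Z cos th |F0|^2. *)
Lemma radial_wronskian_conj_neq_0 al E (F G : R -> C) (F0 G0 : C) Z th :
  radial_solution al E F G ->
  filterlim F (at_right 0) (locally F0) -> filterlim G (at_right 0) (locally G0) ->
  F0 <> 0 -> G0 = (Ci * RtoC Z * cis th * F0)%C -> Z <> 0 -> cos th <> 0 ->
  exists w : C, w <> 0 /\ forall x, 0 < x -> (F x * Cconj (G x) - G x * Cconj (F x))%C = w.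
Proof.
intros HF LF LG HF0 EG HZ Hth.
destruct (radial_wronskian _ _ _ _ _ _ HF (radial_solution_conj _ _ _ _ HF)) as [w Hw].
exists w; split; [|exact Hw].
assert (W : w = (F0 * Cconj G0 + - (G0 * Cconj F0))%C).
{ apply (filterlimC_unique (at_right 0) (fun x => F x * Cconj (G x) + - (G x * Cconj (F x)))%C).
  - apply (filterlim_ext_loc (fun _ => w)); [|apply filterlim_const].
    generalize (at_right_lt 0 1 Rlt_0_1); apply filter_imp; intros x Hx; symmetry; apply Hw; lra.
  - apply filterlimC_plus; [typeclasses eauto| |].
    + apply filterlimC_mult; [typeclasses eauto|easy|apply filterlimC_conj; [typeclasses eauto|easy]].
    + apply filterlimC_opp; [typeclasses eauto|].
      apply filterlimC_mult; [typeclasses eauto|easy|apply filterlimC_conj; [typeclasses eauto|easy]]. }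
intros W0; apply HF0; rewrite W, EG in W0.
destruct F0 as [u v]; injection W0; simpl; intros HI _.
assert (S : Z * cos th * (u * u + v * v) = 0) by lra.
apply Rmult_integral in S; destruct S as [S|S].
  apply Rmult_integral in S; tauto.
apply injective_projections; simpl; nra.
Qed.

(** * Scattering states *)

Lemma Laplace_Beltrami_radial al f x y :
  Laplace_Beltrami al (fun x' _ => f x') x y = (deriv (deriv f) x - RtoC (al / x) * deriv f x)%C.
Proof.
unfold Laplace_Beltrami.
assert (H0 : forall c t, deriv (fun _ => c) t = 0).
  intros c t; apply is_derivC_deriv, is_derivC_const.
assert (H : deriv (deriv (fun _ => f x)) y = 0).
{ apply is_derivC_deriv, (is_derivC_ext_loc (fun _ => RtoC 0)); [|apply is_derivC_const].
  apply filter_forall; intros t; symmetry; apply H0. }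
change (deriv (fun s => f s)) with (deriv f); rewrite H; ring.
Qed.

(** The left half line is reflected onto x > 0, where the equation is the same. Then [hl] carries
    the sign built into f_1^-, and both fluxes tend to (1 + al) f_1. *)
Definition two_sided_solution (al E : R) (f hr hl : R -> C) : Prop :=
  radial_solution al E f hr /\ radial_solution al E (fun x => f (- x)) hl.

Lemma radial_solution_ext al E f h g l : (forall x, 0 < x -> f x = g x /\ h x = l x) ->
  radial_solution al E f h -> radial_solution al E g l.
Proof.
intros Hfg H x Hx; destruct (H x Hx) as [H1 H2]; destruct (Hfg x Hx) as [E1 E2]; split.
- rewrite <- E2; apply (is_derivC_ext_loc f); [|easy].
  generalize (open_gt 0 x Hx); apply filter_imp; apply Hfg.
- rewrite <- E1; apply (is_derivC_ext_loc h); [|easy].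
  generalize (open_gt 0 x Hx); apply filter_imp; apply Hfg.
Qed.

Lemma radial_solution_of_second_order al E f f1 f2 :
  (forall x, 0 < x -> is_derivC f x (f1 x) /\ is_derivC f1 x (f2 x) /\
     f2 x = (RtoC (al / x) * f1 x - RtoC E * f x)%C) ->
  radial_solution al E f (fun x => RtoC (Rpower x (- al)) * f1 x)%C.
Proof.
intros H x Hx; destruct (H x Hx) as [H1 [H2 H3]]; split.
- apply (is_derivC_eq _ _ _ _ H1).
  rewrite Cmult_assoc, <- RtoC_mult, Rpower_opp_mult; ring.
- eapply is_derivC_eq.
    apply is_derivC_mult; [now apply is_derivC_RtoC, is_derive_Rpower|exact H2].
  rewrite H3; unfold Rdiv; rewrite !RtoC_mult, RtoC_opp; ring.
Qed.

Lemma is_derivC_opp_arg f x l : is_derivC f (- x) l -> is_derivC (fun s => f (- s)) x (- l)%C.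
Proof.
intros H; eapply is_derivC_eq.
  apply (is_derivC_comp f Ropp); [exact H|].
  apply (is_derive_opp (K := R_AbsRing) (V := R_NormedModule) (fun s => s)), is_derive_id.
unfold opp, one; simpl; rewrite RtoC_opp; ring.
Qed.

Lemma is_derivC_opp f x l : is_derivC f x l -> is_derivC (fun s => - f s)%C x (- l)%C.
Proof.
intros H; apply (is_derivC_ext_loc (fun s => RtoC (-1) * f s)%C).
- apply filter_forall; intros t; apply injective_projections; simpl; ring.
- eapply is_derivC_eq; [apply is_derivC_cmult; exact H|].
  apply injective_projections; simpl; ring.
Qed.

Lemma two_sided_solution_of_equation al E f :
  twice_differentiable_on_M (fun x _ => f x) ->
  (forall x y, x <> 0 -> (- Laplace_Beltrami al (fun x' _ => f x') x y)%C = (RtoC E * f x)%C) ->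
  two_sided_solution al E f (fun x => RtoC (Rpower x (- al)) * deriv f x)%C
    (fun x => RtoC (Rpower x (- al)) * - deriv f (- x))%C.
Proof.
intros HD HE.
assert (H1 : forall x, x <> 0 -> is_derivC f x (deriv f x) /\ is_derivC (deriv f) x (deriv (deriv f) x) /\
  deriv (deriv f) x = (RtoC (al / x) * deriv f x - RtoC E * f x)%C).
{ intros x Hx; destruct (HD x 0 Hx) as [D1 [D2 _]].
  split; [now apply ex_derive_is_derivC|split; [now apply ex_derive_is_derivC|]].
  rewrite <- (HE x 0 Hx), Laplace_Beltrami_radial; ring. }
split.
- apply radial_solution_of_second_order with (deriv (deriv f)); intros x Hx; apply H1; lra.
- apply (radial_solution_of_second_order al E (fun x => f (- x)) (fun x => - deriv f (- x))%C
    (fun x => deriv (deriv f) (- x))).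
  intros x Hx; destruct (H1 (- x) ltac:(lra)) as [D1 [D2 D3]].
  split; [now apply is_derivC_opp_arg|split].
  + eapply is_derivC_eq; [apply is_derivC_opp, is_derivC_opp_arg; exact D2|ring].
  + rewrite D3; replace (al / - x) with (- (al / x)) by (field; lra); rewrite RtoC_opp; ring.
Qed.

Lemma two_sided_solution_deriv al E f hr hl : two_sided_solution al E f hr hl ->
  (forall x, 0 < x -> is_derivC f x (RtoC (Rpower x al) * hr x)%C) /\
  (forall x, x < 0 -> is_derivC f x (- (RtoC (Rpower (- x) al) * hl (- x)%R))%C).
Proof.
intros [Hr Hl]; split; intros x Hx; [now apply Hr|].
apply (is_derivC_ext_loc (fun s => f (- - s))).
  apply filter_forall; intros t; now rewrite Ropp_involutive.
apply (is_derivC_opp_arg (fun s => f (- s))), Hl; lra.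
Qed.

Lemma is_derivC_flux al E f h x : radial_solution al E f h -> 0 < x ->
  is_derivC (fun s => RtoC (Rpower s al) * h s)%C x
    (RtoC (al / x) * (RtoC (Rpower x al) * h x) - RtoC E * f x)%C.
Proof.
intros H Hx; eapply is_derivC_eq.
  apply is_derivC_mult; [now apply is_derivC_RtoC, is_derive_Rpower|apply H, Hx].
assert (P : (RtoC (Rpower x al) * RtoC (Rpower x (- al)) = 1)%C) by now rewrite <- RtoC_mult, Rpower_opp_mult.
rewrite !RtoC_mult.
transitivity (RtoC (al / x) * (RtoC (Rpower x al) * h x) - (RtoC (Rpower x al) * RtoC (Rpower x (- al))) * RtoC E * f x)%C; [ring|].
rewrite P; ring.
Qed.

Lemma two_sided_solution_equation al E f hr hl : two_sided_solution al E f hr hl ->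
  twice_differentiable_on_M (fun x _ => f x) /\
  (forall x y, x <> 0 -> (- Laplace_Beltrami al (fun x' _ => f x') x y)%C = (RtoC E * f x)%C).
Proof.
intros H; destruct (two_sided_solution_deriv _ _ _ _ _ H) as [Dr Dl]; destruct H as [Hr Hl].
assert (D2 : forall x, x <> 0 ->
  exists f1, is_derivC f x f1 /\ is_derivC (deriv f) x (RtoC (al / x) * f1 - RtoC E * f x)%C).
{ intros x Hx; destruct (Rtotal_order x 0) as [Hx'|[Hx'|Hx']]; [| easy |].
  - eexists; split; [now apply Dl|].
    apply (is_derivC_ext_loc (fun s => - (RtoC (Rpower (- s) al) * hl (- s)%R))%C).
      generalize (open_lt 0 x Hx'); apply filter_imp; intros t Ht; symmetry; now apply is_derivC_deriv, Dl.
    eapply is_derivC_eq.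
      apply is_derivC_opp, (is_derivC_opp_arg (fun s => RtoC (Rpower s al) * hl s)%C).
      apply (is_derivC_flux _ _ _ _ (- x) Hl); lra.
    cbv beta; rewrite Ropp_involutive.
    replace (al / - x) with (- (al / x)) by (field; lra); rewrite RtoC_opp; ring.
  - eexists; split; [now apply Dr|].
    apply (is_derivC_ext_loc (fun s => RtoC (Rpower s al) * hr s)%C).
      generalize (open_gt 0 x Hx'); apply filter_imp; intros t Ht; symmetry; now apply is_derivC_deriv, Dr.
    now apply is_derivC_flux. }
split.
- intros x y Hx; destruct (D2 x Hx) as [f1 [H1 H2]].
  split; [eapply is_derivC_ex_derive; exact H1|split; [eapply is_derivC_ex_derive; exact H2|]].
  split; eapply is_derivC_ex_derive; [apply is_derivC_const|].
  apply (is_derivC_ext_loc (fun _ => RtoC 0)); [|apply is_derivC_const].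
  apply filter_forall; intros t; symmetry; apply is_derivC_deriv, is_derivC_const.
- intros x y Hx; destruct (D2 x Hx) as [f1 [H1 H2]].
  rewrite Laplace_Beltrami_radial, (is_derivC_deriv _ _ _ H2), (is_derivC_deriv _ _ _ H1); ring.
Qed.

Lemma filterlim_at_left_opp {T} (f : R -> T) (G : (T -> Prop) -> Prop) :
  filterlim (fun x => f (- x)) (at_right 0) G -> filterlim f (at_left 0) G.
Proof.
intros H; apply (filterlim_ext (fun x => f (- - x))).
  intros x; now rewrite Ropp_involutive.
apply (filterlim_comp _ _ _ Ropp (fun x => f (- x)) _ (at_right 0)); [|exact H].
generalize (filterlim_Ropp_left 0); now rewrite Ropp_0.
Qed.

Lemma filterlim_m_infty_opp {T} (f : R -> T) (G : (T -> Prop) -> Prop) :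
  filterlim f (Rbar_locally m_infty) G <-> filterlim (fun x => f (- x)) (Rbar_locally p_infty) G.
Proof.
split; intros H.
- apply (filterlim_comp _ _ _ Ropp f _ (Rbar_locally m_infty)); [|exact H].
  intros P [M HM]; exists (- M); intros x Hx; apply HM; lra.
- apply (filterlim_ext (fun x => f (- - x))).
    intros x; now rewrite Ropp_involutive.
  apply (filterlim_comp _ _ _ Ropp (fun x => f (- x)) _ (Rbar_locally p_infty)); [|exact H].
  intros P [M HM]; exists (- M); intros x Hx; apply HM; lra.
Qed.

(** The fluxes tend to (1 + al) f_1 rather than f_1, which accounts for the factor 1 + al in front
    of gamma. *)
Lemma boundary_condition_iff al E a gamma f hr hl (pr pl qr ql : C) : 0 <= al ->
  two_sided_solution al E f hr hl ->
  filterlim f (at_right 0) (locally pr) -> filterlim hr (at_right 0) (locally qr) ->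
  filterlim (fun x => f (- x)) (at_right 0) (locally pl) -> filterlim hl (at_right 0) (locally ql) ->
  (boundary_condition al a gamma f <->
   pr = (a * pl)%C /\ (ql + Cconj a * qr)%C = (RtoC ((1 + al) * gamma) * pl)%C).
Proof.
intros Hal H Lpr Lqr Lpl Lql; destruct (two_sided_solution_deriv _ _ _ _ _ H) as [Dr Dl].
assert (L1 : filterlim (fun x => RtoC (/ (1 + al) * Rpower (Rabs x) (- al)) * deriv f x)%C
  (at_right 0) (locally (RtoC (/ (1 + al)) * qr)%C)).
{ apply (filterlim_ext_loc (fun x => RtoC (/ (1 + al)) * hr x)%C).
  - generalize (at_right_lt 0 1 Rlt_0_1); apply filter_imp; intros x Hx.
    rewrite (is_derivC_deriv _ _ _ (Dr x (proj1 Hx))), Rabs_pos_eq, RtoC_mult by lra.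
    transitivity (RtoC (/ (1 + al)) * (RtoC (Rpower x al) * RtoC (Rpower x (- al))) * hr x)%C; [|ring].
    rewrite <- RtoC_mult, Rpower_opp_mult; ring.
  - apply filterlimC_mult; [typeclasses eauto|apply filterlim_const|easy]. }
assert (L2 : filterlim (fun x => - (RtoC (/ (1 + al) * Rpower (Rabs x) (- al)) * deriv f x))%C
  (at_left 0) (locally (RtoC (/ (1 + al)) * ql)%C)).
{ apply filterlim_at_left_opp.
  apply (filterlim_ext_loc (fun x => RtoC (/ (1 + al)) * hl x)%C).
  - generalize (at_right_lt 0 1 Rlt_0_1); apply filter_imp; intros x Hx.
    rewrite (is_derivC_deriv _ _ _ (Dl (- x) ltac:(lra))), Rabs_Ropp, Ropp_involutive, Rabs_pos_eq, RtoC_mult by lra.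
    transitivity (RtoC (/ (1 + al)) * (RtoC (Rpower x al) * RtoC (Rpower x (- al))) * hl x)%C; [|ring].
    rewrite <- RtoC_mult, Rpower_opp_mult; ring.
  - apply filterlimC_mult; [typeclasses eauto|apply filterlim_const|easy]. }
apply filterlim_at_left_opp in Lpl.
assert (K : RtoC (1 + al) <> 0) by (apply RtoC_neq_0; lra).
assert (Ki := RtoC_inv (1 + al) ltac:(lra)).
rewrite (RtoC_mult (1 + al)).
split.
- intros [f0p [f0m [f1p [f1m [B1 [B2 [B3 [B4 [B5 B6]]]]]]]]].
  apply (filterlimC_unique _ _ _ _ B1) in Lpr.
  apply (filterlimC_unique _ _ _ _ B2) in Lpl.
  apply (filterlimC_unique _ _ _ _ B3) in L1.
  apply (filterlimC_unique _ _ _ _ B4) in L2.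
  subst; split; [easy|].
  rewrite <- Cmult_assoc, <- B6, Ki; field; easy.
- intros [C1 C2]; exists pr, pl, (RtoC (/ (1 + al)) * qr)%C, (RtoC (/ (1 + al)) * ql)%C.
  repeat (split; [assumption|]).
  transitivity (RtoC (/ (1 + al)) * (ql + Cconj a * qr))%C; [ring|].
  rewrite C2, Ki; field; easy.
Qed.

(** * Identification of the coefficients at infinity *)

Lemma frequently_const_limit (f : R -> C) (c : C) :
  filterlim f (Rbar_locally p_infty) (locally (RtoC 0)) ->
  (forall M, exists x, M < x /\ f x = c) -> c = 0.
Proof.
intros Hf Hc; apply filterlim_C in Hf; [|typeclasses eauto]; destruct Hf as [H1 H2].
assert (K : forall (g : R -> R) (z : R), filterlim g (Rbar_locally p_infty) (locally 0) ->
  (forall M, exists x, M < x /\ g x = z) -> z = 0).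
{ intros g z Hg Hz; destruct (Req_dec z 0) as [|N]; [easy|exfalso].
  apply filterlim_locally with (eps := mkposreal _ (Rabs_pos_lt z N)) in Hg.
  destruct Hg as [M HM]; destruct (Hz M) as [x [Hx E]].
  specialize (HM x Hx); change (Rabs (g x - 0) < Rabs z) in HM.
  rewrite E, Rminus_0_r in HM; lra. }
apply injective_projections.
- apply (K _ _ H1); intros M; destruct (Hc M) as [x [Hx E]]; exists x; split; [easy|now rewrite E].
- apply (K _ _ H2); intros M; destruct (Hc M) as [x [Hx E]]; exists x; split; [easy|now rewrite E].
Qed.

(** The combination is periodic, so tending to 0 forces it to vanish identically; the phases 0 and
    pi / 2 then give two independent equations. *)
Lemma plane_waves_independent k (u v : C) : 0 < k ->
  filterlim (fun x => u * cis (- (x * k)) + v * cis (x * k))%C (Rbar_locally p_infty) (locally (RtoC 0)) ->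
  u = 0 /\ v = 0.
Proof.
intros Hk H.
assert (K : forall th, (u * cis (- th) + v * cis th)%C = 0).
{ intros th; apply (frequently_const_limit _ _ H); intros M.
  destruct (INR_unbounded (M * k - th)) as [n Hn].
  exists ((th + 2 * INR n * PI) / k); split.
  - apply Rmult_lt_reg_r with k; [easy|].
    replace ((th + 2 * INR n * PI) / k * k) with (th + 2 * INR n * PI) by (field; lra).
    generalize PI_RGT_0 PI2_1 (pos_INR n); nra.
  - replace ((th + 2 * INR n * PI) / k * k) with (th + 2 * INR n * PI) by (field; lra).
    rewrite <- !cis_conj; unfold cis; now rewrite cos_period, sin_period. }
assert (K0 := K 0); assert (K1 := K (PI / 2)).
rewrite <- cis_conj, cis_0 in K0; rewrite <- cis_conj, cis_PI2 in K1.
destruct u as [u1 u2], v as [v1 v2]; injection K0; injection K1; simpl; intros.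
split; apply injective_projections; simpl; lra.
Qed.

Definition span (F : R -> C) (c d : C) (x : R) : C := (c * F x + d * Cconj (F x))%C.

(** Up to a vanishing error, the left side is a combination of plane waves with coefficients d - u
    and c - v. *)
Lemma span_asymptotic al k F (c d u v : C) : 0 < k ->
  filterlim (fun x => RtoC (Rpower x (- (al / 2))) * F x - cis (x * k))%C
    (Rbar_locally p_infty) (locally (RtoC 0)) ->
  filterlim (fun x => RtoC (Rpower x (- (al / 2))) * span F c d x - (u * cis (- (x * k)) + v * cis (x * k)))%C
    (Rbar_locally p_infty) (locally (RtoC 0)) <->
  c = v /\ d = u.
Proof.
intros Hk HF.
set (e := fun x => (RtoC (Rpower x (- (al / 2))) * F x - cis (x * k))%C) in *.
assert (L : filterlim (fun x => c * e x + d * Cconj (e x))%C (Rbar_locally p_infty) (locally (RtoC 0))).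
{ replace (RtoC 0) with (c * 0 + d * Cconj 0)%C by (apply injective_projections; simpl; ring).
  apply filterlimC_plus; [typeclasses eauto| |]; (apply filterlimC_mult; [typeclasses eauto|apply filterlim_const|]).
  - easy.
  - apply filterlimC_conj; [typeclasses eauto|easy]. }
assert (E : forall x, (RtoC (Rpower x (- (al / 2))) * span F c d x - (u * cis (- (x * k)) + v * cis (x * k)))%C
  = ((c * e x + d * Cconj (e x)) + ((d - u) * cis (- (x * k)) + (c - v) * cis (x * k)))%C).
{ intros x; unfold span, e; rewrite <- cis_conj; apply injective_projections; simpl; ring. }
split.
- intros H.
  destruct (plane_waves_independent k (d - u) (c - v)%C Hk) as [A1 A2].
  + apply (filterlim_ext (fun x => (RtoC (Rpower x (- (al / 2))) * span F c d x - (u * cis (- (x * k)) + v * cis (x * k)))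
      + - (c * e x + d * Cconj (e x)))%C).
      intros x; rewrite E; ring.
    replace (RtoC 0) with (0 + - 0)%C by ring.
    apply filterlimC_plus; [typeclasses eauto|easy|].
    apply filterlimC_opp; [typeclasses eauto|easy].
  + split.
    * transitivity (c - v + v)%C; [ring|rewrite A2; ring].
    * transitivity (d - u + u)%C; [ring|rewrite A1; ring].
- intros [<- <-]; apply (filterlim_ext (fun x => c * e x + d * Cconj (e x))%C); [|easy].
  intros x; rewrite E; ring.
Qed.

(** * The boundary conditions as a linear system *)

(* Coefficients of the outgoing wave [F] and of the incoming wave [Cconj F] on the
   right and on the left half line, as functions of [|x|]. *)
Definition out_r (d : incidence) (r t : C) : C :=
  match d with from_plus_infinity => r | from_minus_infinity => t end.
Definition in_r (d : incidence) : C :=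
  match d with from_plus_infinity => 1 | from_minus_infinity => 0 end.
Definition out_l (d : incidence) (r t : C) : C :=
  match d with from_plus_infinity => t | from_minus_infinity => r end.
Definition in_l (d : incidence) : C :=
  match d with from_plus_infinity => 0 | from_minus_infinity => 1 end.

(** First the condition f_0^+ = a f_0^-, then the flux condition multiplied by 1 + al. *)
Definition coupling (d : incidence) (al : R) (a : C) (gamma : R) (F0 G0 r t : C) : Prop :=
  (out_r d r t * F0 + in_r d * Cconj F0)%C = (a * (out_l d r t * F0 + in_l d * Cconj F0))%C /\
  (out_l d r t * G0 + in_l d * Cconj G0 + Cconj a * (out_r d r t * G0 + in_r d * Cconj G0))%C
  = (RtoC ((1 + al) * gamma) * (out_l d r t * F0 + in_l d * Cconj F0))%C.

Lemma impedance_pos al E : 0 <= al < 1 -> 0 < impedance al E.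
Proof.
intros Hal; unfold impedance, Rdiv.
repeat apply Rmult_lt_0_compat; try apply Rpower_pos.
- apply Gamma_pos; lra.
- apply Rinv_0_lt_compat, Gamma_pos; lra.
Qed.

Lemma cos_phase_pos al : 0 <= al < 1 -> 0 < cos (PI / 2 * al).
Proof.
intros Hal; generalize PI_RGT_0; intros; apply cos_gt_0; nra.
Qed.

Lemma filterlim_span F F0 c d : filterlim F (at_right 0) (locally F0) ->
  filterlim (span F c d) (at_right 0) (locally (c * F0 + d * Cconj F0)%C).
Proof.
intros H; apply filterlimC_plus; [typeclasses eauto| |];
  (apply filterlimC_mult; [typeclasses eauto|apply filterlim_const|]); [easy|].
apply filterlimC_conj; [typeclasses eauto|easy].
Qed.

Lemma asymptotic_span_r al k F f (c d u v : C) g : 0 < k ->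
  filterlim (fun x => RtoC (Rpower x (- (al / 2))) * F x - cis (x * k))%C
    (Rbar_locally p_infty) (locally (RtoC 0)) ->
  (forall x, 0 < x -> f x = span F c d x) ->
  (forall x, g x = (u * cis (- (x * k)) + v * cis (x * k))%C) ->
  (asymptotic al (Rbar_locally p_infty) f g <-> c = v /\ d = u).
Proof.
intros Hk HF Hf Hg; rewrite <- (span_asymptotic al k F c d u v Hk HF); unfold asymptotic.
assert (E : Rbar_locally p_infty (fun x => (RtoC (Rpower (Rabs x) (- (al / 2))) * f x - g x)%C =
  (RtoC (Rpower x (- (al / 2))) * span F c d x - (u * cis (- (x * k)) + v * cis (x * k)))%C)).
{ exists 0; intros x Hx; rewrite Rabs_pos_eq, Hf, Hg by lra; easy. }
split; apply filterlim_ext_loc; [exact E|].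
revert E; apply filter_imp; congruence.
Qed.

Lemma asymptotic_span_l al k F f (c d u v : C) g : 0 < k ->
  filterlim (fun x => RtoC (Rpower x (- (al / 2))) * F x - cis (x * k))%C
    (Rbar_locally p_infty) (locally (RtoC 0)) ->
  (forall x, 0 < x -> f (- x) = span F c d x) ->
  (forall x, g x = (u * cis (x * k) + v * cis (- (x * k)))%C) ->
  (asymptotic al (Rbar_locally m_infty) f g <-> c = v /\ d = u).
Proof.
intros Hk HF Hf Hg.
rewrite <- (asymptotic_span_r al k F (fun x => f (- x)) c d u v (fun x => g (- x)) Hk HF Hf).
- unfold asymptotic; rewrite filterlim_m_infty_opp.
  split; apply filterlim_ext; intros x; now rewrite Rabs_Ropp.
- intros x; rewrite Hg; replace (- x * k) with (- (x * k)) by ring; now rewrite Ropp_involutive.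
Qed.

Lemma scattering_asymptotics_iff d al E F f (cr dr cl dl r t : C) : 0 < E ->
  filterlim (fun x => RtoC (Rpower x (- (al / 2))) * F x - cis (x * sqrt E))%C
    (Rbar_locally p_infty) (locally (RtoC 0)) ->
  (forall x, 0 < x -> f x = span F cr dr x /\ f (- x) = span F cl dl x) ->
  (scattering_asymptotics d al E f r t <->
   (cr = out_r d r t /\ dr = in_r d) /\ (cl = out_l d r t /\ dl = in_l d)).
Proof.
intros HE HF Hf.
assert (Hk : 0 < sqrt E) by now apply sqrt_lt_R0.
assert (Hr := fun x Hx => proj1 (Hf x Hx)).
assert (Hl := fun x Hx => proj2 (Hf x Hx)).
assert (Ar := asymptotic_span_r al (sqrt E) F f cr dr (in_r d) (out_r d r t) _ Hk HF Hr (fun x => eq_refl)).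
assert (Al := asymptotic_span_l al (sqrt E) F f cl dl (in_l d) (out_l d r t) _ Hk HF Hl (fun x => eq_refl)).
rewrite <- Ar, <- Al.
unfold asymptotic; destruct d; simpl scattering_asymptotics; unfold asymptotic; simpl in_r; simpl in_l; simpl out_r; simpl out_l.
- split; intros [H1 H2]; split; [revert H1|revert H2|revert H1|revert H2];
    apply filterlim_ext; intros x; ring.
- split; intros [H1 H2]; split; [revert H2|revert H1|revert H2|revert H1];
    apply filterlim_ext; intros x; ring.
Qed.

Lemma two_sided_span al E F G f cr dr cl dl : radial_solution al E F G ->
  (forall x, 0 < x -> f x = span F cr dr x /\ f (- x) = span F cl dl x) ->
  two_sided_solution al E f (span G cr dr) (span G cl dl).
Proof.
intros HF Hf; assert (HF' := radial_solution_conj _ _ _ _ HF); split.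
- apply (radial_solution_ext al E (span F cr dr) (span G cr dr)).
    intros x Hx; split; [symmetry; now apply Hf|easy].
  exact (radial_solution_lin _ _ _ _ _ _ cr dr HF HF').
- apply (radial_solution_ext al E (span F cl dl) (span G cl dl)).
    intros x Hx; split; [symmetry; now apply Hf|easy].
  exact (radial_solution_lin _ _ _ _ _ _ cl dl HF HF').
Qed.

(** Reduces the scattering problem to linear algebra. Being an equivalence, it serves for existence
    and for uniqueness; f at x = 0 stays free. *)
Lemma scattering_state_iff d al a gamma E F G F0 G0 f r t : 0 <= al < 1 -> 0 < E ->
  jost_data al E F G F0 G0 ->
  (scattering_state d al a gamma E f r t <->
   (forall x, 0 < x -> f x = span F (out_r d r t) (in_r d) x /\ f (- x) = span F (out_l d r t) (in_l d) x) /\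
   coupling d al a gamma F0 G0 r t).
Proof.
intros Hal HE [HF [LF [LG [AF [HF0 EG]]]]].
assert (Main : forall cr dr cl dl,
  (forall x, 0 < x -> f x = span F cr dr x /\ f (- x) = span F cl dl x) ->
  (boundary_condition al a gamma f <->
   (cr * F0 + dr * Cconj F0)%C = (a * (cl * F0 + dl * Cconj F0))%C /\
   (cl * G0 + dl * Cconj G0 + Cconj a * (cr * G0 + dr * Cconj G0))%C
   = (RtoC ((1 + al) * gamma) * (cl * F0 + dl * Cconj F0))%C)).
{ intros cr dr cl dl Hf.
  apply (boundary_condition_iff al E a gamma f (span G cr dr) (span G cl dl)).
  - lra.
  - now apply two_sided_span with F.
  - apply (filterlim_ext_loc (span F cr dr)); [|now apply filterlim_span].
    generalize (at_right_lt 0 1 Rlt_0_1); apply filter_imp; intros x [Hx _]; symmetry; now apply Hf.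
  - now apply filterlim_span.
  - apply (filterlim_ext_loc (span F cl dl)); [|now apply filterlim_span].
    generalize (at_right_lt 0 1 Rlt_0_1); apply filter_imp; intros x [Hx _]; symmetry; now apply Hf.
  - now apply filterlim_span. }
split.
- intros [D [EQ [BC AS]]].
  destruct (radial_wronskian_conj_neq_0 al E F G F0 G0 (impedance al E) (- (PI / 2 * al))) as [w [Hw HW]];
    try easy.
    now apply Rgt_not_eq, impedance_pos.
    now rewrite cos_neg; apply Rgt_not_eq, cos_phase_pos.
  destruct (two_sided_solution_of_equation _ _ _ D EQ) as [Rr Rl].
  destruct (radial_solution_span _ _ _ _ _ _ w Hw Rr HF HW) as [cr [dr Hr]].
  destruct (radial_solution_span _ _ _ _ _ _ w Hw Rl HF HW) as [cl [dl Hl]].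
  assert (Hf : forall x, 0 < x -> f x = span F cr dr x /\ f (- x) = span F cl dl x).
    intros x Hx; split; [now apply Hr|now apply Hl].
  apply (scattering_asymptotics_iff d al E F f cr dr cl dl r t HE AF Hf) in AS.
  apply (Main _ _ _ _ Hf) in BC.
  destruct AS as [[-> ->] [-> ->]]; now split.
- intros [Hf HC].
  destruct (two_sided_solution_equation al E f _ _ (two_sided_span _ _ _ _ _ _ _ _ _ HF Hf)) as [D EQ].
  split; [easy|split; [easy|split]].
  + now apply (Main _ _ _ _ Hf).
  + now apply (scattering_asymptotics_iff d al E F f _ _ _ _ r t HE AF Hf).
Qed.

(* [x ^ (- al) * f' / f] at [0+] for the outgoing solution, that is [(1 + al) * f_1 / f_0]. *)
Definition boundary_impedance (al E : R) : C := (Ci * RtoC (impedance al E) * cis (- (PI / 2 * al)))%C.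

(* Determinant of the linear system [coupling] in [r] and [t]. *)
Definition coupling_det (al : R) (a : C) (gamma E : R) : C :=
  (RtoC (1 + Cmod a ^ 2) * boundary_impedance al E - RtoC ((1 + al) * gamma))%C.

(** The gamma term is real, and the imaginary part of the rest is (1 + |a|^2) Z cos (pi al / 2) > 0,
    with Z the impedance. *)
Lemma coupling_det_neq_0 al a gamma E : 0 <= al < 1 -> coupling_det al a gamma E <> 0.
Proof.
intros Hal K; injection K; intros K2 _; revert K2; unfold boundary_impedance, Ci, cis, RtoC.
simpl; rewrite cos_neg, sin_neg.
generalize (impedance_pos al E Hal) (cos_phase_pos al Hal) (pow2_ge_0 (Cmod a)); intros Hz Hc Ha.
match goal with |- ?u = 0 -> False => replace u with ((1 + Cmod a ^ 2) * (impedance al E * cos (PI / 2 * al))) by ring end.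
apply Rgt_not_eq, Rmult_lt_0_compat; [lra|now apply Rmult_lt_0_compat].
Qed.

(** The solution of [coupling], as is [reflected]. The phase p stands for conj F0 / F0; it drops out
    of the moduli. *)
Definition transmitted (d : incidence) (al : R) (a : C) (gamma E : R) (p : C) : C :=
  (match d with from_plus_infinity => Cconj a | from_minus_infinity => a end
   * p * (boundary_impedance al E - Cconj (boundary_impedance al E)) / coupling_det al a gamma E)%C.

Definition reflected (d : incidence) (al : R) (a : C) (gamma E : R) (p : C) : C :=
  (let m := boundary_impedance al E in
   match d with
   | from_plus_infinity =>
       - p * (m + RtoC (Cmod a ^ 2) * Cconj m - RtoC ((1 + al) * gamma))
   | from_minus_infinity =>
       - p * (Cconj m + RtoC (Cmod a ^ 2) * m - RtoC ((1 + al) * gamma))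
   end / coupling_det al a gamma E)%C.

Lemma coupling_iff d al a gamma E (F0 r t : C) : 0 <= al < 1 -> F0 <> 0 ->
  (coupling d al a gamma F0 (boundary_impedance al E * F0)%C r t <->
   r = reflected d al a gamma E (Cconj F0 / F0)%C /\ t = transmitted d al a gamma E (Cconj F0 / F0)%C).
Proof.
intros Hal HF0.
assert (HD := coupling_det_neq_0 al a gamma E Hal).
unfold coupling, reflected, transmitted.
set (g := RtoC ((1 + al) * gamma)).
set (m := boundary_impedance al E) in *.
assert (ED : coupling_det al a gamma E = ((1 + a * Cconj a) * m - g)%C).
  unfold coupling_det; rewrite RtoC_plus, Cmod2_conj; easy.
set (D := coupling_det al a gamma E) in *; clearbody D.
rewrite Cmod2_conj, Cmult_conj; set (b := Cconj a); fold b in ED.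
set (n := Cconj m); set (F1 := Cconj F0).
assert (Div : forall z u v : C, z <> 0 -> (u * z)%C = v -> u = (v / z)%C).
  intros z u v Hz <-; field; easy.
assert (Canc : forall z u v : C, z <> 0 -> (u * z)%C = (v * z)%C -> u = v).
  intros z u v Hz H; transitivity (v * z / z)%C; [rewrite <- H|]; field; easy.
set (p := (F1 / F0)%C).
assert (Ep : F1 = (p * F0)%C) by (unfold p; field; easy).
rewrite Ep; clearbody p.
destruct d; simpl.
- split.
  + intros [H1 H2].
    (* The first condition expresses r through t; the second then reads t D = b p (m - n). *)
    assert (K1 : (r + p)%C = (a * t)%C) by (apply (Canc F0); [easy|]; transitivity (r * F0 + 1 * (p * F0))%C; [ring|rewrite H1; ring]).
    assert (K2 : (t * m + b * (r * m + p * n))%C = (g * t)%C).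
      apply (Canc F0); [easy|]; transitivity (t * (m * F0) + 0 * (n * (p * F0)) + b * (r * (m * F0) + 1 * (n * (p * F0))))%C; [ring|rewrite H2; ring].
    assert (Er : r = (a * t - p)%C) by (rewrite <- K1; ring).
    assert (Et : (t * D)%C = (b * p * (m - n))%C).
    { rewrite ED; transitivity (t * m + b * (r * m + p * n) - g * t + b * p * (m - n))%C; [rewrite Er; ring|rewrite K2; ring]. }
    split; apply Div; try easy.
    transitivity (a * (t * D) - p * D)%C; [rewrite Er; ring|rewrite Et, ED; ring].
  + intros [-> ->]; split.
    * transitivity ((- p * (m + a * b * n - g) + p * D) * F0 / D)%C; [field; easy|rewrite ED at 1; field; easy].
    * transitivity ((b * p * (m - n) * m + b * (- p * (m + a * b * n - g) * m + p * n * D)) * F0 / D)%C; [field; easy|rewrite ED at 1; field; easy].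
- split.
  + intros [H1 H2].
    (* From the other end the first condition gives t in terms of r, so the second is solved for
       r. *)
    assert (K1 : t = (a * (r + p))%C) by (apply (Canc F0); [easy|]; transitivity (t * F0 + 0 * (p * F0))%C; [ring|rewrite H1; ring]).
    assert (K2 : (r * m + p * n + b * (t * m))%C = (g * (r + p))%C).
      apply (Canc F0); [easy|]; transitivity (r * (m * F0) + 1 * (n * (p * F0)) + b * (t * (m * F0) + 0 * (n * (p * F0))))%C; [ring|rewrite H2; ring].
    assert (Er : (r * D)%C = (- p * (n + a * b * m - g))%C).
    { rewrite ED; transitivity ((r * m + p * n + b * (t * m)) - g * (r + p) + - p * (n + a * b * m - g))%C; [rewrite K1; ring|rewrite K2; ring]. }
    split; apply Div; try easy.
    transitivity (a * (r * D + p * D))%C; [rewrite K1; ring|rewrite Er, ED; ring].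
  + intros [-> ->]; split.
    * transitivity ((a * p * (m - n)) * F0 / D)%C; [field; easy|].
      transitivity (a * (- p * (n + a * b * m - g) + p * D) * F0 / D)%C; [rewrite ED at 2; field; easy|field; easy].
    * transitivity ((- p * (n + a * b * m - g) * m + p * n * D + b * (a * p * (m - n) * m)) * F0 / D)%C; [field; easy|].
      transitivity (g * (- p * (n + a * b * m - g) + p * D) * F0 / D)%C; [rewrite ED at 1 3; field; easy|field; easy].
Qed.

(** * Transmission and reflection coefficients *)

Lemma scattering_state_exists d al a gamma E : 0 <= al < 1 -> 0 < E ->
  exists (f : R -> C) (p : C), Cmod p = 1 /\
    scattering_state d al a gamma E f (reflected d al a gamma E p) (transmitted d al a gamma E p) /\
    forall f' r' t', scattering_state d al a gamma E f' r' t' ->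
      (forall x, x <> 0 -> f' x = f x) /\
      r' = reflected d al a gamma E p /\ t' = transmitted d al a gamma E p.
Proof.
intros Hal HE.
destruct (jost_solution al E Hal HE) as [F [G [F0 [G0 HJ]]]].
assert (HJ' := HJ).
destruct HJ as [_ [_ [_ [_ [HF0 EG]]]]].
change (G0 = (boundary_impedance al E * F0)%C) in EG; rewrite EG in HJ'; clear EG G0.
set (p := (Cconj F0 / F0)%C).
set (r := reflected d al a gamma E p); set (t := transmitted d al a gamma E p).
(* The value at 0 is arbitrary; it is taken from the right branch. *)
set (f := fun x => if Rle_dec 0 x then span F (out_r d r t) (in_r d) x else span F (out_l d r t) (in_l d) (- x)).
assert (Hf : forall x, 0 < x -> f x = span F (out_r d r t) (in_r d) x /\ f (- x) = span F (out_l d r t) (in_l d) x).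
{ intros x Hx; unfold f; split.
  - destruct (Rle_dec 0 x); [easy|lra].
  - destruct (Rle_dec 0 (- x)); [lra|now rewrite Ropp_involutive]. }
exists f, p; split; [|split].
- unfold p; rewrite Cmod_div, Cmod_conj by easy; field.
  now apply Rgt_not_eq, Cmod_gt_0.
- apply (scattering_state_iff d al a gamma E F G _ _ _ _ _ Hal HE HJ'); split; [exact Hf|].
  now apply coupling_iff.
- intros f' r' t' H'.
  apply (scattering_state_iff d al a gamma E F G _ _ _ _ _ Hal HE HJ') in H'; destruct H' as [Hf' HC].
  apply coupling_iff in HC; [|easy|easy]; destruct HC as [-> ->]; split; [|easy].
  intros x Hx; destruct (Rtotal_order x 0) as [Hx'|[Hx'|Hx']]; [|easy|].
  + rewrite <- (Ropp_involutive x).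
    rewrite (proj2 (Hf' (- x) ltac:(lra))), (proj2 (Hf (- x) ltac:(lra))); easy.
  + rewrite (proj1 (Hf' x Hx')), (proj1 (Hf x Hx')); easy.
Qed.

(** Existence makes the [epsilon] choice come from a genuine scattering state, and uniqueness
    identifies its r and t. *)
Lemma coefficients_eq_Cmod2 d al a gamma E : 0 <= al < 1 -> 0 < E ->
  exists p : C, Cmod p = 1 /\
    transmission d al a gamma E = Cmod (transmitted d al a gamma E p) ^ 2 /\
    reflection d al a gamma E = Cmod (reflected d al a gamma E p) ^ 2.
Proof.
intros Hal HE.
destruct (scattering_state_exists d al a gamma E Hal HE) as [f [p [Hp [Hs Hu]]]].
exists p; split; [easy|split].
- assert (S := epsilon_spec (inhabits 0) (fun T => exists (f : R -> C) (r t : C),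
    scattering_state d al a gamma E f r t /\ T = (Cmod t) ^ 2)
    (ex_intro _ _ (ex_intro _ f (ex_intro _ _ (ex_intro _ _ (conj Hs eq_refl)))))).
  destruct S as [f' [r' [t' [S1 S2]]]].
  transitivity (Cmod t' ^ 2); [exact S2|]; now destruct (Hu _ _ _ S1) as [_ [_ ->]].
- assert (S := epsilon_spec (inhabits 0) (fun T => exists (f : R -> C) (r t : C),
    scattering_state d al a gamma E f r t /\ T = (Cmod r) ^ 2)
    (ex_intro _ _ (ex_intro _ f (ex_intro _ _ (ex_intro _ _ (conj Hs eq_refl)))))).
  destruct S as [f' [r' [t' [S1 S2]]]].
  transitivity (Cmod r' ^ 2); [exact S2|]; now destruct (Hu _ _ _ S1) as [_ [-> _]].
Qed.

Lemma Cmod2_Re_Im (z : C) : Cmod z ^ 2 = Re z ^ 2 + Im z ^ 2.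
Proof. unfold Cmod; rewrite pow2_sqrt; [easy|nra]. Qed.

Lemma Cmod2_div (u v : C) : v <> 0 -> Cmod (u / v)%C ^ 2 = Cmod u ^ 2 / Cmod v ^ 2.
Proof.
intros Hv; rewrite Cmod_div by easy.
field; now apply Rgt_not_eq, Cmod_gt_0.
Qed.

(** The squared modulus of [coupling_det], with |a|^2 and the impedance as free variables so that
    the low-energy limit is continuity at Z = 0. *)
Definition det2 (al A gamma Z : R) : R :=
  ((1 + A) * (Z * sin (PI / 2 * al)) - (1 + al) * gamma) ^ 2 + ((1 + A) * (Z * cos (PI / 2 * al))) ^ 2.

Lemma boundary_impedance_eq al E :
  boundary_impedance al E = (impedance al E * sin (PI / 2 * al), impedance al E * cos (PI / 2 * al)).
Proof.
unfold boundary_impedance; apply injective_projections; simpl; rewrite cos_neg, sin_neg; ring.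
Qed.

Lemma Cmod2_coupling_det al a gamma E :
  Cmod (coupling_det al a gamma E) ^ 2 = det2 al (Cmod a ^ 2) gamma (impedance al E).
Proof.
rewrite Cmod2_Re_Im; unfold coupling_det, det2; rewrite boundary_impedance_eq; simpl; ring.
Qed.

Lemma det2_pos al A gamma Z : 0 <= al < 1 -> 0 <= A -> 0 < Z -> 0 < det2 al A gamma Z.
Proof.
intros Hal HA HZ; unfold det2.
assert (0 < ((1 + A) * (Z * cos (PI / 2 * al))) ^ 2).
{ apply pow_lt, Rmult_lt_0_compat; [lra|]; apply Rmult_lt_0_compat; [easy|now apply cos_phase_pos]. }
generalize (pow2_ge_0 ((1 + A) * (Z * sin (PI / 2 * al)) - (1 + al) * gamma)); lra.
Qed.

Lemma Cmod2_transmitted d al a gamma E p : 0 <= al < 1 -> Cmod p = 1 ->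
  Cmod (transmitted d al a gamma E p) ^ 2 =
  Cmod (Cconj a * (boundary_impedance al E - Cconj (boundary_impedance al E)) / coupling_det al a gamma E)%C ^ 2.
Proof.
intros Hal Hp; assert (HD := coupling_det_neq_0 al a gamma E Hal).
unfold transmitted; rewrite !Cmod_div, !Cmod_mult, Hp by easy.
destruct d; rewrite ?Cmod_conj; f_equal; f_equal; ring.
Qed.

(** The numerators for the two ends are, up to the factor - p, complex conjugates of each other. *)
Lemma Cmod2_reflected d al a gamma E p : 0 <= al < 1 -> Cmod p = 1 ->
  Cmod (reflected d al a gamma E p) ^ 2 =
  Cmod ((boundary_impedance al E + RtoC (Cmod a ^ 2) * Cconj (boundary_impedance al E) - RtoC ((1 + al) * gamma))
    / coupling_det al a gamma E)%C ^ 2.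
Proof.
intros Hal Hp; assert (HD := coupling_det_neq_0 al a gamma E Hal).
unfold reflected; destruct d.
- rewrite !Cmod_div, Cmod_mult, Cmod_opp, Hp by easy; f_equal; f_equal; ring.
- rewrite !Cmod_div, Cmod_mult, Cmod_opp, Hp by easy; f_equal; f_equal.
  rewrite Rmult_1_l, <- Cmod_conj; f_equal.
  destruct (boundary_impedance al E); apply injective_projections; simpl; ring.
Qed.

Lemma transmission_real d al a gamma E : 0 <= al < 1 -> 0 < E ->
  transmission d al a gamma E =
  4 * Cmod a ^ 2 * (impedance al E * cos (PI / 2 * al)) ^ 2 / det2 al (Cmod a ^ 2) gamma (impedance al E).
Proof.
intros Hal HE; destruct (coefficients_eq_Cmod2 d al a gamma E Hal HE) as [p [Hp [-> _]]].
assert (HD := coupling_det_neq_0 al a gamma E Hal).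
rewrite Cmod2_transmitted, Cmod2_div, Cmod_mult, Cmod_conj, Rpow_mult_distr, Cmod2_coupling_det by easy.
f_equal; rewrite (Cmod2_Re_Im (_ - _)%C), boundary_impedance_eq; simpl; ring.
Qed.

(** With m the boundary impedance, A = |a|^2 and g = (1 + al) gamma, the numbers m + A conj m - g
    and (1 + A) m - g have the same real part; the squares of their imaginary parts differ by 4 A
    (Im m)^2, the numerator of the transmission. *)
Lemma transmission_plus_reflection d al a gamma E : 0 <= al < 1 -> 0 < E ->
  transmission d al a gamma E + reflection d al a gamma E = 1.
Proof.
intros Hal HE; rewrite (transmission_real d al a gamma E Hal HE).
destruct (coefficients_eq_Cmod2 d al a gamma E Hal HE) as [p [Hp [_ ->]]].
assert (HD := coupling_det_neq_0 al a gamma E Hal).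
assert (Hd := det2_pos al (Cmod a ^ 2) gamma _ Hal (pow2_ge_0 _) (impedance_pos al E Hal)).
rewrite Cmod2_reflected, Cmod2_div, Cmod2_coupling_det by easy.
rewrite <- Rdiv_plus_distr.
match goal with |- ?u / ?v = 1 => replace u with v; [apply Rinv_r; lra|] end.
rewrite (Cmod2_Re_Im (_ - _)%C), boundary_impedance_eq; unfold det2; simpl; ring.
Qed.

(** * The stated formulas with Gamma factors *)

Lemma Ci_mult_Ci : (Ci * Ci)%C = RtoC (-1).
Proof. apply injective_projections; simpl; ring. Qed.

Lemma impedance_scale al E : 0 <= al < 1 ->
  Rpower E ((1 + al) / 2) * Gamma ((1 - al) / 2) = Rpower 2 al * Gamma ((1 + al) / 2) * impedance al E.
Proof.
intros Hal; assert (HG := Gamma_pos ((1 + al) / 2) ltac:(lra)).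
unfold impedance.
transitivity ((Rpower 2 al * Rpower 2 (- al)) * (Rpower E ((1 + al) / 2) * Gamma ((1 - al) / 2))).
  rewrite Rpower_opp_mult; ring.
field; lra.
Qed.

(** Gamma ((3 + al) / 2) = (1 + al) / 2 * Gamma ((1 + al) / 2), and the 2 cancels one factor of 2^(1
    + al). *)
Lemma coupling_scale al gamma : 0 <= al < 1 ->
  gamma * Rpower 2 (1 + al) * Gamma ((3 + al) / 2) =
  Rpower 2 al * Gamma ((1 + al) / 2) * ((1 + al) * gamma).
Proof.
intros Hal; replace ((3 + al) / 2) with ((1 + al) / 2 + 1) by field.
rewrite Gamma_succ, (Rpower_plus 1 al 2), Rpower_1 by lra; field.
Qed.

(* The factor [2^al * Gamma ((1 + al) / 2) * (- i e^(i pi al / 2))] turns the solution of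
   [coupling] into the form of the statement. *)
Definition normalization (al : R) : C :=
  (RtoC (Rpower 2 al * Gamma ((1 + al) / 2)) * (- Ci * cis (PI / 2 * al)))%C.

Lemma normalization_neq_0 al : 0 <= al < 1 -> normalization al <> 0.
Proof.
intros Hal; apply Cmult_neq_0.
- apply RtoC_neq_0, Rgt_not_eq, Rmult_lt_0_compat; [apply Rpower_pos|apply Gamma_pos; lra].
- apply Cmult_neq_0; [|apply cis_neq_0].
  intros H; injection H; lra.
Qed.

Lemma normalization_impedance al E : 0 <= al < 1 ->
  (normalization al * boundary_impedance al E)%C =
    RtoC (Rpower E ((1 + al) / 2) * Gamma ((1 - al) / 2)) /\
  (normalization al * Cconj (boundary_impedance al E))%C =
    (- (RtoC (Rpower E ((1 + al) / 2) * Gamma ((1 - al) / 2)) * cis (PI * al)))%C.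
Proof.
intros Hal; rewrite impedance_scale by easy.
unfold normalization, boundary_impedance.
assert (Q := cis_mult_opp (PI / 2 * al)).
split.
- transitivity (RtoC (Rpower 2 al * Gamma ((1 + al) / 2)) * RtoC (impedance al E) * (- (Ci * Ci)) *
    (cis (PI / 2 * al) * cis (- (PI / 2 * al))))%C; [ring|].
  rewrite Q, Ci_mult_Ci, <- RtoC_mult; apply injective_projections; simpl; ring.
- rewrite !Cmult_conj, cis_conj, Ropp_involutive.
  replace (PI * al) with (PI / 2 * al + PI / 2 * al) by field; rewrite cis_plus.
  replace (Cconj Ci) with (- Ci)%C by (apply injective_projections; simpl; ring).
  replace (Cconj (RtoC (impedance al E))) with (RtoC (impedance al E)) by (apply injective_projections; simpl; ring).
  transitivity (RtoC (Rpower 2 al * Gamma ((1 + al) / 2)) * RtoC (impedance al E) * (Ci * Ci) *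
    (cis (PI / 2 * al) * cis (PI / 2 * al)))%C; [ring|].
  rewrite Ci_mult_Ci, <- RtoC_mult; apply injective_projections; simpl; ring.
Qed.

Lemma normalization_gamma al gamma : 0 <= al < 1 ->
  (normalization al * RtoC ((1 + al) * gamma))%C =
  (- (Ci * RtoC (gamma * Rpower 2 (1 + al)) * cis (PI / 2 * al) * RtoC (Gamma ((3 + al) / 2))))%C.
Proof.
intros Hal.
transitivity (- (Ci * cis (PI / 2 * al) * RtoC (gamma * Rpower 2 (1 + al) * Gamma ((3 + al) / 2))))%C.
- rewrite coupling_scale by easy; unfold normalization; rewrite !RtoC_mult; ring.
- rewrite !RtoC_mult; ring.
Qed.

Lemma normalization_det al a gamma E : 0 <= al < 1 ->
  (RtoC (Rpower E ((1 + al) / 2) * Gamma ((1 - al) / 2) * (1 + (Cmod a) ^ 2))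
   + Ci * RtoC (gamma * Rpower 2 (1 + al)) * cis (PI / 2 * al) * RtoC (Gamma ((3 + al) / 2)))%C =
  (normalization al * coupling_det al a gamma E)%C.
Proof.
intros Hal; unfold coupling_det.
transitivity (RtoC (1 + Cmod a ^ 2) * (normalization al * boundary_impedance al E)
  - normalization al * RtoC ((1 + al) * gamma))%C; [|ring].
rewrite (proj1 (normalization_impedance al E Hal)), (normalization_gamma al gamma Hal).
rewrite (RtoC_mult (_ * _) (1 + _)); ring.
Qed.

Lemma Cdiv_cancel_l (z u v : C) : z <> 0 -> v <> 0 -> (z * u / (z * v))%C = (u / v)%C.
Proof. intros Hz Hv; field; easy. Qed.

Lemma transmission_formula d al a gamma E : 0 <= al < 1 -> 0 < E ->
  transmission d al a gamma E =
  (Cmod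
    ((RtoC (Rpower E ((1 + al) / 2)) * (1 + cis (PI * al))
      * RtoC (Gamma ((1 - al) / 2)) * Cconj a)
     / (RtoC (Rpower E ((1 + al) / 2) * Gamma ((1 - al) / 2)
              * (1 + (Cmod a) ^ 2))
        + Ci * RtoC (gamma * Rpower 2 (1 + al))
          * cis (PI / 2 * al) * RtoC (Gamma ((3 + al) / 2))))%C) ^ 2.
Proof.
intros Hal HE; destruct (coefficients_eq_Cmod2 d al a gamma E Hal HE) as [p [Hp [-> _]]].
rewrite Cmod2_transmitted, normalization_det by easy; f_equal; f_equal.
rewrite <- (Cdiv_cancel_l (normalization al)) by (now apply normalization_neq_0 || now apply coupling_det_neq_0).
f_equal.
transitivity (Cconj a * (normalization al * boundary_impedance al E - normalization al * Cconj (boundary_impedance al E)))%C; [ring|].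
destruct (normalization_impedance al E Hal) as [-> ->]; rewrite RtoC_mult; ring.
Qed.

Lemma reflection_formula d al a gamma E : 0 <= al < 1 -> 0 < E ->
  reflection d al a gamma E =
  (Cmod
    ((RtoC (Rpower E ((1 + al) / 2) * Gamma ((1 - al) / 2))
        * (1 - RtoC ((Cmod a) ^ 2) * cis (PI * al))
      + Ci * RtoC (gamma * Rpower 2 (1 + al))
          * cis (PI / 2 * al) * RtoC (Gamma ((3 + al) / 2)))
     / (RtoC (Rpower E ((1 + al) / 2) * Gamma ((1 - al) / 2)
              * (1 + (Cmod a) ^ 2))
        + Ci * RtoC (gamma * Rpower 2 (1 + al))
          * cis (PI / 2 * al) * RtoC (Gamma ((3 + al) / 2))))%C) ^ 2.
Proof.
intros Hal HE; destruct (coefficients_eq_Cmod2 d al a gamma E Hal HE) as [p [Hp [_ ->]]].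
rewrite Cmod2_reflected, normalization_det by easy; f_equal; f_equal.
rewrite <- (Cdiv_cancel_l (normalization al)) by (now apply normalization_neq_0 || now apply coupling_det_neq_0).
f_equal.
transitivity (normalization al * boundary_impedance al E + RtoC (Cmod a ^ 2) * (normalization al * Cconj (boundary_impedance al E))
  - normalization al * RtoC ((1 + al) * gamma))%C; [ring|].
rewrite (normalization_gamma al gamma Hal).
destruct (normalization_impedance al E Hal) as [-> ->]; ring.
Qed.

(** * Energy dependence and limits *)

Lemma reflection_real d al a gamma E : 0 <= al < 1 -> 0 < E ->
  reflection d al a gamma E = 1 - transmission d al a gamma E.
Proof. intros Hal HE; generalize (transmission_plus_reflection d al a gamma E Hal HE); lra. Qed.

(** The energy enters only through the impedance, which cancels for gamma = 0. *)
Lemma transmission_gamma_0 d al a E : 0 <= al < 1 -> 0 < E ->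
  transmission d al a 0 E = 4 * Cmod a ^ 2 * cos (PI / 2 * al) ^ 2 / (1 + Cmod a ^ 2) ^ 2.
Proof.
intros Hal HE; rewrite transmission_real by easy.
assert (Hz := impedance_pos al E Hal); assert (HA := pow2_ge_0 (Cmod a)).
assert (Q := sin2_cos2 (PI / 2 * al)); unfold Rsqr in Q.
replace (det2 al (Cmod a ^ 2) 0 (impedance al E)) with ((1 + Cmod a ^ 2) ^ 2 * impedance al E ^ 2).
- field; split; apply Rgt_not_eq; lra.
- unfold det2; set (s := sin _) in *; set (c := cos _) in *; set (A := Cmod a ^ 2).
  transitivity ((1 + A) ^ 2 * impedance al E ^ 2 * (s * s + c * c)); [rewrite Q|]; ring.
Qed.

(* [z] stands for the inverse of the impedance, which tends to [0] as [E] grows. *)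
Lemma transmission_inv_impedance d al a gamma E : 0 <= al < 1 -> 0 < E ->
  let A := Cmod a ^ 2 in
  let g := (1 + al) * gamma in
  let z := / impedance al E in
  transmission d al a gamma E =
  4 * A * cos (PI / 2 * al) ^ 2 /
    (((1 + A) * sin (PI / 2 * al) - g * z) ^ 2 + ((1 + A) * cos (PI / 2 * al)) ^ 2).
Proof.
intros Hal HE A g z; rewrite transmission_real by easy; fold A.
assert (Hz := impedance_pos al E Hal).
assert (Hd := det2_pos al A gamma _ Hal (pow2_ge_0 _) Hz).
assert (Ed : ((1 + A) * sin (PI / 2 * al) - g * z) ^ 2 + ((1 + A) * cos (PI / 2 * al)) ^ 2
  = det2 al A gamma (impedance al E) / impedance al E ^ 2).
  unfold det2, g, z; field; lra.
rewrite Ed; field; lra.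
Qed.

Lemma filterlim_Rpower_infty p : 0 < p ->
  filterlim (fun x => Rpower x p) (Rbar_locally p_infty) (Rbar_locally p_infty).
Proof.
intros Hp P [M HM].
exists (Rpower (Rmax M 1) (/ p)); intros x Hx; apply HM.
assert (H1 : 0 < Rmax M 1) by (apply Rlt_le_trans with 1; [lra|apply Rmax_r]).
apply Rle_lt_trans with (1 := Rmax_l M 1).
apply Rle_lt_trans with (Rpower (Rpower (Rmax M 1) (/ p)) p).
- rewrite Rpower_mult, Rinv_l, Rpower_1 by lra; lra.
- apply Rlt_Rpower_l; [easy|split; [apply Rpower_pos|easy]].
Qed.

Lemma impedance_lim_infty al : 0 <= al < 1 ->
  filterlim (fun E => / impedance al E) (Rbar_locally p_infty) (locally 0).
Proof.
intros Hal; unfold impedance.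
set (c := Rpower 2 (- al) * _ / _).
assert (Hc : 0 < c).
{ unfold c, Rdiv; repeat apply Rmult_lt_0_compat; [apply Rpower_pos|apply Gamma_pos; lra|].
  apply Rinv_0_lt_compat, Gamma_pos; lra. }
apply (filterlim_ext (fun E => / (c * Rpower E ((1 + al) / 2)))).
  intros E; f_equal; ring.
apply (filterlim_comp _ _ _ (fun E => c * Rpower E ((1 + al) / 2)) Rinv _ (Rbar_locally p_infty)).
- apply (filterlim_comp _ _ _ (fun E => Rpower E ((1 + al) / 2)) (fun y => c * y) _ (Rbar_locally p_infty)).
    apply filterlim_Rpower_infty; lra.
  now apply filterlim_scale_infty.
- apply (filterlim_Rbar_inv p_infty); easy.
Qed.

Lemma impedance_lim_0 al : 0 <= al < 1 ->
  filterlim (impedance al) (at_right 0) (locally 0).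
Proof.
intros Hal; unfold impedance.
replace (locally 0) with (locally (0 * (Rpower 2 (- al) * Gamma ((1 - al) / 2) / Gamma ((1 + al) / 2))))
  by (f_equal; ring).
apply filterlimR_mult; [typeclasses eauto|apply filterlim_Rpower_0; lra|apply filterlim_const].
Qed.

(** In the inverse impedance the coefficient is a rational function, continuous at 0 with
    denominator (1 + A)^2; there gamma disappears, and 2 cos^2 is rewritten with the double
    angle. *)
Lemma transmission_lim_infty d al a gamma : 0 <= al < 1 ->
  filterlim (fun E => transmission d al a gamma E) (Rbar_locally p_infty)
    (locally (2 * (Cmod a) ^ 2 * (1 + cos (PI * al)) / (1 + (Cmod a) ^ 2) ^ 2)).
Proof.
intros Hal.
set (A := Cmod a ^ 2); set (g := (1 + al) * gamma).
assert (HA : 0 <= A) by apply pow2_ge_0.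
set (phi := fun z => 4 * A * cos (PI / 2 * al) ^ 2 /
    (((1 + A) * sin (PI / 2 * al) - g * z) ^ 2 + ((1 + A) * cos (PI / 2 * al)) ^ 2)).
assert (Q := sin2_cos2 (PI / 2 * al)); unfold Rsqr in Q.
assert (D0 : ((1 + A) * sin (PI / 2 * al) - g * 0) ^ 2 + ((1 + A) * cos (PI / 2 * al)) ^ 2 = (1 + A) ^ 2).
{ set (s := sin _) in *; set (c := cos _) in *.
  transitivity ((1 + A) ^ 2 * (s * s + c * c)); [|rewrite Q]; ring. }
assert (P0 : phi 0 = 2 * A * (1 + cos (PI * al)) / (1 + A) ^ 2).
{ unfold phi; rewrite D0.
  replace (PI * al) with (2 * (PI / 2 * al)) by field; rewrite cos_2a_cos; field; lra. }
rewrite <- P0.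
apply (filterlim_ext_loc (fun E => phi (/ impedance al E))).
  exists 0; intros E HE; symmetry; now apply transmission_inv_impedance.
apply (filterlim_comp _ _ _ (fun E => / impedance al E) phi _ (locally 0)).
  now apply impedance_lim_infty.
apply (ex_derive_continuous (K := R_AbsRing) (V := R_NormedModule) phi 0).
unfold phi; auto_derive; rewrite ?D0.
assert (0 < (1 + A) ^ 2) by (apply pow_lt; lra).
simpl in D0; simpl in H; intros K; revert D0; simpl; intros; lra.
Qed.

(** The numerator vanishes at zero impedance, while the denominator is ((1 + al) gamma)^2, nonzero
    exactly because gamma is. *)
Lemma transmission_lim_0 d al a gamma : 0 <= al < 1 -> gamma <> 0 ->
  filterlim (fun E => transmission d al a gamma E) (at_right 0) (locally 0).
Proof.
intros Hal Hg.
set (A := Cmod a ^ 2).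
set (phi := fun Z => 4 * A * (Z * cos (PI / 2 * al)) ^ 2 / det2 al A gamma Z).
assert (D0 : det2 al A gamma 0 = ((1 + al) * gamma) ^ 2) by (unfold det2; ring).
assert (Dn : det2 al A gamma 0 <> 0).
{ rewrite D0; apply pow_nonzero, Rmult_integral_contrapositive; split; lra. }
replace (locally 0) with (locally (phi 0)) by (f_equal; unfold phi, Rdiv; ring).
apply (filterlim_ext_loc (fun E => phi (impedance al E))).
  generalize (at_right_lt 0 1 Rlt_0_1); apply filter_imp; intros E HE; symmetry; now apply transmission_real.
apply (filterlim_comp _ _ _ (impedance al) phi _ (locally 0)).
  now apply impedance_lim_0.
apply (ex_derive_continuous (K := R_AbsRing) (V := R_NormedModule) phi 0).
unfold phi, det2 in *; auto_derive; exact Dn.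
Qed.

Lemma reflection_lim d al a gamma F {FF : Filter F} (l : R) : 0 <= al < 1 ->
  F (fun E => 0 < E) ->
  filterlim (fun E => transmission d al a gamma E) F (locally l) ->
  filterlim (fun E => reflection d al a gamma E) F (locally (1 - l)).
Proof.
intros Hal HF Hl.
apply (filterlim_ext_loc (fun E => 1 + - transmission d al a gamma E)).
  revert HF; apply filter_imp; intros E HE; symmetry; now apply reflection_real.
apply filterlimR_plus; [easy|apply filterlim_const|now apply filterlimR_opp].
Qed.

(** For |a| = 1 the reflection vanishes when the real part of [coupling_det] does, that is when 2 Z
    sin th = (1 + al) gamma, with Z the impedance. As Z is proportional to E^((1 + al) / 2) and 1 -
    cos (2 th) = 2 sin^2 th, the given E solves this equation; al > 0 makes sin th positive. *)
Lemma reflection_zero d al a gamma E : 0 < al < 1 -> Cmod a = 1 -> 0 < gamma ->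
  E = Rpower
        ((Rpower 2 (1 + al) * gamma * Gamma ((3 + al) / 2) * sin (PI / 2 * al))
         / (Gamma ((1 - al) / 2) * (1 - cos (PI * al))))
        (2 / (1 + al)) ->
  reflection d al a gamma E = 0.
Proof.
intros Hal Ha Hg HE.
assert (Hal' : 0 <= al < 1) by lra.
assert (E0 : 0 < E) by (rewrite HE; apply Rpower_pos).
rewrite (reflection_real d al a gamma E Hal' E0), (transmission_real d al a gamma E Hal' E0).
assert (Hd := det2_pos al (Cmod a ^ 2) gamma _ Hal' (pow2_ge_0 _) (impedance_pos al E Hal')).
set (th := PI / 2 * al) in *.
assert (Hs : 0 < sin th).
{ generalize PI_RGT_0; intros; apply sin_gt_0; unfold th; nra. }
assert (HG1 := Gamma_pos ((1 - al) / 2) ltac:(lra)).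
assert (HG := Gamma_pos ((1 + al) / 2) ltac:(lra)).
assert (HP := Rpower_pos 2 al).
assert (Ec : 1 - cos (PI * al) = 2 * sin th ^ 2).
{ replace (PI * al) with (2 * th) by (unfold th; field); rewrite cos_2a_sin; ring. }
assert (Key : 2 * (impedance al E * sin th) = (1 + al) * gamma).
{ apply Rmult_eq_reg_l with (Rpower 2 al * Gamma ((1 + al) / 2)); [|apply Rgt_not_eq; nra].
  rewrite <- coupling_scale by easy.
  transitivity (2 * sin th * (Rpower 2 al * Gamma ((1 + al) / 2) * impedance al E)); [ring|].
  rewrite <- impedance_scale by easy.
  rewrite HE, Rpower_mult.
  replace (2 / (1 + al) * ((1 + al) / 2)) with 1 by (field; lra).
  rewrite Rpower_1, Ec; [field; split; apply Rgt_not_eq; assumption|].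
  rewrite Ec; apply Rmult_lt_0_compat.
  - repeat apply Rmult_lt_0_compat; try easy; [apply Rpower_pos|apply Gamma_pos; lra].
  - apply Rinv_0_lt_compat, Rmult_lt_0_compat; [easy|]; apply Rmult_lt_0_compat; [lra|now apply pow_lt]. }
replace (det2 al (Cmod a ^ 2) gamma (impedance al E))
  with (4 * Cmod a ^ 2 * (impedance al E * cos th) ^ 2) in *.
- rewrite Rdiv_diag by lra; ring.
- unfold det2; fold th; rewrite Ha, <- Key; ring.
Qed.

Theorem theorem2p5 (alpha : R) (a : C) (gamma : R)
    (Halpha : 0 <= alpha < 1) :
  (* the scattering state exists and is unique, for incidence from either end *)
  (forall (d : incidence) (E : R), 0 < E ->
     exists (f : R -> C) (r t : C),
       scattering_state d alpha a gamma E f r t /\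
       (forall (f' : R -> C) (r' t' : C),
          scattering_state d alpha a gamma E f' r' t' ->
          (forall x : R, x <> 0 -> f' x = f x) /\ r' = r /\ t' = t)) /\
  (* all the claims on the coefficients, for incidence from either end *)
  (forall d : incidence,
    (forall E : R, 0 < E ->
       transmission d alpha a gamma E =
       (Cmod
         ((RtoC (Rpower E ((1 + alpha) / 2)) * (1 + cis (PI * alpha))
           * RtoC (Gamma ((1 - alpha) / 2)) * Cconj a)
          / (RtoC (Rpower E ((1 + alpha) / 2) * Gamma ((1 - alpha) / 2)
                   * (1 + (Cmod a) ^ 2))
             + Ci * RtoC (gamma * Rpower 2 (1 + alpha))
               * cis (PI / 2 * alpha) * RtoC (Gamma ((3 + alpha) / 2))))%C) ^ 2) /\
    (forall E : R, 0 < E ->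
       reflection d alpha a gamma E =
       (Cmod
         ((RtoC (Rpower E ((1 + alpha) / 2) * Gamma ((1 - alpha) / 2))
             * (1 - RtoC ((Cmod a) ^ 2) * cis (PI * alpha))
           + Ci * RtoC (gamma * Rpower 2 (1 + alpha))
               * cis (PI / 2 * alpha) * RtoC (Gamma ((3 + alpha) / 2)))
          / (RtoC (Rpower E ((1 + alpha) / 2) * Gamma ((1 - alpha) / 2)
                   * (1 + (Cmod a) ^ 2))
             + Ci * RtoC (gamma * Rpower 2 (1 + alpha))
               * cis (PI / 2 * alpha) * RtoC (Gamma ((3 + alpha) / 2))))%C) ^ 2) /\
    (forall E : R, 0 < E ->
       transmission d alpha a gamma E + reflection d alpha a gamma E = 1) /\
    (gamma = 0 -> forall E1 E2 : R, 0 < E1 -> 0 < E2 ->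
       transmission d alpha a gamma E1 = transmission d alpha a gamma E2 /\
       reflection d alpha a gamma E1 = reflection d alpha a gamma E2) /\
    (0 < alpha -> Cmod a = 1 -> 0 < gamma ->
       forall E : R,
         E = Rpower
               ((Rpower 2 (1 + alpha) * gamma * Gamma ((3 + alpha) / 2)
                 * sin (PI / 2 * alpha))
                / (Gamma ((1 - alpha) / 2) * (1 - cos (PI * alpha))))
               (2 / (1 + alpha)) ->
         reflection d alpha a gamma E = 0) /\
    is_lim (fun E => transmission d alpha a gamma E) p_infty
      (2 * (Cmod a) ^ 2 * (1 + cos (PI * alpha)) / (1 + (Cmod a) ^ 2) ^ 2) /\
    is_lim (fun E => reflection d alpha a gamma E) p_infty
      ((1 + (Cmod a) ^ 4 - 2 * (Cmod a) ^ 2 * cos (PI * alpha))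
       / (1 + (Cmod a) ^ 2) ^ 2) /\
    (gamma <> 0 ->
       filterlim (fun E => transmission d alpha a gamma E)
         (at_right 0) (locally 0) /\
       filterlim (fun E => reflection d alpha a gamma E)
         (at_right 0) (locally 1))).
Proof.
split; [|intros d; split; [|split; [|split; [|split; [|split; [|split; [|split]]]]]]].
- intros d E HE.
  destruct (scattering_state_exists d alpha a gamma E Halpha HE) as [f [p [_ H]]].
  now exists f, (reflected d alpha a gamma E p), (transmitted d alpha a gamma E p).
- intros E HE; now apply transmission_formula.
- intros E HE; now apply reflection_formula.
- intros E HE; now apply transmission_plus_reflection.
- intros -> E1 E2 H1 H2.
  rewrite !reflection_real, !transmission_gamma_0 by easy; easy.
- intros Ha0 Ha Hg E HE; now apply reflection_zero.
- now apply transmission_lim_infty.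
- assert (HA := pow2_ge_0 (Cmod a)).
  replace ((1 + Cmod a ^ 4 - 2 * Cmod a ^ 2 * cos (PI * alpha)) / (1 + Cmod a ^ 2) ^ 2)
    with (1 - 2 * Cmod a ^ 2 * (1 + cos (PI * alpha)) / (1 + Cmod a ^ 2) ^ 2) by (field; lra).
  apply (reflection_lim d alpha a gamma (Rbar_locally p_infty)); [easy|now exists 0|].
  now apply transmission_lim_infty.
- intros Hg; split; [now apply transmission_lim_0|].
  rewrite <- (Rminus_0_r 1).
  apply reflection_lim; [typeclasses eauto|easy| |now apply transmission_lim_0].
  generalize (at_right_lt 0 1 Rlt_0_1); apply filter_imp; tauto.
Qed.
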